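(* Let $X$ be a Banach space and let $\xi\geq1$ be a countable ordinal. Let $(c_k)_{k\in\mathbb N}$ be a sequence of positive reals satisfying $\sum_{k=1}^\infty c_k^{-1}<\infty$, and for every $k\in\mathbb N$ let $(e_n^k)_n$ be a normalized sequence that belongs to $SM_\xi^w(X)$. Then there exist $(e_n)_n$ in $SM_\xi^w(X)$ and a real $K$ with $\max_{k\in\mathbb N}c_k^{-1}\leq K\leq\sum_{k=1}^\infty c_k^{-1}$ satisfying the following. (i) The sequence $(e_n)_n$ is normalized. (ii) The sequence $(e_n)_n$ $(c_kK)$-dominates $(e_n^k)_n$, for all $k\in\mathbb N$. (iii) For every $l\in\mathbb N$ and every choice of reals $a_1,\dots,a_l$ in $[-1,1]$ we have $\big\|\sum_{j=1}^l a_je_j\big\|\leq K^{-1}\sum_{k=1}^\infty c_k^{-1}\big\|\sum_{j=1}^l a_je_j^k\big\|$.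
   Context: Notation. $\mathbb{N}=\{1,2,\dots\}$. For $M\subseteq\mathbb N$, $[M]^{\infty}$ and $[M]^{<\infty}$ denote the sets of infinite and of finite subsets of $M$. For an infinite (resp. finite) set $L\subseteq\mathbb N$, $L(k)$ is the $k$-th element of $L$ in increasing order; $|s|$ is the cardinality of $s$. Regular thin families. A family $\mathcal R$ of finite subsets of $\mathbb N$ is regular if it is compact (the characteristic functions of its members form a compact subset of $\{0,1\}^{\mathbb N}$ with the product topology), hereditary (it contains all subsets of its members) and spreading (if $s\in\mathcal R$, $t\in[\mathbb N]^{<\infty}$, $|s|=|t|=n$ and $s(i)\leq t(i)$ for $1\leq i\leq n$, then $t\in\mathcal R$). A family $\mathcal F$ is regular thin if it is the set of inclusion-maximal elements of some regular family $\mathcal R$. The order of $\mathcal R$ is $o(\mathcal R)=\rho(\emptyset)$, where $\rho(t)=\sup\{\rho(s)+1: s\in\mathcal R,\ t\subsetneq s\}$ (with $\sup\emptyset=0$), a countable ordinal; and $o(\mathcal F)=o(\mathcal R)$. Put $\mathcal F\upharpoonright L=\{s\in\mathcal F:s\subseteq L\}$, $\widehat{\mathcal F}=\{s: s\subseteq t\text{ for some }t\in\mathcal F\}$, $\widehat{\mathcal F}\upharpoonright L=\{s\in\widehat{\mathcal F}:s\subseteq L\}$; the latter has the subspace topology of $\{0,1\}^{\mathbb N}$ (sets identified with characteristic functions). Plegma families. An $l$-tuple $(s_j)_{j=1}^l$ of nonempty finite subsets of $\mathbb N$ is plegma if (i) $s_i(k)<s_j(k)$ whenever $1\leq i<j\leq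 l$ and $1\leq k\leq\min(|s_i|,|s_j|)$, and (ii) $s_i(k)<s_j(k+1)$ for all $i,j\in\{1,\dots,l\}$ and $1\leq k\leq\min(|s_i|,|s_j|-1)$. $\mathrm{Plm}_k(\mathcal F\upharpoonright L)$ is the set of plegma $k$-tuples of members of $\mathcal F\upharpoonright L$. Spreading models. An $\mathcal F$-sequence in $X$ is a family $(x_s)_{s\in\mathcal F}$ in $X$; an $\mathcal F$-subsequence is $(x_s)_{s\in\mathcal F\upharpoonright L}$ with $L\in[\mathbb N]^\infty$. Let $(e_n)_n$ be a Hamel basis of an infinite-dimensional seminormed space $(E,\|\cdot\|_* )$. $(x_s)_{s\in\mathcal F\upharpoonright M}$ generates $(e_n)_n$ as an $\mathcal F$-spreading model if there is a null sequence $(\delta_n)_n$ of positive reals such that for all $1\leq k\leq l$, all $a_1,\dots,a_k\in[-1,1]$ and all $(s_j)_{j=1}^k\in\mathrm{Plm}_k(\mathcal F\upharpoonright M)$ with $s_1(1)\geq M(l)$, $\big|\,\|\sum_{j=1}^k a_jx_{s_j}\|-\|\sum_{j=1}^k a_je_j\|_*\big|\leq\delta_l$. $(x_s)_{s\in\mathcal F\upharpoonright L}$ is subordinated if there is a map $\widehat\varphi:\widehat{\mathcal F}\upharpoonright L\to X$, continuous for the weak topology of $X$, with $\widehat\varphi(s)=x_s$ for all $s\in\mathcal F\upharpoonright L$. It is weakly null if for every $x^*\in X^*$ and $\varepsilon>0$ there is $n_0$ such that $|x^*(x_s)|<\varepsilon$ for every $s\in\mathcal F\upharpoonright L$ with $\min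 s\geq n_0$. $SM_\xi^w(X)$ is the set of all sequences $(e_n)_n$ generated as an $\mathcal F$-spreading model by some subordinated weakly null $\mathcal F$-subsequence in $X$, for some regular thin family $\mathcal F$ of order $\xi$. Normalized means $\|e_n\|=1$ for all $n$. For $C>0$, $(e_n^2)_n$ $C$-dominates $(e_n^1)_n$ if $\|\sum_{i=1}^n a_ie_i^1\|\leq C\|\sum_{i=1}^n a_ie_i^2\|$ for all $n\in\mathbb N$ and all reals $a_1,\dots,a_n$. The symbol $\|\cdot\|$ applied to linear combinations of a member of $SM_\xi^w(X)$ denotes the seminorm of the space it spans. *)

(* Defs.v *)
From HB Require Import structures.
From mathcomp Require Import all_boot all_order all_algebra finmap.
From mathcomp Require Import all_classical all_reals all_analysis.

Set Implicit Arguments.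
Unset Strict Implicit.
Unset Printing Implicit Defensive.

Import Order.TTheory GRing.Theory Num.Theory.
Import numFieldNormedType.Exports.

Local Open Scope classical_set_scope.
Local Open Scope ring_scope.

(** Conventions.  The set {1, 2, ...} is represented by [nat] through the order
    isomorphism n |-> n - 1 (only its order is used), and sequences and
    enumerations are indexed from 0.  An infinite subset L of [nat] is given by
    its increasing enumeration [L : nat -> nat]; thus the k-th element of L is
    [L k.-1].  Cardinalities and numbers of terms (the k, l below) are
    genuine natural numbers. *)

(** [Osup f] is the supremum of the successors of the values of [f].  Every
    countable ordinal is represented, but not uniquely: ordinals are to be
    compared with [ole] and [oeq], never with [=]. *)
Inductive cord : Type := Osup of (nat -> option cord).

Definition ozero : cord := Osup (fun=> None).

Definition osucc (a : cord) : cord := Osup (fun=> Some a).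

Fixpoint ole (a b : cord) {struct a} : Prop :=
  match a, b with
  | Osup f, Osup g =>
      forall n, match f n with
                | None => True
                | Some a' => exists m, match g m with
                                       | None => False
                                       | Some b' => ole a' b'
                                       end
                end
  end.

Definition oeq (a b : cord) : Prop := ole a b /\ ole b a.

Definition is_osup (A : set cord) (a : cord) : Prop :=
  (forall b, A b -> ole b a) /\
  (forall c, (forall b, A b -> ole b c) -> ole a c).

(** [selt s k] is the element of [s] of index k (from 0) in increasing order;
    it is meaningful only for [k < #|` s|]. *)
Definition selt (s : {fset nat}) (k : nat) : nat := nth 0%N (sort leq s) k.

Definition charf (s : {fset nat}) : cantor_space := fun n => n \in s.

Definition hereditary (F : set {fset nat}) : Prop :=
  forall s t : {fset nat}, F t -> (s `<=` t)%fset -> F s.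

Definition spreading (F : set {fset nat}) : Prop :=
  forall s t : {fset nat}, F s -> #|` s| = #|` t| ->
    (forall i, (i < #|` s|)%N -> (selt s i <= selt t i)%N) -> F t.

Definition regular (F : set {fset nat}) : Prop :=
  [/\ compact (charf @` F), hereditary F & spreading F].

Definition maximals (F : set {fset nat}) : set {fset nat} :=
  [set s | F s /\ forall t, F t -> (s `<=` t)%fset -> t = s].

(** [t] ranges over all finite sets; for hereditary F, the condition for [t]
    outside F just says that [rho t] is zero. *)
Definition is_rank (F : set {fset nat}) (rho : {fset nat} -> cord) : Prop :=
  forall t, is_osup [set osucc (rho s) | s in [set s | F s /\ (t `<` s)%fset]]
                    (rho t).

Definition has_order (F : set {fset nat}) (xi : cord) : Prop :=
  exists rho, is_rank F rho /\ oeq (rho fset0) xi.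

Definition regular_thin_of_order (F : set {fset nat}) (xi : cord) : Prop :=
  exists G, [/\ regular G, F = maximals G & has_order G xi].

Definition restr (F : set {fset nat}) (L : nat -> nat) : set {fset nat} :=
  [set s | F s /\ forall n, n \in s -> range L n].

Definition hat (F : set {fset nat}) : set {fset nat} :=
  [set s | exists2 t, F t & (s `<=` t)%fset].

Definition plegma (l : nat) (s : 'I_l -> {fset nat}) : Prop :=
  [/\ forall j, s j != fset0,
      forall (i j : 'I_l) k, (i < j)%N ->
        (k < minn #|` s i| #|` s j|)%N -> (selt (s i) k < selt (s j) k)%N
    & forall (i j : 'I_l) k,
        (k < minn #|` s i| #|` s j|.-1)%N ->
        (selt (s i) k < selt (s j) k.+1)%N].

Definition Plm (l : nat) (F : set {fset nat}) : set ('I_l -> {fset nat}) :=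
  [set s | plegma s /\ forall j, F (s j)].

Record dual (R : realType) (X : normedModType R) := Dual {
  dual_fun :> {linear X -> R^o};
  dual_continuous : continuous dual_fun }.

Definition eval_dual (R : realType) (X : normedModType R) (x : X) :
  prod_topology (fun _ : dual X => R^o) := fun f => f x.

(** [X] with the coarsest topology making all the elements of the dual
    continuous. *)
Definition weak_space (R : realType) (X : normedModType R) :=
  initial_topology (@eval_dual R X).

(** A seminormed space together with a Hamel basis indexed by [nat]; it is
    therefore infinite dimensional. *)
Record seminormed_basis (R : realType) := SeminormedBasis {
  sb_space : lmodType R;
  sb_norm : sb_space -> R;
  sb_vec :> nat -> sb_space;
  sb_norm_ge0 : forall x, 0 <= sb_norm x;
  sb_normD : forall x y, sb_norm (x + y) <= sb_norm x + sb_norm y;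
  sb_normZ : forall (a : R) x, sb_norm (a *: x) = `|a| * sb_norm x;
  sb_free : forall n (a : 'I_n -> R),
    \sum_(i < n) a i *: sb_vec i = 0 -> forall i, a i = 0;
  sb_span : forall x, exists n (a : 'I_n -> R),
    x = \sum_(i < n) a i *: sb_vec i }.

Definition comb_norm (R : realType) (e : seminormed_basis R) (n : nat)
  (a : 'I_n -> R) : R := sb_norm (\sum_(i < n) a i *: e i).

Definition normalized (R : realType) (e : seminormed_basis R) : Prop :=
  forall n, sb_norm (e n) = 1.

Definition dominates (R : realType) (C : R) (e2 e1 : seminormed_basis R) : Prop :=
  forall n (a : 'I_n -> R), comb_norm e1 a <= C * comb_norm e2 a.

(** An F-sequence is represented by a total function on finite sets, whose
    values outside F are irrelevant.  The number of vectors, [k.+1], ranges over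
    the positive integers. *)
Definition generates (R : realType) (X : normedModType R)
  (F : set {fset nat}) (x : {fset nat} -> X) (L : nat -> nat) (e : seminormed_basis R) : Prop :=
  exists delta : nat -> R,
    [/\ forall n, 0 < delta n,
        delta @ \oo --> (0 : R)
      & forall (k l : nat) (a : 'I_k.+1 -> R) (s : 'I_k.+1 -> {fset nat}),
          (k.+1 <= l)%N ->
          (forall j, -1 <= a j <= 1) ->
          Plm (restr F L) s ->
          (L l.-1 <= selt (s ord0) 0)%N ->
          `| `|\sum_(j < k.+1) a j *: x (s j)| - comb_norm e a | <= delta l].

Definition subordinated (R : realType) (X : normedModType R)
  (F : set {fset nat}) (x : {fset nat} -> X) (L : nat -> nat) : Prop :=
  exists phi : cantor_space -> weak_space X,
    {within charf @` (restr (hat F) L), continuous phi} /\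
    (forall s, restr F L s -> phi (charf s) = x s).

Definition weakly_null (R : realType) (X : normedModType R)
  (F : set {fset nat}) (x : {fset nat} -> X) (L : nat -> nat) : Prop :=
  forall (f : dual X) (eps : R), 0 < eps ->
    exists n0 : nat, forall s, restr F L s ->
      (n0 <= selt s 0)%N -> `|f (x s)| < eps.

Definition SMw (R : realType) (X : normedModType R) (xi : cord)
  (e : seminormed_basis R) : Prop :=
  exists (F : set {fset nat}) (x : {fset nat} -> X) (L : nat -> nat),
    [/\ regular_thin_of_order F xi, {homo L : m n / (m < n)%N},
        subordinated F x L, weakly_null F x L & generates F x L e].

(* Main.v *)
From HB Require Import structures.
Require Import Defs.
From mathcomp Require Import all_boot all_order all_algebra finmap.
From mathcomp Require Import all_classical all_reals all_analysis.
From mathcomp Require Import ring lra zify.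
Import Order.TTheory GRing.Theory Num.Theory.
Import numFieldNormedType.Exports.
Local Open Scope classical_set_scope.
Local Open Scope ring_scope.

(** Why the theorem is true.

    All the members of [SMw X xi] are generated along regular thin families of
    one and the same order. Pulled back to a sparse set, such a family becomes
    a tree of finite increasing sequences that every infinite set [B] leaves
    at exactly one maximal node, and a subordinated weakly null sequence becomes
    a [weak_tree]: a map into [X] on these nodes, weakly continuous, null at the
    root, whose value at the node where [B] leaves is written
    [branch_value Phi B] ([tree_of_SMw]). Plegma tuples become tuples of
    interleaved infinite sets, and a tuple is coded by a single infinite set.

    Let [b k = (c k)^-1] and let [Phi k] be the tree of [ek k]. For a block of
    [n * n] interleaved infinite sets, indexed by [j] and [k], consider
    [\sum_j \sum_k a_j b_k (value of Phi k at the (j, k)-th set)]. Its norm is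
    a function of one infinite set that depends on a finite part of that set
    only; a Ramsey theorem for such functions ([ramsey_diagonal]) makes it
    asymptotically constant, and the constants define a seminorm on finite
    sequences of scalars, that is, on polynomials ([asymptotic_norm]). Its value
    at a unit vector is [K], and the normalized seminorm is the one of [e].

    The upper bounds, for the norm of [e] and for [K], are the triangle inequality
    ([asymptotic_norm_le]). The domination and [b k <= K] need that the
    terms belonging to the other trees do not cancel those of [Phi k]
    ([asymptotic_norm_ge]). This is [suppression]: a functional norming the
    terms of [Phi k] can be found before the elements of the other branches are
    chosen, because a weak-star cluster point may replace the functionals
    that depend on later elements; weak nullity then makes it small on the other
    branches. It is for this purpose that different trees are read along
    different, interleaved sets.

    It remains to see that the seminorm is generated along a regular thin family
    of order [xi]: the one of [ek 0]. As the orders agree, a suitable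
    shift of the elements turns the maximal members of that family into sequences
    long enough to leave the tree of [ek k] ([compare_families]). The sums above,
    read along translates of a sparse image of [s] and truncated at a level that
    grows with the least element of [s], are therefore functions of the member
    [s] of the family ([zvec]). They inherit weak continuity and weak nullity, and
    plegma tuples of members extend to interleaved infinite sets
    ([plegma_branches]), where the asymptotic norm applies. *)

Set Implicit Arguments.
Unset Strict Implicit.
Unset Printing Implicit Defensive.

(** * Norming functionals and weak-star cluster points *)

Section NormingFunctional.
Variables (R : realType) (X : normedModType R).
Implicit Types (p : X -> R) (x y z : X).

Definition sublinear_below_norm p : Prop :=
  [/\ forall x y, p (x + y) <= p x + p y,
      forall (a : R) x, 0 <= a -> p (a *: x) = a * p x
    & forall x, p x <= `|x|].

Lemma sublinear0 p : sublinear_below_norm p -> p 0 = 0.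
Proof. by case=> _ pZ _; rewrite -(scale0r 0) pZ// mul0r. Qed.

Lemma sublinear_ge p x : sublinear_below_norm p -> - p (- x) <= p x.
Proof.
move=> sp; have [pD _ _] := sp.
by have := pD x (- x); rewrite subrr sublinear0 //; lra.
Qed.

(** Tilting [p] makes its value at [- z] as small as a sublinear functional below
    [p] can have it, namely [- p z]; a minimal sublinear functional is equal to
    all its tilts and is therefore additive. *)
Definition tilt p z x : R := inf [set p (x + t *: z) - t * p z | t in [set t | 0 <= t]].

Lemma tilt_has_inf p z x : sublinear_below_norm p ->
  has_inf [set p (x + t *: z) - t * p z | t in [set t | 0 <= t]].
Proof.
move=> sp; have [pD pZ _] := sp; split; first by exists (p (x + 0 *: z) - 0 * p z), 0 => //=.
exists (- p (- x)) => _ [t /= t0 <-].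
have := pD (- x) (x + t *: z); rewrite addrA addNr add0r pZ //; lra.
Qed.

Lemma tilt_le p z x t : sublinear_below_norm p -> 0 <= t ->
  tilt p z x <= p (x + t *: z) - t * p z.
Proof.
move=> sp t0; apply: ge_inf; last by exists t.
by have [] := tilt_has_inf z x sp.
Qed.

Lemma tilt_sublinear p z : sublinear_below_norm p -> sublinear_below_norm (tilt p z).
Proof.
move=> sp; have [pD pZ pn] := sp; have hi x := tilt_has_inf z x sp; split.
- move=> x y; apply/ler_addgt0Pr => e e0.
  have [_ [t /= t0 <-] Ht] := inf_adherent (divr_gt0 e0 (ltr0n R 2)) (hi x).
  have [_ [s /= s0 <-] Hs] := inf_adherent (divr_gt0 e0 (ltr0n R 2)) (hi y).
  have := tilt_le z (x + y) sp (addr_ge0 t0 s0).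
  have := pD (x + t *: z) (y + s *: z).
  rewrite addrACA -scalerDl; rewrite -/(tilt p z x) in Ht; rewrite -/(tilt p z y) in Hs.
  lra.
- move=> a x; rewrite le_eqVlt => /predU1P[<-|a0].
    rewrite scale0r mul0r; apply/eqP; rewrite eq_le; apply/andP; split.
      by apply: le_trans (tilt_le z 0 sp (lexx 0)) _; rewrite scale0r add0r sublinear0// mul0r subrr.
    apply: lb_le_inf; first by have [] := hi 0.
    by move=> _ [t /= t0 <-]; rewrite add0r pZ// subrr.
  apply/eqP; rewrite eq_le; apply/andP; split.
    rewrite -ler_pdivrMl//; apply: lb_le_inf; first by have [] := hi x.
    move=> _ [t /= t0 <-]; rewrite ler_pdivrMl//.
    apply: le_trans (tilt_le z _ sp (mulr_ge0 (ltW a0) t0)) _.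
    by rewrite -scalerA -scalerDr pZ ?(ltW a0)// mulrBr mulrA.
  apply: lb_le_inf; first by have [] := hi (a *: x).
  move=> _ [t /= t0 <-].
  have ta : 0 <= t / a by rewrite divr_ge0// ltW.
  apply: le_trans (ler_wpM2l (ltW a0) (tilt_le z x sp ta)) _.
  have ata : a * (t / a) = t by rewrite mulrC divfK ?gt_eqF.
  by rewrite mulrBr -(pZ _ _ (ltW a0)) scalerDr scalerA ata mulrA ata.
- by move=> x; have := tilt_le z x sp (lexx 0); rewrite scale0r addr0 mul0r subr0 => /le_trans; apply.
Qed.

Definition sublinear_fun := {p : X -> R | sublinear_below_norm p}.

(** Zorn's lemma: the pointwise infimum of a chain is sublinear, being bounded
    below by [- `|x|]. *)
Lemma minimal_sublinear (p0 : sublinear_fun) :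
  exists2 p : sublinear_fun, (forall x, sval p x <= sval p0 x) &
    forall q : sublinear_fun, (forall x, sval q x <= sval p x) -> q = p.
Proof.
pose T := {p : sublinear_fun | forall x, sval p x <= sval p0 x}.
pose Rel (p q : T) := `[< forall x, sval (sval q) x <= sval (sval p) x >].
have [||||[p pp0] pmin] := @Zorn T Rel.
- by move=> t; apply/asboolP.
- move=> r s t /asboolP rs /asboolP st; apply/asboolP => x.
  exact: le_trans (st x) (rs x).
- move=> [[s ss] s0] [[t st] t0] /asboolP /= ts /asboolP /= tt.
  have est : s = t by apply/funext => x; apply/eqP; rewrite eq_le tt ts.
  by subst t; have e : ss = st by []; subst st; have -> : s0 = t0 by [].
- move=> A totA; have [[a0 Aa0]|A0] := pselect (exists a, A a); last first.
    have p0p0 : forall x, sval p0 x <= sval p0 x by [].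
    exists (exist _ p0 p0p0) => s As; by exfalso; apply: A0; exists s.
  pose m x := inf [set sval (sval p) x | p in A].
  have hm x : has_inf [set sval (sval p) x | p in A].
    split; first by exists (sval (sval a0) x), a0.
    exists (- `|x|) => _ [[[q sq] qp] /= _ <-].
    have := sublinear_ge x sq; have [_ _ /(_ (- x))] := sq; rewrite normrN; lra.
  have mle x (p : T) : A p -> m x <= sval (sval p) x.
    by move=> Ap; apply: ge_inf; [have [] := hm x|exists p].
  have sm : sublinear_below_norm m.
    split.
    - move=> x y; apply/ler_addgt0Pr => e e0.
      have [_ [p /= Ap <-] Hp] := inf_adherent (divr_gt0 e0 (ltr0n R 2)) (hm x).
      have [_ [q /= Aq <-] Hq] := inf_adherent (divr_gt0 e0 (ltr0n R 2)) (hm y).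
      rewrite -/(m x) in Hp; rewrite -/(m y) in Hq.
      have [/asboolP pq|/asboolP qp] := totA p q Ap Aq.
        have [/(_ x y) D _ _] := svalP (sval q).
        by have := mle (x + y) _ Aq; have := pq x; lra.
      have [/(_ x y) D _ _] := svalP (sval p).
      by have := mle (x + y) _ Ap; have := qp y; lra.
    - move=> a x; rewrite le_eqVlt => /predU1P[<-|apos].
        rewrite scale0r mul0r; rewrite /m.
        have -> : [set sval (sval p) 0 | p in A] = [set 0].
          apply/seteqP; split=> [_ [p _ <-]|_ ->] /=.
            by rewrite sublinear0//; exact: svalP.
          by exists a0 => //; rewrite sublinear0//; exact: svalP.
        by rewrite inf1.
      have scal (p : T) y : sval (sval p) (a *: y) = a * sval (sval p) y.
        by have [_ -> //] := svalP (sval p); exact: ltW.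
      apply/eqP; rewrite eq_le; apply/andP; split.
        rewrite -ler_pdivrMl//; apply: lb_le_inf; first by have [] := hm x.
        by move=> _ [p Ap <-]; rewrite ler_pdivrMl// -scal mle.
      apply: lb_le_inf; first by have [] := hm (a *: x).
      by move=> _ [p Ap <-]; rewrite scal ler_pM2l// mle.
    - by move=> x; apply: le_trans (mle x _ Aa0) _; have [] := svalP (sval a0).
  have mp0 x : m x <= sval p0 x := le_trans (mle x _ Aa0) (svalP a0 x).
  exists (exist _ (exist _ m sm) mp0) => s As; apply/asboolP => x /=; exact: mle.
exists p => // q qp.
have qp0 x : sval q x <= sval p0 x := le_trans (qp x) (pp0 x).
have /pmin/(congr1 sval)//= : Rel (exist _ p pp0) (exist _ q qp0) by apply/asboolP.
Qed.

Lemma minimal_sublinear_additive (p : sublinear_fun) :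
  (forall q : sublinear_fun, (forall x, sval q x <= sval p x) -> q = p) ->
  forall x z, sval p (x + z) = sval p x + sval p z.
Proof.
case: p => p sp pmin x z /=; have [pD _ _] := sp.
have /(_ _)/(congr1 sval)/= pz := pmin (exist _ (tilt p z) (tilt_sublinear z sp)).
have {}pz : tilt p z = p.
  by apply: pz => y; have := tilt_le z y sp (lexx 0); rewrite scale0r addr0 mul0r subr0.
apply/eqP; rewrite eq_le pD /=.
by have := tilt_le z x sp ler01; rewrite pz scale1r mul1r; lra.
Qed.

Definition norm_le1 (f : dual X) := forall x, `|f x| <= `|x|.

Lemma dual_of_bounded (g : X -> R) (C : R) :
  (forall x y, g (x + y) = g x + g y) -> (forall a x, g (a *: x) = a * g x) ->
  (forall x, `|g x| <= C * `|x|) -> exists f : dual X, forall x, f x = g x.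
Proof.
move=> gD gZ gC.
have gL : linear (g : X -> R^o) by move=> a x y; rewrite gD gZ.
pose gl := GRing.isLinear.Build R X R^o *:%R g gL.
pose g' : {linear X -> R^o} := HB.pack (g : X -> R^o) gl.
suff g'c : continuous g' by exists (Dual g'c).
apply: bounded_linear_continuous; apply/linear_boundedP; near=> r => x.
apply: le_trans (gC x) _; apply: ler_wpM2r => //; near: r; exact: nbhs_pinfty_ge.
Unshelve. all: by end_near. Qed.

(** A minimal sublinear functional below the tilt of the norm along [y]. *)
Theorem norming_functional (y : X) : exists2 f : dual X, norm_le1 f & f y = `|y|.
Proof.
have sn : sublinear_below_norm (fun x : X => `|x|).
  split=> // [x z|a x a0]; first exact: ler_normD.
  by rewrite normrZ ger0_norm.
pose p0 : sublinear_fun := exist _ _ (tilt_sublinear y sn).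
have [p pp0 pmin] := minimal_sublinear p0.
have pD := minimal_sublinear_additive pmin.
have [_ pZ pn] := svalP p.
have pN x : sval p (- x) = - sval p x.
  by apply/eqP; rewrite -addr_eq0 -pD addNr (sublinear0 (svalP p)).
have pZ' a x : sval p (a *: x) = a * sval p x.
  have [a0|a0] := leP 0 a; first exact: pZ.
  have a0' : 0 <= - a by rewrite oppr_ge0 ltW.
  by rewrite -[a *: x]opprK -scaleNr pN (pZ _ _ a0') mulNr opprK.
have pb x : `|sval p x| <= `|x|.
  by rewrite ler_norml pn andbT lerNl -pN -(normrN x).
have [|f fE] := @dual_of_bounded (sval p) 1 pD pZ'.
  by move=> x; rewrite mul1r.
exists f; first by move=> x; rewrite fE.
(* At [- y] the tilt is at most its term [t = 1], which is [- `|y|]. *)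
rewrite fE; apply/eqP; rewrite eq_le pn /= -lerN2 -pN.
apply: le_trans (pp0 _) _; apply: le_trans (tilt_le y _ sn ler01) _.
by rewrite scale1r addNr normr0 mul1r sub0r.
Qed.

End NormingFunctional.

Section UltraLimit.
Variable R : realType.

Lemma ultrafilter_nat : exists U : set_system nat,
  UltraFilter U /\ forall N, U [set n | (N <= n)%N].
Proof.
have [U [UU sU]] := @ultraFilterLemma nat \oo _.
by exists U; split => // N; apply: sU; exists N.
Qed.

Lemma ultra_bounded_cvg (U : set_system nat) (u : nat -> R) (C : R) :
  UltraFilter U -> (forall n, `|u n| <= C) -> cvg (u @ U).
Proof.
move=> UU uC; apply/cvg_ex.
have UI : (u @ U) `[- C, C]%classic.
  suff : U [set n | `[- C, C]%classic (u n)] by [].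
  by apply: (@filterS _ _ _ setT) filterT => n _ /=; rewrite in_itv /= -ler_norml uC.
have [x [_ xc]] := @segment_compact R (- C) C (u @ U) _ UI.
exists x => V Vx; have [//|UV] := in_ultra_setVsetC (u @^-1` V) UU.
have [|y []//] := xc (~` V) V _ Vx.
exact: UV.
Qed.

(** The pointwise limit of the functionals along an ultrafilter; finitely many
    strict inequalities at the limit hold on a member of the ultrafilter. *)
Lemma weak_star_cluster (X : normedModType R) (f : nat -> dual X) :
  (forall n, norm_le1 (f n)) ->
  exists2 g : dual X, norm_le1 g &
    forall (ys : seq X) (e : R), (forall y, y \in ys -> `|g y| < e) ->
      forall N, exists2 n, (N <= n)%N & forall y, y \in ys -> `|f n y| < e.
Proof.
move=> f1; have [U [UU Uge]] := ultrafilter_nat.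
have cf x : cvg ((fun n => f n x : R) @ U).
  by apply: (@ultra_bounded_cvg _ _ `|x|) => n; exact: f1.
pose g x : R := lim ((fun n => f n x : R) @ U).
have gl x : (fun n => f n x : R) @ U --> g x := cf x.
have gb x : `|g x| <= `|x|.
  have cn : `|f n x : R| @[n --> U] --> `|g x| by apply: cvg_norm; exact: gl.
  rewrite -(cvg_lim _ cn)//; apply: limr_le; first by apply/cvg_ex; exists `|g x|.
  by apply: nearW => n; exact: f1.
have [|||h hE] := @dual_of_bounded R X g 1.
- move=> x y; apply: (@cvg_unique _ _ (fmap (fun n => f n (x + y) : R) U) _).
  + exact: Rhausdorff.
  + exact: gl.
  + have -> : (fun n => f n (x + y) : R) = (fun n => (f n x : R) + (f n y : R)).
      by apply/funext => n; exact: linearD.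
    by apply: cvgD; exact: gl.
- move=> a x; apply: (@cvg_unique _ _ (fmap (fun n => f n (a *: x) : R) U) _).
  + exact: Rhausdorff.
  + exact: gl.
  + have -> : (fun n => f n (a *: x) : R) = (fun n => a * (f n x : R)).
      by apply/funext => n; exact: linearZ.
    by apply: cvgM; [exact: cvg_cst|exact: gl].
- by move=> x; rewrite mul1r.
exists h; first by move=> x; rewrite hE.
move=> ys e ge N.
suff : U [set n | (N <= n)%N /\ forall y, y \in ys -> `|f n y| < e].
  by move=> /filter_ex[n [Nn ny]]; exists n.
apply: filterI; first exact: Uge.
elim: ys ge => [|y ys IH] ge.
  by apply: (@filterS _ _ _ setT) filterT.
have gy : `|g y| < e by rewrite -hE ge ?mem_head.
have Uy : U [set n | `|f n y| < e].
  have cn : `|f n y : R| @[n --> U] --> `|g y| by apply: cvg_norm; exact: gl.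
  exact: (cvgr_lt _ cn _ gy).
have IH' := IH (fun z zs => ge z (mem_behead (s := y :: ys) zs)).
apply: filterS (filterI Uy IH') => n [ny nys] z.
by rewrite inE => /predU1P[->//|]; exact: nys.
Qed.

End UltraLimit.

(** * A Ramsey theorem for locally constant colourings of infinite sets *)

Definition incr (B : nat -> nat) : Prop := {homo B : m n / (m < n)%N}.

Lemma incr_ge B n : incr B -> (n <= B n)%N.
Proof. by move=> iB; elim: n => // n /leq_ltn_trans; apply; exact: iB. Qed.

Lemma incr_leq B : incr B -> {homo B : m n / (m <= n)%N}.
Proof. by move=> iB m n; rewrite leq_eqVlt => /predU1P[->//|/iB/ltnW]. Qed.

Lemma incr_lt B m n : incr B -> (B m < B n)%N = (m < n)%N.
Proof.
move=> iB; apply/idP/idP; last exact: iB.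
by apply: contraLR; rewrite -!leqNgt; exact: incr_leq.
Qed.

Lemma incr_inj B : incr B -> injective B.
Proof.
move=> iB m n e; case: (ltngtP m n) => // /iB; by rewrite e ltnn.
Qed.

Lemma incrS B : (forall n, (B n < B n.+1)%N) -> incr B.
Proof. exact: (homo_ltn ltn_trans). Qed.

Lemma incr_comp B C : incr B -> incr C -> incr (B \o C).
Proof. by move=> iB iC m n /iC/iB. Qed.

Lemma mkseqSr (B : nat -> nat) n : mkseq B n.+1 = rcons (mkseq B n) (B n).
Proof. by rewrite /mkseq -addn1 iotaD map_cat /= cats1. Qed.

Lemma sorted_rconsE u (b : nat) :
  sorted ltn (rcons u b) = sorted ltn u && all (fun x => x < b)%N u.
Proof.
rewrite -cats1 !(sorted_pairwise ltn_trans) pairwise_cat /= !andbT andbC.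
by congr (_ && _); rewrite /allrel /=; apply: eq_all => x /=; rewrite andbT.
Qed.

Lemma sorted_mkseq B n : incr B -> sorted ltn (mkseq B n).
Proof.
move=> iB; elim: n => // n IH; rewrite mkseqSr sorted_rconsE IH /=.
by apply/allP => x /mapP[i]; rewrite mem_iota add0n => /andP[_ /iB ?] ->.
Qed.

Lemma mkseq_sorted_incr B : (forall n, sorted ltn (mkseq B n)) -> incr B.
Proof.
move=> sB; apply: incrS => n; have := sB n.+2.
rewrite mkseqSr sorted_rconsE => /andP[_ /allP]; apply.
by apply/mapP; exists n => //; rewrite mem_iota /=.
Qed.

(** Either a property holds at the root, or one follows the failures to
    an infinite branch. *)
Lemma bar_induction (P : seq nat -> Prop) :
  (forall B, incr B -> exists n, P (mkseq B n)) ->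
  (forall u, sorted ltn u ->
     (forall b, sorted ltn (rcons u b) -> P (rcons u b)) -> P u) ->
  P [::].
Proof.
move=> bar step; apply: contrapT => P0.
have ex u : exists b, sorted ltn u -> ~ P u -> sorted ltn (rcons u b) /\ ~ P (rcons u b).
  have [[su Pu]|nP] := pselect (sorted ltn u /\ ~ P u); last first.
    by exists 0%N => su Pu; exfalso; apply: nP.
  apply: contrapT => /forallNP nb; apply: Pu; apply: step => // b sb.
  by apply: contrapT => Pb; apply: (nb b).
have [g gP] := choice ex.
pose U := fix U n := if n is n'.+1 then rcons (U n') (g (U n')) else [::].
have UE n : U n = mkseq (fun i => g (U i)) n by elim: n => // n IH; rewrite mkseqSr -IH.
have UP n : sorted ltn (U n) /\ ~ P (U n) by elim: n => // n [sU PU]; exact: gP.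
have iB : incr (fun i => g (U i)) by apply: mkseq_sorted_incr => n; rewrite -UE; case: (UP n).
by have [n] := bar _ iB; rewrite -UE; case: (UP n).
Qed.

Lemma incr_extract (P : nat -> Prop) :
  (forall N, exists2 n, (N <= n)%N & P n) -> exists2 e, incr e & forall i, P (e i).
Proof.
move=> infP; have ex N : exists n, (N <= n)%N /\ P n by have [n] := infP N; exists n.
have [g gP] := choice ex.
pose e := fix e n := if n is n'.+1 then g (e n').+1 else g 0%N.
exists e; first by apply: incrS => n /=; case: (gP (e n).+1).
by case=> [|n] /=; [case: (gP 0%N)|case: (gP (e n).+1)].
Qed.

Lemma infinite_pigeonhole (T : finType) (c : nat -> T) :
  exists t, forall N, exists2 n, (N <= n)%N & c n = t.
Proof.
apply: contrapT => /forallNP H.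
have ex t : exists N, forall n, (N <= n)%N -> c n <> t.
  apply: contrapT => nex; apply: (H t) => N; apply: contrapT => nN.
  by apply: nex; exists N => n Nn cn; apply: nN; exists n.
have [g gP] := choice ex.
pose n := (\max_t g t)%N.
by apply: (gP (c n) n) => //; exact: leq_bigmax.
Qed.

Definition tail_of (N M : nat -> nat) : Prop := forall i, exists2 j, (0 < j)%N & N i = M j.

(** The diagonal set [fun n => Ms n 0] is, from its [n]-th element on,
    contained in [Ms n], hence enjoys every requirement [S n] up to finitely many
    elements. *)
Lemma fusion (S : nat -> (nat -> nat) -> (nat -> nat) -> Prop) (M : nat -> nat) :
  (forall n M, incr M -> exists N, [/\ incr N, tail_of N M & S n M N]) ->
  incr M ->
  exists Ms : nat -> nat -> nat,
    [/\ Ms 0%N = M, forall n, S n (Ms n) (Ms n.+1), incr (fun n => Ms n 0%N) &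
        forall i j, (i <= j)%N -> exists k, Ms j 0%N = Ms i k].
Proof.
move=> step iM.
have ex (nM : nat * (nat -> nat)) : exists N, incr nM.2 ->
    [/\ incr N, tail_of N nM.2 & S nM.1 nM.2 N].
  have [iN|ni] := pselect (incr nM.2); last by exists nM.2.
  by have [N NP] := step nM.1 nM.2 iN; exists N.
have [g gP] := choice ex.
pose Ms := fix Ms n := if n is n'.+1 then g (n', Ms n') else M.
have iMs n : incr (Ms n) by elim: n => // n IH /=; have [] := gP (n, Ms n) IH.
have MsP n : tail_of (Ms n.+1) (Ms n) /\ S n (Ms n) (Ms n.+1).
  by have [] := gP (n, Ms n) (iMs n).
exists Ms; split => //.
- by move=> n; case: (MsP n).
- apply: incrS => n; have [/(_ 0%N)[j j0 ->] _] := MsP n; exact: iMs.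
- move=> i j /subnK <-; elim: (j - i)%N 0%N => [|d IH] k; first by exists k.
  rewrite addSn; have [/(_ k)[k' _ ->] _] := MsP (d + i)%N; exact: IH.
Qed.

Definition locally_constant T (col : (nat -> nat) -> T) : Prop :=
  forall B, incr B -> exists n, forall B', incr B' ->
    (forall i, (i < n)%N -> B' i = B i) -> col B' = col B.

Definition prepend (u : seq nat) (B : nat -> nat) : nat -> nat :=
  fun i => if (i < size u)%N then nth 0%N u i else B (i - size u)%N.

Lemma prepend_rcons u B : prepend u B = prepend (rcons u (B 0%N)) (fun i => B i.+1).
Proof.
apply/funext => i; rewrite /prepend size_rcons nth_rcons ltnS.
case: (ltngtP i (size u)) => // [ui|->]; last by rewrite subnn.
by congr B; rewrite -subSn.
Qed.

Lemma mkseq_prepend u B : mkseq (prepend u B) (size u) = u.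
Proof.
apply: (@eq_from_nth _ 0%N); rewrite size_mkseq// => i iu.
by rewrite nth_mkseq// /prepend iu.
Qed.

Lemma seq_bound (u : seq nat) : exists N, all (fun x => x < N)%N u.
Proof.
elim: u => [|x u [N h]]; first by exists 0%N.
exists (maxn N x.+1); rewrite /= leq_max leqnn orbT /=.
by apply: sub_all h => y yN; rewrite leq_max yN.
Qed.

Lemma branch_through u n0 : sorted ltn u -> exists B, [/\ incr B,
  mkseq B (size u) = u & forall i, (size u <= i)%N -> (n0 <= B i)%N].
Proof.
move=> su; have [N NP] := seq_bound u.
exists (prepend u (fun i => n0 + N + i)%N); split; last first.
- by move=> i ui; rewrite /prepend ltnNge ui /=; lia.
- exact: mkseq_prepend.
apply: incrS => n; rewrite /prepend.
case: (ltnP n (size u)) => h1; case: (ltnP n.+1 (size u)) => h2; try lia.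
  exact: (sorted_ltn_nth ltn_trans 0%N su).
have /= := allP NP _ (mem_nth 0%N h1); lia.
Qed.

(** Bar induction on the initial segments that do not yet determine the colour;
    at a node, fusion makes the colour depend on the first new element only,
    and the pigeonhole principle removes that dependence. *)
Lemma ramsey_locally_constant (T : finType) (col : (nat -> nat) -> T) (M : nat -> nat) :
  locally_constant col -> incr M ->
  exists N, [/\ incr N, range N `<=` range M &
    exists c, forall B, incr B -> range B `<=` range N -> col B = c].
Proof.
move=> lc iM.
pose P u := forall M, incr M -> exists N, [/\ incr N, range N `<=` range M &
  exists c, forall B, incr B -> range B `<=` range N -> incr (prepend u B) ->
    col (prepend u B) = c].
suff : P [::].
  move=> /(_ M iM)[N [iN NM [c cP]]]; exists N; split => //; exists c => B iB BN.
  have -> : B = prepend [::] B by apply/funext => i; rewrite /prepend /= subn0.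
  by apply: cP => // i j ij; rewrite /prepend /= !subn0; exact: iB.
apply: bar_induction.
  move=> B iB; have [n nP] := lc B iB; exists n => {}M {}iM; exists M; split => //.
  exists (col B) => B' _ _ ia; apply: nP => // i lin.
  by rewrite /prepend size_mkseq lin nth_mkseq.
move=> u su IH {}M {}iM.
(* After the first new element [M' 0], the colour is constant. *)
pose S (n : nat) (M' N' : nat -> nat) := exists c : T, forall B, incr B -> range B `<=` range N' ->
  incr (prepend (rcons u (M' 0%N)) B) -> col (prepend (rcons u (M' 0%N)) B) = c.
have [|Ms [Ms0 MsS ib bM]] := @fusion S M _ iM.
  move=> n M' iM'; have iM'' : incr (fun i => M' i.+1) by move=> i j ij; exact: iM'.
  have [sb|nsb] := boolP (sorted ltn (rcons u (M' 0%N))); last first.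
    exists (fun i => M' i.+1); split=> // [i|]; first by exists i.+1.
    exists (col M) => B iB _ ip; exfalso; move/negP: nsb; apply.
    have := sorted_mkseq (size u).+1 ip; congr sorted.
    apply: (@eq_from_nth _ 0%N); first by rewrite size_mkseq size_rcons.
    by move=> i; rewrite size_mkseq => iu; rewrite nth_mkseq// /prepend size_rcons iu.
  have [N [iN NM Nc]] := IH _ sb _ iM''; exists N; split => // i.
  have [|j _ <-] := NM (N i); first by exists i.
  by exists j.+1.
have [c cP] := choice MsS.
have [t tP] := infinite_pigeonhole c.
have [e ie et] := incr_extract tP.
exists (fun i => Ms (e i) 0%N); split.
- exact: (incr_comp ib ie).
- move=> _ [i _ <-]; have [k ->] := bM 0%N (e i) (leq0n _).
  by exists k => //; rewrite Ms0.
- exists t => B iB BN ip; have [i _ Bi] : range (fun i => Ms (e i) 0%N) (B 0%N).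
    by apply: BN; exists 0%N.
  rewrite prepend_rcons -Bi -(et i); apply: cP.
  + by move=> m n mn; exact: iB.
  + move=> _ [j _ <-]; have [j' _ Bj] : range (fun i => Ms (e i) 0%N) (B j.+1).
      by apply: BN; exists j.+1.
    have := iB 0%N j.+1 (ltn0Sn _); rewrite -Bi -Bj.
    rewrite (incr_lt _ _ (incr_comp ib ie)) => ij.
    by have [k ->] := bM (e i).+1 (e j') (ie _ _ ij); exists k.
  + by rewrite Bi -prepend_rcons.
Qed.

Theorem ramsey_diagonal (T : nat -> finType) (col : forall n, (nat -> nat) -> T n) :
  (forall n, locally_constant (col n)) ->
  exists2 H, incr H & forall n, exists c, forall B, incr B -> range B `<=` range H ->
    (H n < B 0)%N -> col n B = c.
Proof.
move=> lc.
pose S n (M N : nat -> nat) := exists c, forall B, incr B -> range B `<=` range N ->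
  col n B = c.
have [|//|Ms [_ MsS iH HM]] := @fusion S id.
  move=> n M iM; have iM' : incr (fun i => M i.+1) by move=> i j ij; exact: iM.
  have [N [iN NM Nc]] := ramsey_locally_constant (lc n) iM'; exists N; split => // i.
  have [|j _ <-] := NM (N i); first by exists i.
  by exists j.+1.
exists (fun n => Ms n 0%N) => // n; have [c cP] := MsS n; exists c => B iB BH HB.
apply: cP => // _ [i _ <-].
have [j _ Bj] : range (fun n => Ms n 0%N) (B i) by apply: BH; exists i.
have : (Ms n 0 < Ms j 0)%N by rewrite Bj (leq_trans HB)// incr_leq.
rewrite (incr_lt n j iH) => nj; have [k e] := HM n.+1 j nj.
by exists k => //; rewrite -Bj e.
Qed.

(** * Weak trees *)

Section WeakTree.
Variables (R : realType) (X : normedModType R).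
Implicit Types (Phi : seq nat -> X) (B : nat -> nat) (u w : seq nat).

Definition settled Phi u : Prop :=
  forall w, sorted ltn (u ++ w) -> Phi (u ++ w) = Phi u.

(** An abstract form of a subordinated weakly null family: nodes are finite
    increasing sequences, the vectors of the family are the values at the
    settled nodes, and every infinite branch reaches one of them. *)
Record weak_tree Phi : Prop := WeakTree {
  wt_bar : forall B, incr B -> exists n, settled Phi (mkseq B n);
  wt_cont : forall (f : dual X) u (e : R), sorted ltn u -> 0 < e ->
    exists n, forall w, sorted ltn (u ++ w) -> (forall x, x \in w -> (n <= x)%N) ->
      `|f (Phi (u ++ w)) - f (Phi u)| < e;
  wt_root : forall f : dual X, f (Phi [::]) = 0 }.

(** [xget] picks any level at which the branch is settled. *)
Definition branch_value Phi B : X :=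
  Phi (mkseq B (xget 0%N [set n | settled Phi (mkseq B n)])).

Lemma mkseq_split B m n : (m <= n)%N ->
  mkseq B n = mkseq B m ++ [seq B i | i <- iota m (n - m)].
Proof. by move=> mn; rewrite /mkseq -map_cat -iotaD subnKC. Qed.

Lemma settled_leq Phi B m n : incr B -> (m <= n)%N -> settled Phi (mkseq B m) ->
  settled Phi (mkseq B n) /\ Phi (mkseq B n) = Phi (mkseq B m).
Proof.
move=> iB mn sm; have E : Phi (mkseq B n) = Phi (mkseq B m).
  by rewrite (mkseq_split B mn) sm// -mkseq_split//; exact: sorted_mkseq.
split=> // w; rewrite E (mkseq_split B mn) -catA; exact: sm.
Qed.

Lemma branch_valueE Phi B n : incr B -> settled Phi (mkseq B n) ->
  branch_value Phi B = Phi (mkseq B n).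
Proof.
move=> iB sn; rewrite /branch_value; case: xgetP => [m _ sm|/(_ n)//].
have [mn|/ltnW nm] := leqP m n.
  by have [_ ->] := settled_leq iB mn sm.
by have [_ ->] := settled_leq iB nm sn.
Qed.

Lemma branch_value_settled Phi B : weak_tree Phi -> incr B ->
  exists n, forall m, (n <= m)%N ->
    settled Phi (mkseq B m) /\ branch_value Phi B = Phi (mkseq B m).
Proof.
move=> wt iB; have [n sn] := wt_bar wt iB; exists n => m nm.
by have [sm E] := settled_leq iB nm sn; rewrite (branch_valueE iB sm).
Qed.

Lemma sorted_map_incr B u : incr B -> sorted ltn u -> sorted ltn (map B u).
Proof. by move=> iB; rewrite sorted_map; apply: sub_sorted => x y /iB. Qed.

Lemma settled_map Phi B u : incr B -> settled Phi (map B u) ->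
  settled (Phi \o map B) u.
Proof. by move=> iB s w sw; rewrite /= map_cat s// -map_cat sorted_map_incr. Qed.

Lemma weak_tree_map Phi B : incr B -> weak_tree Phi -> weak_tree (Phi \o map B).
Proof.
move=> iB [bar cont root]; split => //.
- move=> C iC; have [n sn] := bar _ (incr_comp iB iC); exists n.
  by apply: settled_map => //; rewrite /mkseq -map_comp.
- move=> f u e su e0; have [n nP] := cont f (map B u) e (sorted_map_incr iB su) e0.
  exists n => w sw wn /=; rewrite map_cat; apply: nP.
    by rewrite -map_cat sorted_map_incr.
  by move=> _ /mapP[x /wn nx ->]; apply: (leq_trans nx); exact: incr_ge.
Qed.

Lemma branch_value_map Phi B C : incr B -> incr C -> weak_tree Phi ->
  branch_value (Phi \o map B) C = branch_value Phi (B \o C).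
Proof.
move=> iB iC wt; have [n sn] := wt_bar wt (incr_comp iB iC).
rewrite (branch_valueE (incr_comp iB iC) sn) (@branch_valueE _ _ n) //=.
  by rewrite /mkseq -map_comp.
by apply: settled_map => //; rewrite /mkseq -map_comp.
Qed.

(** * Interleaved branches *)

(** Slot [r] of the set [B] cut into blocks of length [D]. *)
Definition slice D r B : nat -> nat := fun i => B (i * D + r)%N.

Lemma incr_slice D r B : (r < D)%N -> incr B -> incr (slice D r B).
Proof. by move=> rD iB m n mn; apply: iB; nia. Qed.

Definition slice_seq D r u : seq nat :=
  mask [seq (i %% D)%N == r | i <- iota 0 (size u)] u.

Lemma slice_seq_rcons D r u b : slice_seq D r (rcons u b) =
  if (size u %% D)%N == r then rcons (slice_seq D r u) b else slice_seq D r u.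
Proof.
rewrite /slice_seq size_rcons -addn1 iotaD map_cat /= add0n -(cats1 u) mask_cat ?size_map ?size_iota//.
by case: (_ == r) => /=; rewrite ?cats1 ?cats0.
Qed.

Lemma slice_seq_mkseq D r B n : (r < D)%N -> exists m,
  [/\ (n <= m * D + r)%N, (m * D + r < n + D)%N &
      slice_seq D r (mkseq B n) = mkseq (slice D r B) m].
Proof.
move=> rD; elim: n => [|n [m [h1 h2 e]]]; first by exists 0%N; split.
rewrite mkseqSr slice_seq_rcons size_mkseq e; case: eqP => [nr|nr].
  have nE : n = (m * D + r)%N.
    have := divn_eq n D; rewrite nr => nd; rewrite nd in h1 h2 *; congr (_ * _ + _)%N; nia.
  by exists m.+1; split; [lia|lia|rewrite mkseqSr /slice -nE].
exists m; split => //; last lia.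
suff : n <> (m * D + r)%N by lia.
by move=> nE; apply: nr; rewrite nE modnMDl modn_small.
Qed.

Lemma slice_seq_mkseqM D r B m : (r < D)%N ->
  slice_seq D r (mkseq B (m * D)) = mkseq (slice D r B) m.
Proof.
move=> rD; have [m' [h1 h2 ->]] := slice_seq_mkseq B (m * D) rD.
by congr mkseq; nia.
Qed.

End WeakTree.

(** * Suppressing interleaved weakly null terms *)

Section Suppression.
Variables (R : realType) (X : normedModType R).
Variables (D : nat) (Psi : nat -> seq nat -> X) (w : nat -> R) (Q : pred nat).
Hypothesis Psi_tree : forall r, (r < D)%N -> weak_tree (Psi r).

Definition small_on (e : R) (n0 : nat) (f : dual X) (u : seq nat) : Prop :=
  [/\ sorted ltn u, all (leq n0) u &
    forall q, (q < D)%N -> Q q -> `|f (Psi q (slice_seq D q u))| < e].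

(** The functionals below may depend on the entries outside [Q] only; [0] stands
    for an entry that they ignore. *)
Definition erase (u : seq nat) : seq nat :=
  [seq if Q (i %% D)%N then 0%N else nth 0%N u i | i <- iota 0 (size u)].

Lemma erase_rcons u b :
  erase (rcons u b) = rcons (erase u) (if Q (size u %% D)%N then 0%N else b).
Proof.
rewrite /erase size_rcons -addn1 iotaD map_cat /= add0n cats1 nth_rcons ltnn eqxx.
by congr rcons; apply/eq_in_map => i; rewrite mem_iota add0n nth_rcons => /= ->.
Qed.

Lemma size_erase u : size (erase u) = size u.
Proof. by rewrite /erase size_map size_iota. Qed.

(** The functional comes before the entries in [Q], which adapt to it: in the end
    the other entries [v] determine the vector that it has to norm. *)
Definition extendable (e : R) (n0 : nat) (v : seq nat) : Prop :=
  forall f : dual X, norm_le1 f -> exists2 u, erase u = v & small_on e n0 f u.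

Lemma sorted_slice_seq r u : sorted ltn u -> sorted ltn (slice_seq D r u).
Proof. by move=> su; apply: (subseq_sorted ltn_trans _ su); exact: mask_subseq. Qed.

Hypothesis D_gt0 : (0 < D)%N.

Lemma small_on_rcons e n0 f u : small_on e n0 f u ->
  exists N, forall b, (N <= b)%N -> Q (size u %% D)%N -> small_on e n0 f (rcons u b).
Proof.
move=> [su un sm]; have [N1 N1P] := seq_bound u.
have qD : (size u %% D < D)%N by rewrite ltn_mod.
have [Qq|nQ] := boolP (Q (size u %% D)%N); last by exists 0%N.
have e0 := sm _ qD Qq; rewrite -subr_gt0 in e0.
have [N2 N2P] := wt_cont (Psi_tree qD) f (sorted_slice_seq (size u %% D)%N su) e0.
exists (N1 + N2 + n0)%N => b Nb _.
have sub : sorted ltn (rcons u b).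
  by rewrite sorted_rconsE su /=; apply: sub_all N1P => x; lia.
split => //; first by rewrite all_rcons un andbT; lia.
move=> q q_D Qq'; rewrite slice_seq_rcons; case: eqP => [eq|_]; last exact: sm.
have sb : sorted ltn (slice_seq D q u ++ [:: b]).
  have := sorted_slice_seq q sub; by rewrite slice_seq_rcons eq eqxx cats1.
move: N2P; rewrite eq => /(_ [:: b] sb) N2P; rewrite -cats1.
have /N2P : forall x, x \in [:: b] -> (N2 <= x)%N by move=> x; rewrite inE => /eqP ->; lia.
move: (f (Psi q (slice_seq D q u ++ [:: b]))) (f (Psi q (slice_seq D q u))) => x y xy.
have : `|(x : R)| <= `|x - y : R| + `|y : R| by rewrite -{1}(subrK y x) ler_normD.
by move: xy; rewrite ltrBrDr => /(le_lt_trans _); apply.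
Qed.

Lemma small_on_rcons_free e n0 f (g : dual X) u b : small_on e n0 f u ->
  (forall q, (q < D)%N -> Q q -> `|g (Psi q (slice_seq D q u))| < e) ->
  all (fun x => x < b)%N u -> (n0 <= b)%N -> ~~ Q (size u %% D)%N ->
  small_on e n0 g (rcons u b).
Proof.
move=> [su un _] sm ub n0b nQ; split; first by rewrite sorted_rconsE su.
  by rewrite all_rcons n0b.
move=> q qD Qq; rewrite slice_seq_rcons; case: eqP => [eq|_]; last exact: sm.
by move: nQ; rewrite eq Qq.
Qed.

Lemma small_on_extend e n0 f u : small_on e n0 f u -> exists b, small_on e n0 f (rcons u b).
Proof.
move=> sm; have [Qq|nQ] := boolP (Q (size u %% D)%N).
  by have [N NP] := small_on_rcons sm; exists N; exact: NP.
have [N NP] := seq_bound u; exists (N + n0)%N.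
apply: (small_on_rcons_free sm) => //; last by lia.
- by case: sm.
- by apply: sub_all NP => x; lia.
Qed.

Lemma extendable_nil e n0 : 0 < e -> extendable e n0 [::].
Proof.
move=> e0 f _; exists [::] => //; split => // q qD _.
by rewrite /slice_seq /= (wt_root (Psi_tree qD)) normr0.
Qed.

(** At a slot outside [Q] the functionals may depend on the new element, and a
    weak-star cluster point of them serves before that element is chosen. *)
Lemma extendable_rcons e n0 v : extendable e n0 v -> exists b, extendable e n0 (rcons v b).
Proof.
move=> ev; have [Qq|nQ] := boolP (Q (size v %% D)%N).
  exists 0%N => f f1; have [u uv sm] := ev f f1.
  have szu : size u = size v by rewrite -uv size_erase.
  have [N NP] := small_on_rcons sm; rewrite szu in NP.
  by exists (rcons u N); [rewrite erase_rcons szu Qq uv|exact: NP].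
apply: contrapT => /forallNP nb.
have ex b : exists f : dual X, norm_le1 f /\ forall u, erase u = rcons v b -> ~ small_on e n0 f u.
  apply: contrapT => /forallNP nf; apply: (nb b) => f f1; apply: contrapT => nu.
  by apply: (nf f); split => // u uv sm; apply: nu; exists u.
have [g gP] := choice ex.
have [f f1 fP] := weak_star_cluster (fun b => (gP b).1).
have [u uv sm] := ev f f1; have szu : size u = size v by rewrite -uv size_erase.
have [N NP] := seq_bound u.
have [|b bN bP] := fP [seq Psi q (slice_seq D q u) | q <- iota 0 D & Q q] e _ (N + n0)%N.
  move=> y /mapP[q]; rewrite mem_filter mem_iota add0n => /andP[Qq /= qD] ->.
  by case: sm => _ _; apply.
have [_ /(_ (rcons u b))] := gP b; rewrite erase_rcons szu (negbTE nQ) uv => /(_ erefl); apply.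
apply: (small_on_rcons_free sm); rewrite ?szu //; last by lia.
- move=> q qD Qq; apply: bP; apply/mapP; exists q => //.
  by rewrite mem_filter mem_iota add0n Qq.
- by apply: sub_all NP => x; lia.
Qed.

Lemma extendable_branch e n0 : 0 < e ->
  exists V : nat -> nat, forall n, extendable e n0 (mkseq V n).
Proof.
move=> e0.
have ex v : exists b, extendable e n0 v -> extendable e n0 (rcons v b).
  have [ev|nev] := pselect (extendable e n0 v); last by exists 0%N.
  by have [b] := extendable_rcons ev; exists b.
have [g gP] := choice ex.
pose U := fix U n := if n is n'.+1 then rcons (U n') (g (U n')) else [::].
have UE n : U n = mkseq (fun i => g (U i)) n by elim: n => // n IH; rewrite mkseqSr -IH.
exists (fun i => g (U i)) => n; rewrite -UE.
by elim: n => [|n IH]; [exact: extendable_nil|exact: gP].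
Qed.

Lemma erase_slice u V n r : (r < D)%N -> ~~ Q r -> erase u = mkseq V n ->
  forall i, (i * D + r < n)%N -> nth 0%N u (i * D + r) = V (i * D + r)%N.
Proof.
move=> rD nQ uV i lin; have szu : size u = n by rewrite -size_erase uV size_mkseq.
have := congr1 (fun s => nth 0%N s (i * D + r)) uV.
rewrite /erase (nth_map 0%N) ?size_iota ?szu// nth_iota// add0n nth_mkseq//.
by rewrite modnMDl modn_small// (negbTE nQ).
Qed.

(** The functional norming the part outside [Q] may be fixed independently of
    the elements in the slots of [Q], on which it can then be made small. *)
Theorem suppression (eps : R) (n0 : nat) : 0 < eps ->
  exists B, [/\ incr B, (n0 <= B 0)%N &
    `|\sum_(r < D | ~~ Q r) w r *: branch_value (Psi r) (slice D r B)| <=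
    `|\sum_(r < D) w r *: branch_value (Psi r) (slice D r B)| + eps].
Proof.
move=> eps0; pose W := 1 + \sum_(r < D) `|w r|.
have W1 : 1 <= W by rewrite lerDl sumr_ge0.
have W0 : 0 < W by apply: lt_le_trans W1.
pose e := eps / W; have e0 : 0 < e by rewrite divr_gt0.
have [V VP] := extendable_branch n0 e0.
have iV r : (r < D)%N -> ~~ Q r -> incr (slice D r V).
  move=> rD nQ; apply: incrS => i; have [f f1 _] := norming_functional (0 : X).
  have [u uV [su _ _]] := VP (i.+1 * D + r).+1 f f1.
  have szu : size u = (i.+1 * D + r).+1 by rewrite -size_erase uV size_mkseq.
  have h1 : (i.+1 * D + r < (i.+1 * D + r).+1)%N by [].
  have h2 : (i * D + r < (i.+1 * D + r).+1)%N by nia.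
  rewrite /slice -(erase_slice rD nQ uV h1) -(erase_slice rD nQ uV h2).
  by apply: (sorted_ltn_nth ltn_trans 0%N su); rewrite ?inE ?szu//; nia.
have ex r : exists m, (r < D)%N -> ~~ Q r -> settled (Psi r) (mkseq (slice D r V) m).
  have [/andP[rD nQ]|nr] := boolP ((r < D)%N && ~~ Q r); last first.
    by exists 0%N => rD nQ; move: nr; rewrite rD nQ.
  by have [m ?] := wt_bar (Psi_tree rD) (iV _ rD nQ); exists m.
have [m mP] := choice ex.
pose N := (\max_(r < D) m r)%N.
have mN r : (r < D)%N -> (m r <= N)%N.
  by move=> rD; exact: (leq_bigmax (Ordinal rD)).
pose y := \sum_(r < D | ~~ Q r) w r *: Psi r (mkseq (slice D r V) N).
(* Only now, with the entries outside [Q] long enough to determine [y], is the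
   functional fixed; the remaining entries are chosen for it. *)
have [f f1 fy] := norming_functional y.
have [u uV sm] := VP (N * D)%N f f1.
have szu : size u = (N * D)%N by rewrite -size_erase uV size_mkseq.
have exb u' : exists b, small_on e n0 f u' -> small_on e n0 f (rcons u' b).
  have [s|ns] := pselect (small_on e n0 f u'); last by exists 0%N.
  by have [b] := small_on_extend s; exists b.
have [g gP] := choice exb.
pose U := fix U n := if n is n'.+1 then rcons (U n') (g (U n')) else u.
have UP n : small_on e n0 f (U n) by elim: n => // n IH; exact: gP.
pose B i := if (i < size u)%N then nth 0%N u i else g (U (i - size u)%N).
have BU n : mkseq B (size u + n) = U n.
  elim: n => [|n IH].
    rewrite addn0; apply: (@eq_from_nth _ 0%N); rewrite size_mkseq// => i iu.
    by rewrite nth_mkseq// /B iu.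
  by rewrite addnS mkseqSr IH /= /B ltnNge leq_addr /= addKn.
have smB n : (size u <= n)%N -> small_on e n0 f (mkseq B n).
  by move=> /subnKC <-; rewrite BU.
have iB : incr B.
  apply: mkseq_sorted_incr => n; have [|sB _ _] := smB (size u + n)%N; first by rewrite leq_addr.
  apply: (subseq_sorted ltn_trans _ sB); rewrite (mkseq_split B (leq_addl (size u) n)).
  exact: prefix_subseq.
exists B; split => //.
  have [|_ /allP h _] := smB (size u).+1 => //.
  by apply: h; apply/mapP; exists 0%N; rewrite // mem_iota.
have sliceV r : (r < D)%N -> ~~ Q r -> mkseq (slice D r B) N = mkseq (slice D r V) N.
  move=> rD nQ; apply: (@eq_from_nth _ 0%N); rewrite !size_mkseq// => i iN.
  have h : (i * D + r < N * D)%N by nia.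
  by rewrite !nth_mkseq// /slice /B szu h (erase_slice rD nQ uV h).
have bvP r : (r < D)%N -> ~~ Q r ->
    branch_value (Psi r) (slice D r B) = Psi r (mkseq (slice D r V) N).
  move=> rD nQ; rewrite -sliceV//; apply: branch_valueE; first exact: incr_slice.
  by rewrite sliceV//; have [] := settled_leq (iV _ rD nQ) (mN _ rD) (mP _ rD nQ).
have bvQ q : (q < D)%N -> Q q -> `|f (branch_value (Psi q) (slice D q B))| < e.
  move=> qD Qq; have [k kP] := branch_value_settled (Psi_tree qD) (incr_slice qD iB).
  have [|_ ->] := kP (k + size u)%N; first by rewrite leq_addr.
  rewrite -slice_seq_mkseqM//.
  by have [|_ _] := smB ((k + size u) * D)%N; [nia|apply].
have -> : \sum_(r < D | ~~ Q r) w r *: branch_value (Psi r) (slice D r B) = y.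
  by apply: eq_bigr => r nQ; rewrite bvP.
rewrite (bigID (fun r : 'I_D => Q r)) /=.
have -> : \sum_(r < D | ~~ Q r) w r *: branch_value (Psi r) (slice D r B) = y.
  by apply: eq_bigr => r nQ; rewrite bvP.
set z := \sum_(r < D | Q r) _.
have fz : `|f z| <= eps.
  rewrite /z linear_sum; apply: (@le_trans _ _ (\sum_(r < D | Q r) `|w r| * e)).
    apply: le_trans (ler_norm_sum _ _ _) _; apply: ler_sum => r Qr.
    by rewrite linearZ /= normrM ler_wpM2l// ltW// bvQ.
  rewrite -mulr_suml /e mulrA ler_pdivrMr// mulrC ler_pM2l// /W.
  apply: (@le_trans _ _ (\sum_(r < D) `|w r|)); last by rewrite lerDr.
  by rewrite [leRHS](bigID (fun r : 'I_D => Q r)) /= lerDl sumr_ge0.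
have := f1 (z + y); rewrite linearD /= fy => h.
have : (f z : R) + `|y| <= `|z + y| by apply: le_trans h; exact: ler_norm.
by move: fz; rewrite ler_norml => /andP[h1 _]; lra.
Qed.

End Suppression.

(** * The topologies in terms of coordinates and functionals *)

Section Topologies.

Definition agree_below (b : nat) (c c' : cantor_space) : Prop :=
  forall x, (x < b)%N -> c' x = c x.

Lemma cantor_nbhsP (c : cantor_space) (V : set cantor_space) :
  nbhs c V <-> exists b, agree_below b c `<=` V.
Proof.
pose F : set_system cantor_space := [set V | exists b, agree_below b c `<=` V].
have FF : Filter F.
  split; first by exists 0%N.
    move=> P Q [b bP] [b' bQ]; exists (maxn b b') => c' h; split.
      by apply: bP => x xb; apply: h; rewrite leq_max xb.
    by apply: bQ => x xb; apply: h; rewrite leq_max xb orbT.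
  by move=> P Q PQ [b bP]; exists b; exact: subset_trans PQ.
split.
  suff : F --> c by apply.
  apply/cvg_sup => i U [V' [[W oW <-] Wc WU]]; exists i.+1 => c' h.
  by apply: WU; rewrite /= /proj h.
move=> [b bV]; apply: filterS bV _.
elim: b => [|b IH]; first by apply: (@filterS _ _ _ setT) filterT.
have nb : nbhs c [set c' : cantor_space | c' b = c b].
  apply: (@proj_continuous nat (fun=> bool) b c [set y | y = c b]).
  by apply: open_nbhs_nbhs; split => //; exact: discrete_open.
apply: filterS (filterI IH nb) => c' [h1 h2] x.
by rewrite ltnS leq_eqVlt => /predU1P[->//|]; exact: h1.
Qed.

Variables (R : realType) (X : normedModType R).

Lemma dual_weak_continuous (f : dual X) :
  continuous ((fun x => f x) : weak_space X -> R^o).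
Proof.
move=> x; have h1 := @initial_continuous X _ (@eval_dual R X) x.
have /cvg_sup/(_ f) h2 : nbhs (@eval_dual R X x) --> @eval_dual R X x by exact: cvg_id.
move=> U; rewrite nbhsE => -[W [oW Wx] WU].
have hW : nbhs (@eval_dual R X x) [set g | W (g f)].
  apply: h2; rewrite nbhsE; exists [set g | W (g f)] => //.
  by split => //; exists W.
have h3 : nbhs x (@eval_dual R X @^-1` [set g | W (g f)]) := h1 _ hW.
have FF : Filter (nbhs (x : weak_space X)) by exact: nbhs_filter.
by apply: (filterS _ h3) => y; exact: WU.
Qed.

Lemma within_weak_continuousP (A : set cantor_space) (phi : cantor_space -> weak_space X) :
  {within A, continuous phi} <->
  forall (f : dual X) c (e : R), A c -> 0 < e ->
    exists b, forall c', A c' -> agree_below b c c' -> `|f (phi c') - f (phi c)| < e.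
Proof.
rewrite subspace_continuousP; split.
  move=> cphi f c e Ac e0.
  have h : (fun c' => f (phi c') : R^o) @ within A (nbhs c) --> (f (phi c) : R^o).
    exact: (cvg_comp _ _ (cphi c Ac) (@dual_weak_continuous f (phi c))).
  have /cvgrPdist_lt/(_ e e0) := h; rewrite /within /= => /cantor_nbhsP[b bP].
  by exists b => c' Ac' h'; rewrite distrC; exact: bP.
move=> H c Ac U; rewrite nbhsE => -[B [[C oC CE] Bc] BU].
have FF : Filter (within A (nbhs c)) by exact: within_filter.
have : (fun c' => @eval_dual R X (phi c')) @ within A (nbhs c) --> @eval_dual R X (phi c).
  apply/cvg_sup => f U' [V' [[W oW <-] Wc WU]].
  have nW : nbhs (f (phi c) : R^o) W by apply: open_nbhs_nbhs.
  have [e /= e0 eW] := (nbhs_ballP _ _).1 nW.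
  have [b bP] := H f c e Ac e0.
  apply/cantor_nbhsP; exists b => c' h Ac'; apply: WU; apply: eW.
  by rewrite /ball /= distrC; exact: bP.
move=> /(_ C) h.
have {}h : ((fun c' => @eval_dual R X (phi c')) @ within A (nbhs c)) C.
  by apply: h; apply: open_nbhs_nbhs; split => //; move: Bc; rewrite -CE.
have h' : within A (nbhs c) [set c' | C (@eval_dual R X (phi c'))] := h.
suff : within A (nbhs c) [set c' | U (phi c')] by [].
by apply: filterS h' => c' h'; apply: BU; rewrite -CE.
Qed.

End Topologies.

(** * Finite sets and their increasing enumerations *)

Definition setof (u : seq nat) : {fset nat} := seq_fset tt u.

Lemma in_setof u : setof u =i u.
Proof. exact: seq_fsetE. Qed.

Lemma sorted_ltn_uniq u : sorted ltn u -> uniq u.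
Proof. exact: (sorted_uniq ltn_trans ltnn). Qed.

Lemma sorted_ltn_leq u : sorted ltn u -> sorted leq u.
Proof. by apply: sub_sorted => x y /ltnW. Qed.

Lemma card_setof u : sorted ltn u -> #|` setof u| = size u.
Proof. by move=> su; rewrite size_seq_fset undup_id ?sorted_ltn_uniq. Qed.

Lemma sort_setof u : sorted ltn u -> sort leq (setof u) = u.
Proof.
move=> su; apply: (sorted_eq leq_trans anti_leq).
- exact: (sort_sorted leq_total).
- exact: sorted_ltn_leq.
- rewrite perm_sort; apply: uniq_perm; [exact: fset_uniq|exact: sorted_ltn_uniq|exact: in_setof].
Qed.

Lemma selt_setof u k : sorted ltn u -> selt (setof u) k = nth 0%N u k.
Proof. by move=> su; rewrite /selt sort_setof. Qed.

Lemma sorted_sort (s : {fset nat}) : sorted ltn (sort leq s).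
Proof. by rewrite ltn_sorted_uniq_leq sort_uniq fset_uniq (sort_sorted leq_total). Qed.

Lemma setof_sort (s : {fset nat}) : setof (sort leq s) = s.
Proof. by apply/fsetP => x; rewrite in_setof mem_sort. Qed.

Lemma setof_inj u v : sorted ltn u -> sorted ltn v -> setof u = setof v -> u = v.
Proof. by move=> su sv e; rewrite -(sort_setof su) e sort_setof. Qed.

Lemma setof_rcons u x : setof (rcons u x) = (setof u `|` [fset x])%fset.
Proof. by apply/fsetP => y; rewrite !inE !in_setof mem_rcons inE orbC. Qed.

Lemma nth_sorted_subset (u v : seq nat) i : sorted ltn u -> sorted ltn v ->
  {subset u <= v} -> (i < size u)%N -> (nth 0 v i <= nth 0 u i)%N.
Proof.
elim: v u i => [|y v IH] [|x u] i //.
  by move=> _ _ /(_ x); rewrite mem_head => /(_ isT).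
move=> su sv uv; have yx : (y <= x)%N.
  have := uv x (mem_head _ _); rewrite inE => /predU1P[->//|xv].
  by move: sv; rewrite /= (path_sortedE ltn_trans) => /andP[/allP/(_ _ xv)/ltnW].
case: i => [|i] //= iu; apply: IH => //.
- exact: path_sorted su.
- exact: path_sorted sv.
- move=> z zu; have := uv z; rewrite !inE zu orbT => /(_ isT)/predU1P[zy|//].
  move: su; rewrite /= (path_sortedE ltn_trans) => /andP[/allP/(_ _ zu)].
  by rewrite /= zy ltnNge yx.
Qed.

Lemma selt_subset (s t : {fset nat}) i : (s `<=` t)%fset -> (i < #|` s|)%N ->
  (selt t i <= selt s i)%N.
Proof.
move=> /fsubsetP st si; apply: nth_sorted_subset; rewrite ?sorted_sort ?size_sort//.
by move=> x; rewrite !mem_sort; exact: st.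
Qed.

Lemma fset_bound (s : {fset nat}) : exists N, forall x, x \in s -> (x < N)%N.
Proof.
exists (\max_(x <- s) x).+1 => x xs; rewrite ltnS.
by apply: (@leq_bigmax_seq _ _ xpredT (fun x => x)) => //.
Qed.

Lemma sort_fsetU1_last (s : {fset nat}) n : (forall x, x \in s -> (x < n)%N) ->
  sort leq (s `|` [fset n])%fset = rcons (sort leq s) n.
Proof.
move=> sn; rewrite -{1}(setof_sort s) -setof_rcons sort_setof//.
rewrite sorted_rconsE sorted_sort /=; apply/allP => x; rewrite mem_sort; exact: sn.
Qed.

Lemma card_sort (s : {fset nat}) : #|` s| = size (sort leq s).
Proof. by rewrite size_sort. Qed.

Lemma selt_mem (s : {fset nat}) i : (i < #|` s|)%N -> selt s i \in s.
Proof. by move=> si; rewrite -(mem_sort leq) mem_nth// -card_sort. Qed.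

(** * Comparing regular families by their orders *)

Lemma cord_induction (P : cord -> Prop) :
  (forall f, (forall n a, f n = Some a -> P a) -> P (Osup f)) -> forall a, P a.
Proof.
move=> H; fix IH 1 => -[f]; apply: H => n a.
case: (f n) => [b|]; last discriminate.
by case=> <-; apply: IH.
Qed.

Lemma ole_succP a g : ole (osucc a) (Osup g) <-> exists m b, g m = Some b /\ ole a b.
Proof.
split=> [/(_ 0%N) /= [m]|[m [b [gm ab]]] _].
  by case E: (g m) => [b|//] ab; exists m, b.
by exists m; rewrite gm.
Qed.

Lemma ole_supP f b :
  ole (Osup f) b <-> forall n a, f n = Some a -> ole (osucc a) b.
Proof.
case: b => g; split=> H n.
  move=> a fn; have /= := H n; rewrite fn => -[m].
  by case E: (g m) => [b|//] ab; apply/ole_succP; exists m, b.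
case fn: (f n) => [a|//]; have /ole_succP[m [b [gm ab]]] := H n a fn.
by exists m; rewrite gm.
Qed.

Lemma ole_trans a b c : ole a b -> ole b c -> ole a c.
Proof.
elim/cord_induction: a b c => f IH [g] [h] /ole_supP fg gh.
apply/ole_supP => n a fn; have /ole_succP[m [b [gm ab]]] := fg n a fn.
have /ole_succP[k [c [hk bc]]] := (ole_supP g (Osup h)).1 gh m b gm.
by apply/ole_succP; exists k, c; split => //; exact: IH fn _ _ ab bc.
Qed.

Lemma ole_total a b : ole a b \/ ole (osucc b) a.
Proof.
elim/cord_induction: a b => f IH b.
have [|/existsNP[n /existsNP[a /not_implyP[fn nab]]]] :=
  pselect (forall n a, f n = Some a -> ole (osucc a) b); first by move/ole_supP; left.
right; apply/ole_succP; exists n, a; split => //.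
case: b nab => g nab; apply/ole_supP => m b gm.
have [ab|//] := IH n a fn b.
by exfalso; apply: nab; apply/ole_succP; exists m, b.
Qed.

Lemma ole_succ_irrefl a : ~ ole (osucc a) a.
Proof.
elim/cord_induction: a => f IH /ole_succP[m [b [fm fb]]].
by apply: (IH m b fm); move: fb => /ole_supP; apply; exact: fm.
Qed.

(** Below a supremum of successors lies a member: otherwise, the order being
    total, [a] would itself be an upper bound. *)
Lemma is_osup_lt T (S : set T) (rho : T -> cord) l a :
  is_osup [set osucc (rho s) | s in S] l -> ole (osucc a) l ->
  exists2 s, S s & ole a (rho s).
Proof.
move=> [ub lub] al; apply: contrapT => H.
apply: (@ole_succ_irrefl a); apply: (ole_trans al); apply: lub => _ [s Ss <-].
by have [as_|//] := ole_total a (rho s); exfalso; apply: H; exists s.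
Qed.

Lemma rank_antitone F rho (s t : {fset nat}) : is_rank F rho -> (s `<=` t)%fset ->
  ole (rho t) (rho s).
Proof.
move=> rk st; have [_ lub] := rk t; apply: lub => _ [r [Fr tr] <-].
have [ub _] := rk s; apply: ub; exists r => //; split => //.
exact: fsub_proper_trans st tr.
Qed.

(** If the rank of [s] in [S] is at most that of [t] in [G], then every
    continuation of [s] in [S] is matched by one of [t] in [G]: a new element of
    [s] is answered by a new element of [t] of no smaller rank. As [G] tolerates
    larger elements, one [sigma] bounding the countably many answers serves for
    all continuations, and the answers may be taken beyond [t]. *)
Lemma compare_families (S G : set {fset nat}) rhoS rhoG :
  is_rank S rhoS -> is_rank G rhoG -> hereditary S -> hereditary G -> spreading G ->
  forall (a : cord) (s t : {fset nat}), G t -> ole (rhoS s) a -> ole (rhoS s) (rhoG t) ->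
  exists sigma : nat -> nat, forall (w : seq nat) (v : {fset nat}), sorted ltn w ->
    (forall x y, x \in s -> y \in w -> (x < y)%N) -> S (s `|` setof w)%fset ->
    #|` v| = (#|` t| + size w)%N ->
    (forall i, (i < #|` t|)%N -> (selt t i <= selt v i)%N) ->
    (forall i, (i < size w)%N -> (sigma (nth 0 w i) <= selt v (#|` t| + i))%N) ->
    G v.
Proof.
move=> rkS rkG hS hG spG; elim/cord_induction => f IH s t Gt sa st.
have ex n : exists p : {fset nat} * (nat -> nat), n \notin s -> S (s `|` [fset n])%fset ->
  [/\ (t `<=` p.1)%fset, #|` p.1| = #|` t|.+1 &
   forall (w : seq nat) (v : {fset nat}), sorted ltn w ->
    (forall x y, x \in (s `|` [fset n])%fset -> y \in w -> (x < y)%N) ->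
    S ((s `|` [fset n]) `|` setof w)%fset ->
    #|` v| = (#|` p.1| + size w)%N ->
    (forall i, (i < #|` p.1|)%N -> (selt p.1 i <= selt v i)%N) ->
    (forall i, (i < size w)%N -> (p.2 (nth 0 w i) <= selt v (#|` p.1| + i))%N) ->
    G v].
  have [[ns Sn]|nn] := pselect (n \notin s /\ S (s `|` [fset n])%fset); last first.
    by exists (fset0, id) => ns Sn; exfalso; apply: nn.
  have sub : (s `<` s `|` [fset n])%fset.
    by rewrite fproperEneq fsubsetUl andbT; apply/eqP => /fsetP/(_ n); rewrite !inE eqxx orbT (negbTE ns).
  have lt : ole (osucc (rhoS (s `|` [fset n])%fset)) (rhoS s).
    by have [ub _] := rkS s; apply: ub; exists (s `|` [fset n])%fset.
  have /ole_succP[m [a [fm ra]]] := ole_trans lt sa.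
  have [s' [Gs' ts'] rs'] := is_osup_lt (rkG t) (ole_trans lt st).
  have [x xs' xt] : exists2 x, x \in s' & x \notin t.
    by apply/fsubsetPn; move: ts'; rewrite fproperE => /andP[].
  have t'G : (t `|` [fset x] `<=` s')%fset.
    by rewrite fsubUset; apply/andP; split; [exact: fproper_sub|rewrite fsub1set].
  have [sg sgP] := IH m a fm (s `|` [fset n])%fset (t `|` [fset x])%fset
    (hG _ _ Gs' t'G) ra (ole_trans rs' (rank_antitone rkG t'G)).
  exists ((t `|` [fset x])%fset, sg) => _ _; split => //=; first exact: fsubsetUl.
  by rewrite fsetUC cardfsU1 xt.
have [p pP] := choice ex.
(* [sigma j] bounds the answers to all the elements up to [j], as any of them
   may precede [j]. *)
pose sigma j := (\max_(n < j.+1) maxn ((p n).2 j) (selt (p n).1 #|` t|))%N.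
have sigmaP n j : (n <= j)%N ->
    ((p n).2 j <= sigma j)%N /\ (selt (p n).1 #|` t| <= sigma j)%N.
  move=> nj; have := @leq_bigmax _ (fun n : 'I_j.+1 => maxn ((p n).2 j) (selt (p n).1 #|` t|))
    (@Ordinal j.+1 n nj).
  by rewrite -/(sigma j) geq_max => /andP[].
exists sigma => -[|n w] v sw sw' Ssw vt tv wv.
  by apply: (spG t v) => //; rewrite vt addn0.
have ns : n \notin s by apply/negP => /sw' => /(_ n (mem_head _ _)); rewrite ltnn.
have E : (s `|` setof (n :: w) = (s `|` [fset n]) `|` setof w)%fset.
  by apply/fsetP => x; rewrite !inE !in_setof inE orbA.
rewrite E in Ssw.
have [|t1 ct pG] := pP n ns; first by apply: hS Ssw _; exact: fsubsetUl.
move: sw; rewrite /= (path_sortedE ltn_trans) => /andP[/allP nw sw].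
apply: (pG w v) => //.
- move=> x y; rewrite !inE => /orP[xs yw|/eqP -> /nw//].
  by apply: sw' => //; rewrite inE yw orbT.
- by rewrite vt ct /= addnS.
- move=> i; rewrite ct ltnS leq_eqVlt => /predU1P[->|it].
    have := wv 0%N isT; rewrite addn0 /=; apply: leq_trans.
    by case: (sigmaP n n (leqnn n)).
  by apply: leq_trans (tv i it); exact: selt_subset.
- move=> i iw; rewrite ct addSnnS; apply: leq_trans (wv i.+1 iw) => /=.
  by case: (sigmaP n (nth 0%N w i)) => //; apply: ltnW; apply: nw; rewrite mem_nth.
Qed.

(** * Regular families along sparse sets *)

Section RegularFamily.
Variable G : set {fset nat}.
Hypotheses (G_compact : compact (charf @` G)) (G_hereditary : hereditary G)
  (G_spreading : spreading G).

(** The characteristic function of an infinite set, as a limit of members,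
    would be that of a member. *)
Lemma no_infinite_branch B : incr B -> exists n, ~ G (setof (mkseq B n)).
Proof.
move=> iB; apply: contrapT => /forallNP nG.
have GB n : G (setof (mkseq B n)) by apply: contrapT; exact: nG.
pose c : cantor_space := fun x => `[< range B x >].
have cG : closed (charf @` G) := compact_closed cantor_space_hausdorff G_compact.
have [s Gs sc] : (charf @` G) c.
  apply: cG => V /cantor_nbhsP[b bV].
  exists (charf (setof (mkseq B b))); split; first by exists (setof (mkseq B b)).
  apply: bV => x xb; rewrite /charf in_setof; apply/idP/asboolP.
    by move=> /mapP[i _ ->]; exists i.
  move=> [i _ ix]; apply/mapP; exists i => //; rewrite mem_iota add0n /=.
  by apply: leq_ltn_trans xb; rewrite -ix; exact: incr_ge.
have [N Ns] := fset_bound s.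
have : B N \in s.
  have := congr1 (fun c : cantor_space => c (B N)) sc; rewrite /charf => ->.
  by apply/asboolP; exists N.
by move=> /Ns; rewrite ltnNge incr_ge.
Qed.

(** The element that extends [s] may lie anywhere, but spreading moves the last
    element of the extension to any larger place. *)
Lemma nonmaximal_extend s : G s -> ~ maximals G s ->
  exists n0, forall n, (n0 <= n)%N -> G (s `|` [fset n])%fset.
Proof.
move=> Gs nm.
have [t [Gt st ts]] : exists t, [/\ G t, (s `<=` t)%fset & t <> s].
  apply: contrapT => /forallNP H; apply: nm; split => // t Gt st.
  by apply: contrapT => ts; apply: (H t).
have [m mt ms] : exists2 m, m \in t & m \notin s.
  by apply/fsubsetPn; apply/negP => ts'; apply: ts; apply/eqP; rewrite eqEfsubset ts'.
have Gm : G (s `|` [fset m])%fset.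
  by apply: (G_hereditary Gt); rewrite fsubUset st fsub1set.
have [N NP] := fset_bound (s `|` [fset m])%fset.
exists N => n Nn.
have sn x : x \in s -> (x < n)%N.
  by move=> xs; apply: leq_trans Nn; apply: NP; rewrite !inE xs.
have cm : #|` s `|` [fset m]|%fset = #|` s|.+1 by rewrite fsetUC cardfsU1 ms.
apply: (G_spreading Gm).
  by rewrite cm [RHS]card_sort sort_fsetU1_last// size_rcons -card_sort.
move=> i; rewrite cm ltnS /selt (sort_fsetU1_last sn) nth_rcons -card_sort.
rewrite leq_eqVlt => /predU1P[->|si].
  rewrite ltnn eqxx; apply: leq_trans Nn; apply: ltnW; apply: NP; apply: selt_mem.
  by rewrite cm.
by rewrite si; apply: selt_subset => //; exact: fsubsetUl.
Qed.

Lemma sparse_gap b : exists n0, forall s n, (forall x, x \in s -> (x <= b)%N) -> G s ->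
  ~ maximals G s -> (n0 <= n)%N -> G (s `|` [fset n])%fset.
Proof.
have ex s : exists n0, forall n, G s -> ~ maximals G s -> (n0 <= n)%N ->
    G (s `|` [fset n])%fset.
  have [[Gs nm]|H] := pselect (G s /\ ~ maximals G s).
    by have [n0 P] := nonmaximal_extend Gs nm; exists n0 => n _ _; exact: P.
  by exists 0%N => n Gs nm; exfalso; apply: H.
have [g gP] := choice ex.
exists (\max_(s <- fpowerset (setof (iota 0 b.+1))) g s)%N => s n sb Gs nm gn.
apply: (gP s n Gs nm); apply: leq_trans gn; apply: (leq_bigmax_seq (P := xpredT)) => //.
rewrite fpowersetE; apply/fsubsetP => x /sb xb.
by rewrite in_setof mem_iota add0n ltnS xb.
Qed.

(** Along a sparse set the maximal members of a regular family form
    a front: a member with a larger element added is again a member, unless it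
    is maximal. *)
Lemma sparse_subset L N0 : incr L -> exists N, [/\ incr N, range N `<=` range L,
  (N0 <= N 0)%N & forall u b, sorted ltn (rcons u b) -> G (setof (map N u)) ->
    ~ maximals G (setof (map N u)) -> G (setof (map N (rcons u b)))].
Proof.
move=> iL; have [nu nuP] := choice sparse_gap.
pose N := fix N n := if n is n'.+1 then L (nu (N n') + N n').+1 else L (nu 0 + N0)%N.
have iN : incr N.
  apply: incrS => n /=; apply: (@leq_trans (nu (N n) + N n).+1); last exact: incr_ge.
  by rewrite ltnS leq_addl.
exists N; split => //.
- by move=> _ [[|n] _ <-] /=; eexists.
- by apply: leq_trans (incr_ge _ iL); rewrite leq_addl.
- move=> u b sub Gu nm; rewrite map_rcons setof_rcons.
  case: (lastP u) sub Gu nm => [|u' x] sub Gu nm.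
    apply: (nuP 0%N) => //; first by move=> y; rewrite in_setof.
    apply: leq_trans (incr_leq iN (leq0n b)).
    by apply: leq_trans (incr_ge _ iL); rewrite leq_addr.
  move: sub; rewrite sorted_rconsE => /andP[su /allP ub].
  have xb : (x < b)%N by apply: ub; rewrite mem_rcons mem_head.
  apply: (nuP (N x)) => //.
    move=> y; rewrite in_setof => /mapP[z zu ->]; apply: (incr_leq iN).
    move: zu su; rewrite mem_rcons inE => /predU1P[->//|zu].
    by rewrite sorted_rconsE => /andP[_ /allP/(_ _ zu)/ltnW].
  apply: leq_trans (incr_leq iN xb) => /=.
  apply: (@leq_trans (nu (N x) + N x).+1); last exact: incr_ge.
  by rewrite leqW// leq_addr.
Qed.

End RegularFamily.

Section Stem.
Variable T : seq nat -> Prop.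
Hypothesis T_prefix : forall u w, T (u ++ w) -> T u.

(** The longest initial segment in [T] of [u ++ w], once [u] is in [T]. *)
Fixpoint stem_from (u w : seq nat) : seq nat :=
  if w is b :: w' then
    if `[< T (rcons u b) >] then stem_from (rcons u b) w' else u
  else u.

Definition stem := stem_from [::].

Lemma stem_from_cat u v w : T (u ++ v) -> stem_from u (v ++ w) = stem_from (u ++ v) w.
Proof.
elim: v u => [|b v IH] u; first by rewrite cats0.
rewrite -cat_rcons => Tuv /=.
have /asboolP -> : T (rcons u b) by exact: T_prefix Tuv.
exact: IH.
Qed.

Lemma stem_fromP u w : T u -> exists v v', [/\ w = v ++ v', stem_from u w = u ++ v, T (u ++ v) &
  v' = [::] \/ exists b v'', v' = b :: v'' /\ ~ T (rcons (u ++ v) b)].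
Proof.
elim: w u => [|b w IH] u Tu /=.
  by exists [::], [::]; rewrite !cats0; split => //; left.
have [/asboolP Tub|/asboolPn nT] := boolP `[< T (rcons u b) >].
  have [v [v' [-> -> Tv v'P]]] := IH _ Tub.
  by exists (b :: v), v'; rewrite -cat_rcons.
by exists [::], (b :: w); rewrite !cats0; split => //; right; exists b, w.
Qed.

End Stem.

(** * The weak tree of a subordinated weakly null subsequence *)

Section TreeOfFamily.
Variables (R : realType) (X : normedModType R).
Variables (G : set {fset nat}) (N : nat -> nat).
Hypotheses (G_compact : compact (charf @` G)) (G_hereditary : hereditary G).
Hypotheses (N_incr : incr N) (G0 : G fset0) (G0_nonmax : ~ maximals G fset0).
Hypothesis N_sparse : forall u b, sorted ltn (rcons u b) -> G (setof (map N u)) ->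
  ~ maximals G (setof (map N u)) -> G (setof (map N (rcons u b))).

Notation nset u := (setof (map N u)).
Definition node (u : seq nat) : Prop := G (nset u).
Definition leaf (u : seq nat) : Prop := maximals G (nset u).

Lemma node_prefix u w : node (u ++ w) -> node u.
Proof.
move=> Gu; apply: (G_hereditary Gu); apply/fsubsetP => x.
by rewrite !in_setof map_cat mem_cat => ->.
Qed.

Lemma node_nil : node [::].
Proof. by rewrite /node (_ : nset [::] = fset0)//; apply/fsetP => x; rewrite in_setof inE. Qed.

Lemma leaf_not_nil : ~ leaf [::].
Proof. by rewrite /leaf (_ : nset [::] = fset0)//; apply/fsetP => x; rewrite in_setof inE. Qed.

Lemma leaf_rcons u b : leaf u -> sorted ltn (rcons u b) -> ~ node (rcons u b).
Proof.
move=> [_ mx] sub nub; have : N b \in nset u.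
  rewrite -(mx _ nub); first by rewrite in_setof map_rcons mem_rcons mem_head.
  by apply/fsubsetP => x; rewrite !in_setof map_rcons mem_rcons inE orbC => ->.
rewrite in_setof => /mapP[c cu /(incr_inj N_incr) bc].
by move: sub; rewrite sorted_rconsE => /andP[_ /allP/(_ _ cu)]; rewrite bc ltnn.
Qed.

Notation nstem := (stem node).

Lemma stem_leaf v w : leaf v -> sorted ltn (v ++ w) -> nstem (v ++ w) = v.
Proof.
move=> lv svw; rewrite /stem stem_from_cat /=; last by case: lv.
  case: w svw => [//|b w] /=; rewrite -cat_rcons => svb.
  have /asboolPn/negbTE -> // : ~ node (rcons v b).
  apply: leaf_rcons => //; apply: (subseq_sorted ltn_trans _ svb); exact: prefix_subseq.
exact: node_prefix.
Qed.

Lemma stem_node u w : node u -> exists v v',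
  w = v ++ v' /\ nstem (u ++ w) = u ++ v.
Proof.
move=> nu; rewrite /stem stem_from_cat //; last exact: node_prefix.
by have [v [v' [-> E _ _]]] := stem_fromP w nu; exists v, v'.
Qed.

(** By sparseness, a stem that stops before the end of [u] is maximal. *)
Lemma stemP u : sorted ltn u -> node (nstem u) /\
  exists v', u = nstem u ++ v' /\ (leaf (nstem u) \/ v' = [::]).
Proof.
move=> su; have [v [v' [uE sE Tv v'P]]] := stem_fromP u node_nil.
rewrite /stem sE; split => //; exists v'; split => //.
case: v'P => [->|[b [v'' [v'E nT]]]]; first by right.
left; apply: contrapT => nl; apply: nT; apply: N_sparse => //.
apply: (subseq_sorted ltn_trans _ su); rewrite uE v'E -cat_rcons; exact: prefix_subseq.
Qed.

Lemma sorted_nset u : sorted ltn u -> sorted ltn (map N u).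
Proof. exact: sorted_map_incr. Qed.

Lemma branch_leaf B : incr B -> exists n, forall m, (n <= m)%N -> leaf (nstem (mkseq B m)).
Proof.
move=> iB; have [n nP] := no_infinite_branch G_compact (incr_comp N_incr iB).
exists n => m nm; have [nst [v' [E]]] := stemP (sorted_mkseq m iB).
case=> [//|v'0]; exfalso; apply: nP.
have : node (mkseq B m) by rewrite E v'0 cats0.
rewrite (mkseq_split B nm) => /node_prefix; rewrite /node.
by rewrite /mkseq -map_comp.
Qed.

Lemma node_hat u : sorted ltn u -> node u -> hat (maximals G) (nset u).
Proof.
move=> su nu; have [B [iB Bu _]] := branch_through 0 su.
have [n nP] := branch_leaf iB; have lf := nP (size u + n)%N (leq_addl _ _).
rewrite (mkseq_split B (leq_addr n (size u))) Bu in lf.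
have [v [v' [_ E]]] := stem_node [seq B i | i <- iota (size u) (size u + n - size u)] nu.
rewrite E in lf; exists (nset (u ++ v)) => //.
by apply/fsubsetP => x; rewrite !in_setof map_cat mem_cat => ->.
Qed.

Variables (L : nat -> nat) (x : {fset nat} -> X) (phi : cantor_space -> weak_space X).
Hypothesis NL : range N `<=` range L.
Hypothesis phi_cont : {within charf @` restr (hat (maximals G)) L, continuous phi}.
Hypothesis phi_x : forall s, restr (maximals G) L s -> phi (charf s) = x s.
Hypothesis x_null : weakly_null (maximals G) x L.

(** The tree is constant beyond the maximal members. *)
Definition tree_of_family (u : seq nat) : X := phi (charf (nset (nstem u))).
Notation Phi := tree_of_family.

Lemma nset_range u n : n \in nset u -> range L n.
Proof. by rewrite in_setof => /mapP[m _ ->]; apply: NL; exists m. Qed.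

Lemma tree_leaf u : leaf (nstem u) -> Phi u = x (nset (nstem u)).
Proof. by move=> lu; apply: phi_x; split => // n; exact: nset_range. Qed.

Lemma leaf_settled u : sorted ltn u -> leaf (nstem u) -> settled Phi u.
Proof.
move=> su lu w suw; have [_ [v' [E _]]] := stemP su.
by rewrite /Phi {1}E -catA stem_leaf// catA -E.
Qed.

(** Past a maximal member nothing changes; before it, the node is its own stem
    and adding large elements is a small move in the Cantor space. *)
Lemma tree_of_family_cont (f : dual X) u (e : R) : sorted ltn u -> 0 < e ->
  exists n, forall w, sorted ltn (u ++ w) -> (forall y, y \in w -> (n <= y)%N) ->
    `|f (Phi (u ++ w)) - f (Phi u)| < e.
Proof.
move=> su e0; have [nu [v' [E [lu|v'0]]]] := stemP su.
  exists 0%N => w suw _; rewrite (leaf_settled su lu suw) subrr normr0//.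
have uE : nstem u = u by rewrite {2}E v'0 cats0.
rewrite uE in nu; have inS v : sorted ltn v -> node v ->
    (charf @` restr (hat (maximals G)) L) (charf (nset v)).
  by move=> sv nv; exists (nset v) => //; split; [exact: node_hat|move=> n; exact: nset_range].
have [b bP] := (within_weak_continuousP _ _).1 phi_cont f _ e (inS u su nu) e0.
exists b => w suw wb; have [v [w' [wE sE]]] := stem_node w nu.
have suv : sorted ltn (u ++ v).
  by apply: (subseq_sorted ltn_trans _ suw); rewrite wE catA; exact: prefix_subseq.
have nuv : node (u ++ v) by have [] := stemP suw; rewrite sE.
rewrite /Phi sE uE; apply: bP; first exact: inS.
move=> y yb; rewrite /charf !in_setof map_cat mem_cat.
suff /negbTE -> : y \notin map N v by rewrite orbF.
apply/negP => /mapP[z zv yz]; move: yb; rewrite yz ltnNge; apply/negP/negPn.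
apply: leq_trans (incr_ge z N_incr); apply: wb; by rewrite wE mem_cat zv.
Qed.

Lemma tree_of_family_weak_tree : weak_tree Phi.
Proof.
split; last 1 first.
(* The root is a weak limit of vectors of the family with large minimum. *)
- move=> f; apply/eqP; rewrite -normr_le0; apply/ler_addgt0Pr => e e0; rewrite add0r.
  have e20 : 0 < e / 2 by rewrite divr_gt0.
  have [n nP] := tree_of_family_cont f (isT : sorted ltn [::]) e20.
  have [n0 n0P] := x_null f e20.
  pose B i := (i + (n + n0))%N; have iB : incr B by move=> i j ij; rewrite /B ltn_add2r.
  have [m mP] := branch_leaf iB; have lf := mP m (leqnn m).
  have h1 : `|f (Phi (mkseq B m)) - f (Phi [::])| < e / 2.
    apply: (nP (mkseq B m)); first exact: sorted_mkseq.
    by move=> y /mapP[i _ ->]; rewrite /B; lia.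
  have h2 : `|f (Phi (mkseq B m))| < e / 2.
    rewrite (tree_leaf lf); apply: n0P; first by split => // k; exact: nset_range.
    have [_ [v' [E _]]] := stemP (sorted_mkseq m iB).
    have sst : sorted ltn (nstem (mkseq B m)).
      apply: (subseq_sorted ltn_trans _ (sorted_mkseq m iB)).
      by rewrite {2}E; exact: prefix_subseq.
    rewrite selt_setof ?sorted_nset//.
    case: (nstem (mkseq B m)) lf E => [/leaf_not_nil//|y v] _ E /=.
    apply: leq_trans (incr_ge y N_incr).
    have : y \in mkseq B m by rewrite E mem_head.
    by move=> /mapP[i _ ->]; rewrite /B; lia.
  move: h1 h2; set p := f (Phi (mkseq B m)); set q := f (Phi [::]) => h1 h2.
  have : `|q : R| <= `|p : R| + `|p - q : R|.
    by have := ler_normD (p : R) (q - p : R); rewrite (addrC p) subrK (distrC q).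
  by move: h1 h2 => /ltW h1 /ltW h2; move: h1 h2; lra.
- move=> B iB; have [n nP] := branch_leaf iB; exists n.
  by apply: leaf_settled; [exact: sorted_mkseq|exact: nP].
- by move=> f u e; exact: tree_of_family_cont.
Qed.

Lemma branch_value_leaf B : incr B -> exists u w n, [/\ mkseq B n = u ++ w,
  leaf u, restr (maximals G) L (nset u), u != [::] & branch_value Phi B = x (nset u)].
Proof.
move=> iB; have [n nP] := branch_leaf iB; have lf := nP n (leqnn n).
have [_ [v' [E _]]] := stemP (sorted_mkseq n iB).
exists (nstem (mkseq B n)), v', n; split => //.
- by split => // k; exact: nset_range.
- by apply/eqP => u0; move: lf; rewrite u0; exact: leaf_not_nil.
- rewrite (branch_valueE iB (leaf_settled (sorted_mkseq n iB) lf)); exact: tree_leaf.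
Qed.

End TreeOfFamily.

(** * The tree of a spreading model *)

Section TreeOfSpreadingModel.
Variables (R : realType) (X : normedModType R).

(** A plegma tuple of infinite sets. *)
Definition interleaved (m : nat) (A : nat -> nat -> nat) : Prop :=
  [/\ forall j, (j < m)%N -> incr (A j),
      forall i j j', (j < j')%N -> (j' < m)%N -> (A j i < A j' i)%N &
      forall i j j', (j < m)%N -> (j' < m)%N -> (A j i < A j' i.+1)%N].

Lemma sb_norm0 (e : seminormed_basis R) : sb_norm (0 : sb_space e) = 0.
Proof. by rewrite -(scale0r 0) sb_normZ normr0 mul0r. Qed.

Lemma comb_norm_le (e : seminormed_basis R) n (a : 'I_n -> R) : normalized e ->
  (forall j, `|a j| <= 1) -> comb_norm e a <= n%:R.
Proof.
move=> ne a1; rewrite /comb_norm.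
apply: (@le_trans _ _ (\sum_(i < n) `|a i| * sb_norm (e i))).
  elim/big_rec2: _ => [|i y s _ ys]; first by rewrite sb_norm0.
  by apply: le_trans (sb_normD _ _) _; rewrite sb_normZ lerD2l.
have -> : n%:R = \sum_(i < n) (1 : R) by rewrite sumr_const card_ord.
by apply: ler_sum => i _; rewrite ne mulr1.
Qed.

Lemma order_nonempty G xi : hereditary G -> has_order G xi -> ole (osucc ozero) xi ->
  G fset0 /\ ~ maximals G fset0.
Proof.
move=> hG [rho [rk [_ xr]]] h1.
have [s [Gs s0] _] := is_osup_lt (rk fset0) (ole_trans h1 xr).
split; first by apply: hG Gs _; exact: fsub0set.
move=> [_ /(_ _ Gs (fsub0set _)) sE]; move: s0; by rewrite sE fproperEneq eqxx.
Qed.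

(** What is kept of a member of [SMw X xi]. The last clause is what the
    equality of the orders gives: [sigma] carries every node that is not yet
    settled to a non-maximal member of [G0]. *)
Definition spreading_tree (G0 : set {fset nat}) (e : seminormed_basis R)
    (Phi : seq nat -> X) (sigma : nat -> nat) : Prop :=
  [/\ weak_tree Phi,
    forall B, incr B -> `|branch_value Phi B| <= 2,
    forall m (eps : R), 0 < eps -> exists n, forall A, interleaved m A -> (n <= A 0 0)%N ->
      forall a : nat -> R, (forall j, `|a j| <= 1) ->
      `| `|\sum_(j < m) a j *: branch_value Phi (A j)| - comb_norm e (fun j : 'I_m => a j) |
        <= eps
  & forall u (t : {fset nat}), sorted ltn u -> size u = #|` t| ->
      (forall i, (i < size u)%N -> (sigma (nth 0 u i) <= selt t i)%N) ->
      maximals G0 t -> settled Phi u].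

Theorem tree_of_SMw (xi : cord) (G0 : set {fset nat}) (e : seminormed_basis R) :
  ole (osucc ozero) xi -> regular G0 -> has_order G0 xi ->
  normalized e -> SMw X xi e ->
  exists Phi sigma, spreading_tree G0 e Phi sigma.
Proof.
move=> xi1 [_ hG0 spG0] oG0 ne [F [x [L [[G [[cG hG spG] FE oG]] iL [phi [pc px]] wn gen]]]].
subst F.
have [G00 G00n] := order_nonempty hG0 oG0 xi1.
have [Gf0 Gf0n] := order_nonempty hG oG xi1.
have [rho0 [rk0 [_ xr0]]] := oG0.
have [rho [rk [rx _]]] := oG.
have [sg sgP] := compare_families rk rk0 hG hG0 spG0 G00 rx (ole_trans rx xr0).
have [delta [d0 dc gP]] := gen.
(* Beyond [L l0] the vectors of the family have norm at most [2]. *)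
have [l0 l0P] : exists l0, delta l0.+1 <= 1.
  have /cvgrPdist_lt/(_ 1 ltr01)[l _ lP] := dc; exists l.
  have := lP l.+1 (leqnSn l); rewrite /= sub0r normrN => /ltW; apply: le_trans; exact: ler_norm.
have [N [iN NL N0 Nsp]] := sparse_subset hG spG (L l0) iL.
pose Phi := tree_of_family G N phi.
have wt : weak_tree Phi by exact: (tree_of_family_weak_tree cG hG iN Gf0 Gf0n Nsp NL pc px wn).
have leafB B : incr B -> exists u w n, [/\ mkseq B n = u ++ w,
    leaf G N u, restr (maximals G) L (setof (map N u)), u != [::] &
    branch_value Phi B = x (setof (map N u))].
  by move=> iB; exact: (branch_value_leaf cG hG iN Gf0 Gf0n Nsp NL px iB).
have genA k (l : nat) A : interleaved k.+1 A -> (k.+1 <= l)%N -> (L l.-1 <= N (A 0 0))%N ->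
    forall a : nat -> R, (forall j, `|a j| <= 1) ->
    `| `|\sum_(j < k.+1) a j *: branch_value Phi (A j)| - comb_norm e (fun j : 'I_k.+1 => a j) |
      <= delta l.
  move=> [iA A1 A2] kl lN a a1.
  have ex j : exists u, (j < k.+1)%N -> exists w n, [/\ mkseq (A j) n = u ++ w,
     leaf G N u, restr (maximals G) L (setof (map N u)), u != [::] &
     branch_value Phi (A j) = x (setof (map N u))].
    have [jk|jk] := ltnP j k.+1; last by exists [::] => h; exfalso; lia.
    by have [u [w [n P]]] := leafB _ (iA j jk); exists u => _; exists w, n.
  have [u uP] := choice ex.
  have sel j i : (j < k.+1)%N ->
      [/\ sorted ltn (map N (u j)), #|` setof (map N (u j))| = size (u j) &
      (i < size (u j))%N -> selt (setof (map N (u j))) i = N (A j i)].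
    move=> jk; have [w [n [E _ _ _ _]]] := uP j jk.
    have suw := sorted_mkseq n (iA j jk).
    have su : sorted ltn (u j).
      by apply: (subseq_sorted ltn_trans _ suw); rewrite E; exact: prefix_subseq.
    have sNu := sorted_map_incr iN su; split => //.
      by rewrite card_setof// size_map.
    move=> iu; rewrite selt_setof// (nth_map 0%N)//; congr N.
    have iuw : (i < n)%N by rewrite -(size_mkseq (A j) n) E size_cat ltn_addr.
    by rewrite -(nth_mkseq 0%N (A j) iuw) E nth_cat iu.
  rewrite (eq_bigr (fun j : 'I_k.+1 => a j *: x (setof (map N (u j))))); last first.
    by move=> j _; have [w [n [_ _ _ _ ->]]] := uP j (ltn_ord j).
  apply: (gP k l (fun j => a j) (fun j => setof (map N (u j)))) => //.
  - by move=> j; rewrite -ler_norml.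
  - split; last by move=> j; have [w [n []]] := uP j (ltn_ord j).
    split.
    + move=> j; have [w [n [_ _ _ un _]]] := uP j (ltn_ord j).
      rewrite -cardfs_gt0; have [_ -> _] := sel j 0%N (ltn_ord j).
      by rewrite lt0n size_eq0.
    + move=> i j q ij; rewrite leq_min => /andP[].
      have [_ -> hi] := sel i q (ltn_ord i); have [_ -> hj] := sel j q (ltn_ord j).
      by move=> /hi -> /hj ->; apply: iN; exact: A1.
    + move=> i j q; rewrite leq_min => /andP[].
      have [_ -> hi] := sel i q (ltn_ord i); have [_ -> hj] := sel j q.+1 (ltn_ord j).
      move=> /hi -> qj; rewrite hj; first by apply: iN; exact: A2.
      by move: qj; case: (size (u j)).
  - have [w [n [_ _ _ un _]]] := uP 0%N (ltn0Sn k).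
    have [_ _ ->] := sel 0%N 0%N (ltn0Sn k); first exact: lN.
    by rewrite lt0n size_eq0.
exists Phi, (sg \o N); split => //.
- move=> B iB; have il : interleaved 1 (fun=> B).
    split=> [//|i j j' jj'|i j j' _ _]; first by case: j' jj'.
    exact: iB.
  have := genA 0%N l0.+1 (fun=> B) il isT _ (fun=> 1).
  rewrite big_ord1 scale1r /comb_norm big_ord1 scale1r ne normr1 => h.
  have {}h : `| `|branch_value Phi B| - 1 | <= delta l0.+1.
    by apply: h => //=; apply: leq_trans N0 _; exact: incr_leq.
  move: h; rewrite ler_norml => /andP[_]; lra.
- move=> [|k] eps eps0.
    by exists 0%N => A _ _ a _; rewrite big_ord0 /comb_norm big_ord0 sb_norm0 normr0 subr0 normr0 ltW.
  have /cvgrPdist_lt/(_ eps eps0)[l _ lP] := dc.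
  pose l' := maxn l k.+1; exists (L l'.-1) => A il LA a a1.
  apply: (@le_trans _ _ (delta l')).
    apply: genA => //; first by rewrite leq_maxr.
    by apply: leq_trans LA _; exact: incr_ge.
  have := lP l' (leq_maxl _ _); rewrite /= sub0r normrN => /ltW; apply: le_trans; exact: ler_norm.
- move=> u t su ut sut mt; apply: (leaf_settled hG iN Gf0 Nsp) => //.
  have [nst [v' [uE lv]]] := stemP Gf0 Nsp su.
  case: lv => [//|v0]; have us : stem (node G N) u = u by rewrite {2}uE v0 cats0.
  rewrite us; rewrite us in nst; apply: contrapT => nl.
  have [b bP] := seq_bound u; have [c cP] := fset_bound t.
  have sub : sorted ltn (rcons u b) by rewrite sorted_rconsE su.
  pose n := (c + sg (N b))%N.
  have tn y : y \in t -> (y < n)%N by move=> /cP yc; rewrite ltn_addr.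
  have stn := sort_fsetU1_last tn.
  have Gv : G0 (t `|` [fset n])%fset.
    apply: (sgP (map N (rcons u b))) => //.
    - exact: sorted_map_incr.
    - by rewrite fset0U; exact: Nsp.
    - by rewrite card_sort stn cardfs0 size_rcons size_map size_rcons ut -card_sort.
    - move=> i; rewrite size_map size_rcons ltnS => iu; rewrite cardfs0 add0n.
      rewrite (nth_map 0%N) ?size_rcons ?ltnS// /selt stn !nth_rcons -card_sort -ut.
      move: iu; rewrite leq_eqVlt => /predU1P[->|iu]; first by rewrite ltnn eqxx leq_addl.
      by rewrite iu; exact: sut.
  have [_ /(_ _ Gv (fsubsetUl _ _))] := mt.
  by move=> /fsetP/(_ n); rewrite !inE eqxx orbT => /esym/tn; rewrite ltnn.
Qed.

End TreeOfSpreadingModel.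

(** * Weighted sums of interleaved branches *)

Section Weights.
Variables (R : realType) (b : nat -> R).
Hypotheses (b_gt0 : forall k, 0 < b k) (b_summable : cvgn (series b)).

Definition total : R := limn (series b).
Definition tail n : R := total - \sum_(k < n) b k.

Lemma partial_le_total n : \sum_(k < n) b k <= total.
Proof.
have nd : nondecreasing_seq (series b).
  by apply/nondecreasing_seqP => k; rewrite seriesSr lerDl ltW.
have := nondecreasing_cvgn_le nd b_summable n.
by rewrite /series /= big_mkord.
Qed.

Lemma tail_ge0 n : 0 <= tail n.
Proof. by rewrite subr_ge0 partial_le_total. Qed.

Lemma total_ge0 : 0 <= total.
Proof. by have := partial_le_total 0; rewrite big_ord0. Qed.

Lemma tail_small (e : R) : 0 < e -> exists n0, forall n, (n0 <= n)%N -> tail n <= e.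
Proof.
move=> e0; have /cvgrPdist_lt/(_ e e0)[n0 _ nP] := b_summable.
exists n0 => n /nP /=; rewrite /series /= big_mkord => /ltW; apply: le_trans.
exact: ler_norm.
Qed.

Lemma partial_diff_le_tail n n' : \sum_(k < n') b k - \sum_(k < n) b k <= tail n.
Proof. by rewrite /tail lerD2r partial_le_total. Qed.

Variable X : normedModType R.
Implicit Types (t : R) (v : nat -> X).

Lemma weighted_sum_le n t v : (forall k, (k < n)%N -> `|v k| <= 2) ->
  `|\sum_(k < n) (t * b k) *: v k| <= `|t| * (2 * total).
Proof.
move=> v2; apply: le_trans (ler_norm_sum _ _ _) _.
apply: (@le_trans _ _ (\sum_(k < n) (`|t| * 2) * b k)).
  apply: ler_sum => k _; rewrite normrZ normrM (gtr0_norm (b_gt0 _)) mulrAC.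
  by rewrite ler_wpM2r ?(ltW (b_gt0 _))// ler_wpM2l// v2.
by rewrite -mulr_sumr -mulrA ler_wpM2l// ler_wpM2l// partial_le_total.
Qed.

Lemma weighted_sum_trunc n n' t v : (n <= n')%N -> `|t| <= 1 ->
  (forall k, (k < n')%N -> `|v k| <= 2) ->
  `|\sum_(k < n') (t * b k) *: v k - \sum_(k < n) (t * b k) *: v k| <= 2 * tail n.
Proof.
move=> nn t1 v2.
rewrite -!(big_mkord xpredT (fun k => (t * b k) *: v k)) (big_cat_nat (leq0n n) nn) /=.
rewrite addrAC subrr add0r; apply: le_trans (ler_norm_sum _ _ _) _.
apply: (@le_trans _ _ (\sum_(n <= k < n') 2 * b k)).
  apply: ler_sum_nat => k /andP[_ kn]; rewrite normrZ normrM (gtr0_norm (b_gt0 _)).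
  rewrite [leRHS]mulrC; apply: ler_pM; rewrite ?mulr_ge0 ?(ltW (b_gt0 _))//.
    by rewrite ger_pMl// b_gt0.
  exact: v2.
rewrite -mulr_sumr ler_wpM2l//; apply: le_trans (partial_diff_le_tail n n').
by rewrite -!(big_mkord xpredT b) (big_cat_nat (leq0n n) nn) /= addrAC subrr add0r lexx.
Qed.

End Weights.

Lemma sum_divmod (V : nmodType) (F : nat -> V) m n :
  \sum_(r < m * n) F r = \sum_(j < m) \sum_(k < n) F (j * n + k)%N.
Proof.
elim: m => [|m IH]; first by rewrite mul0n !big_ord0.
rewrite big_ord_recr /= -IH -!(big_mkord xpredT) mulSnr.
rewrite (big_cat_nat (leq0n (m * n)) (leq_addr n _)) /=; congr (_ + _).
rewrite -{1}[(m * n)%N]add0n big_addn addKn big_mkord.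
by apply: eq_bigr => k _; rewrite addnC.
Qed.

Lemma sum_ord_zero (V : nmodType) (F : nat -> V) m n : (m <= n)%N ->
  (forall j, (m <= j)%N -> F j = 0) -> \sum_(j < n) F j = \sum_(j < m) F j.
Proof.
move=> mn F0; rewrite -!(big_mkord xpredT F) (big_cat_nat (leq0n m) mn) /=.
rewrite [X in _ + X]big_nat [X in _ + X]big1 ?addr0// => j /andP[mj _].
exact: F0.
Qed.

Section WeightedBranches.
Variables (R : realType) (X : normedModType R) (b : nat -> R).
Hypotheses (b_gt0 : forall k, 0 < b k) (b_summable : cvgn (series b)).
Variable Phi : nat -> seq nat -> X.
Hypothesis Phi_tree : forall k, weak_tree (Phi k).
Hypothesis Phi_bound : forall k B, incr B -> `|branch_value (Phi k) B| <= 2.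

(** One infinite set [B] codes [n * n] interleaved branches; the branch in slot
    [j * n + k] of each block carries the [k]-th of the given vectors in the
    [j]-th term of the linear combination. *)
Definition branch_sum n (a : nat -> R) (B : nat -> nat) : X :=
  \sum_(r < n * n) (a (r %/ n)%N * b (r %% n)%N) *:
     branch_value (Phi (r %% n)%N) (slice (n * n) r B).

Lemma branch_sumE n a B : branch_sum n a B = \sum_(j < n) \sum_(k < n)
  (a j * b k) *: branch_value (Phi k) (slice (n * n) (j * n + k) B).
Proof.
rewrite /branch_sum (sum_divmod (fun r => (a (r %/ n)%N * b (r %% n)%N) *:
  branch_value (Phi (r %% n)%N) (slice (n * n) r B)) n n).
apply: eq_bigr => j _; apply: eq_bigr => k _.
by rewrite modnMDl modn_small// divnMDl ?divn_small ?addn0//; have := ltn_ord k; lia.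
Qed.

Lemma slot_lt n (j k : nat) : (j < n)%N -> (k < n)%N -> (j * n + k < n * n)%N.
Proof. by nia. Qed.

Lemma branch_sum_dist n a a' B : incr B ->
  `|branch_sum n a B - branch_sum n a' B| <= \sum_(j < n) `|a j - a' j| * (2 * total b).
Proof.
move=> iB; rewrite !branch_sumE -sumrB; apply: le_trans (ler_norm_sum _ _ _) _.
apply: ler_sum => j _; rewrite -sumrB.
under eq_bigr => k _ do rewrite -scalerBl -mulrBl.
apply: (@weighted_sum_le _ _ b_gt0 b_summable _ _ _ (fun k => branch_value (Phi k) (slice (n * n) (j * n + k) B))) => //.
by move=> k kn; apply: Phi_bound; apply: incr_slice => //; exact: slot_lt.
Qed.

Lemma branch_sum_bound n a B : incr B -> (forall j, `|a j| <= 1) ->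
  `|branch_sum n a B| <= n%:R * (2 * total b).
Proof.
move=> iB a1; have := @branch_sum_dist n a (fun=> 0) B iB.
have -> : branch_sum n (fun=> 0) B = 0 by rewrite /branch_sum big1// => r _; rewrite mul0r scale0r.
rewrite subr0 => h; apply: le_trans h _.
have -> : n%:R * (2 * total b) = \sum_(j < n) 2 * total b.
  by rewrite sumr_const card_ord mulr_natl.
apply: ler_sum => j _.
rewrite subr0 ler_piMl// mulr_ge0//; exact: total_ge0.
Qed.

Lemma branch_sum_locally_constant n : locally_constant (fun B a => branch_sum n a B).
Proof.
move=> B iB.
have ex r : exists m, (r < n * n)%N -> settled (Phi (r %% n)%N) (mkseq (slice (n * n) r B) m).
  have [rn|nr] := ltnP r (n * n); last by exists 0%N.
  by have [m mP] := wt_bar (Phi_tree (r %% n)%N) (incr_slice rn iB); exists m.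
have [m mP] := choice ex.
exists (\max_(r < n * n) (m r * (n * n) + r).+1)%N => B' iB' BB'.
apply/funext => a; apply: eq_bigr => r _; congr (_ *: _).
have mE : mkseq (slice (n * n) r B') (m r) = mkseq (slice (n * n) r B) (m r).
  apply/eq_in_map => i; rewrite mem_iota add0n => /andP[_ im]; apply: BB'.
  by apply: leq_trans (@leq_bigmax _ (fun r : 'I_(n * n) => (m r * (n * n) + r).+1) r); nia.
rewrite (branch_valueE (incr_slice (ltn_ord r) iB) (mP r (ltn_ord r))).
rewrite (@branch_valueE _ _ _ _ (m r)) ?mE//; first exact: incr_slice.
exact: mP.
Qed.

(** The norm of [branch_sum n a B] depends on [a] with a modulus independent of [B], so
    that its values for [a] in a finite grid suffice for the colouring. *)
Definition grid d (i : 'I_(2 * d.+1).+1) : R := i%:R / d.+1%:R - 1.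

Lemma grid_approx d (t : R) : `|t| <= 1 ->
  exists i : 'I_(2 * d.+1).+1, `|t - grid i| <= d.+1%:R^-1.
Proof.
rewrite ler_norml => /andP[t1 t2]; have d0 : 0 < d.+1%:R :> R by rewrite ltr0n.
have x0 : 0 <= (t + 1) * d.+1%:R by rewrite mulr_ge0// ; lra.
have /andP[le_x x_lt] := truncn_itv x0.
have lt : (Num.truncn ((t + 1) * d.+1%:R) < (2 * d.+1).+1)%N.
  rewrite ltnS -(ler_nat R); apply: le_trans le_x _; rewrite natrM ler_wpM2r//; lra.
exists (Ordinal lt); rewrite /grid /=; set N := Num.truncn _ in le_x x_lt *.
have -> : t - (N%:R / d.+1%:R - 1) = ((t + 1) * d.+1%:R - N%:R) / d.+1%:R.
  by rewrite mulrBl mulfK ?gt_eqF//; ring.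
rewrite normrM normfV (gtr0_norm d0) ger0_norm ?subr_ge0//.
rewrite ler_pdivrMr// mulVf ?gt_eqF//; move: x_lt; rewrite -addn1 natrD; lra.
Qed.

Lemma grid_le1 d (i : 'I_(2 * d.+1).+1) : `|grid i| <= 1.
Proof.
have d0 : 0 < d.+1%:R :> R by rewrite ltr0n.
have i2 : i%:R / d.+1%:R <= 2 :> R.
  by rewrite ler_pdivrMr// -natrM ler_nat -ltnS.
have i0 : 0 <= i%:R / d.+1%:R :> R by rewrite divr_ge0.
rewrite /grid; move: (_ / _) i0 i2 => x i0 i2.
by rewrite ler_norml; apply/andP; split; lra.
Qed.

Definition grid_ext n d (g : {ffun 'I_n -> 'I_(2 * d.+1).+1}) (j : nat) : R :=
  if insub j is Some i then grid (g i) else 0.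

Definition color_bound n d : nat := (Num.truncn (n%:R * (2 * total b) * d.+1%:R)).

Definition color n d (B : nat -> nat) :
    {ffun {ffun 'I_n -> 'I_(2 * d.+1).+1} -> 'I_(color_bound n d).+1} :=
  [ffun g => inord (Num.truncn (`|branch_sum n (grid_ext g) B| * d.+1%:R))].

Lemma grid_ext_le1 n d (g : {ffun 'I_n -> 'I_(2 * d.+1).+1}) j : `|grid_ext g j| <= 1.
Proof. by rewrite /grid_ext; case: insubP => [i _ _|_]; rewrite ?grid_le1// normr0. Qed.

Lemma color_grid n d B B' : incr B -> incr B' -> color n d B = color n d B' ->
  forall g : {ffun 'I_n -> 'I_(2 * d.+1).+1},
  `| `|branch_sum n (grid_ext g) B| - `|branch_sum n (grid_ext g) B'| | <= d.+1%:R^-1.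
Proof.
move=> iB iB' /ffunP cE g; have d0 : 0 < d.+1%:R :> R by rewrite ltr0n.
have lt C : incr C -> (Num.truncn (`|branch_sum n (grid_ext g) C| * d.+1%:R) < (color_bound n d).+1)%N.
  move=> iC; rewrite ltnS; apply: le_truncn; rewrite ler_wpM2r//.
  by apply: branch_sum_bound => // j; exact: grid_ext_le1.
have := congr1 val (cE g); rewrite !ffunE /= !inordK ?lt// => tE.
have pos C : 0 <= `|branch_sum n (grid_ext g) C| * d.+1%:R by rewrite mulr_ge0.
have /andP[h1 h2] := truncn_itv (pos B); have /andP[h3 h4] := truncn_itv (pos B').
rewrite tE in h1 h2; set N := Num.truncn _ in h1 h2 h3 h4.
have nS : N.+1%:R = N%:R + 1 :> R by rewrite -natr1.
rewrite nS in h2 h4.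
rewrite -(ler_pM2r d0) mulVf ?gt_eqF// -{1}(gtr0_norm d0) -normrM mulrBl ler_norml.
by apply/andP; split; lra.
Qed.

Lemma color_close n d B B' a : incr B -> incr B' -> color n d B = color n d B' ->
  (forall j, `|a j| <= 1) ->
  `| `|branch_sum n a B| - `|branch_sum n a B'| | <= (1 + 4 * n%:R * total b) / d.+1%:R.
Proof.
move=> iB iB' cE a1; have d0 : 0 < d.+1%:R :> R by rewrite ltr0n.
have [g gP] : exists g : {ffun 'I_n -> 'I_(2 * d.+1).+1}, forall j : 'I_n,
    `|a j - grid (g j)| <= d.+1%:R^-1.
  have /choice[g gP] : forall j : 'I_n, exists i : 'I_(2 * d.+1).+1,
      `|a j - grid i| <= d.+1%:R^-1 by move=> j; exact: grid_approx.
  by exists [ffun j => g j] => j; rewrite ffunE.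
pose a' j := if (j < n)%N then a j else 0.
have aE C : branch_sum n a C = branch_sum n a' C.
  by rewrite !branch_sumE; apply: eq_bigr => j _; rewrite /a' ltn_ord.
have aa' j : `|a' j - grid_ext g j| <= d.+1%:R^-1.
  rewrite /a' /grid_ext; case: insubP => [i -> <-|/negbTE ->]; first exact: gP.
  by rewrite subrr normr0 invr_ge0.
have dist C : incr C -> `|branch_sum n a' C - branch_sum n (grid_ext g) C| <= 2 * n%:R * total b / d.+1%:R.
  move=> iC; apply: le_trans (branch_sum_dist n _ _ iC) _.
  have -> : 2 * n%:R * total b / d.+1%:R = \sum_(j < n) (d.+1%:R^-1 * (2 * total b)).
    by rewrite sumr_const card_ord -mulr_natl; ring.
  by apply: ler_sum => j _; rewrite ler_wpM2r// mulr_ge0//; exact: total_ge0.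
rewrite !aE.
have h1 := le_trans (ler_dist_dist _ _) (dist B iB).
have h2 := le_trans (ler_dist_dist _ _) (dist B' iB').
have h3 := color_grid iB iB' cE g.
have -> : (1 + 4 * n%:R * total b) / d.+1%:R =
  d.+1%:R^-1 + 2 * n%:R * total b / d.+1%:R + 2 * n%:R * total b / d.+1%:R by ring.
move: h1 h2 h3; set p := 2 * n%:R * total b / d.+1%:R; move: p (d.+1%:R^-1) => p q.
by rewrite !ler_norml => /andP[? ?] /andP[? ?] /andP[? ?]; apply/andP; split; lra.
Qed.

Lemma color_locally_constant n d : locally_constant (color n d).
Proof.
move=> B iB; have [m mP] := branch_sum_locally_constant n iB; exists m => B' iB' BB'.
apply/ffunP => g; rewrite !ffunE.
by have /(congr1 (fun f => f (grid_ext g))) /= -> := mP B' iB' BB'.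
Qed.

(** [H] is homogeneous, up to finitely many elements, for all the colourings
    [color n d], and sets of the same colour give sums of nearly equal norms. *)
Theorem branch_sum_stabilize : exists2 H, incr H &
  forall n (e : R), 0 < e -> exists nu, forall B B', incr B -> incr B' ->
    (nu <= B 0)%N -> (nu <= B' 0)%N -> forall a : nat -> R, (forall j, `|a j| <= 1) ->
    `| `|branch_sum n a (H \o B)| - `|branch_sum n a (H \o B')| | <= e.
Proof.
pose nd (t : nat) : nat * nat := odflt (0, 0)%N (choice.unpickle t).
have [H iH HP] := ramsey_diagonal (fun t => @color_locally_constant (nd t).1 (nd t).2).
exists H => // n e e0.
have [d dP] : exists d : nat, (1 + 4 * n%:R * total b) / d.+1%:R <= e.
  have y0 : 0 <= (1 + 4 * n%:R * total b) / e.
    by rewrite divr_ge0 ?(ltW e0)// addr_ge0// !mulr_ge0//; exact: total_ge0.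
  exists (Num.truncn ((1 + 4 * n%:R * total b) / e)).
  have /andP[_ /ltW] := truncn_itv y0.
  by rewrite ler_pdivrMr// => h; rewrite ler_pdivrMr ?ltr0n// [leRHS]mulrC.
pose t := choice.pickle (n, d); have [c cP] := HP t.
have ndt : nd t = (n, d) by rewrite /nd choice.pickleK.
rewrite ndt /= in c cP; exists t.+1 => B B' iB iB' tB tB' a a1.
apply: le_trans dP; apply: color_close => //; [exact: incr_comp|exact: incr_comp|].
have rg C : incr C -> range (H \o C) `<=` range H by move=> iC _ [i _ <-]; exists (C i).
transitivity c; [|symmetry]; apply: cP; rewrite ?incr_lt//; first exact: incr_comp.
- exact: rg.
- exact: incr_comp.
- exact: rg.
Qed.

End WeightedBranches.

(** * The asymptotic seminorm *)

(** The increasing enumerations used below place consecutive integers in blocks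
    of length [n] that start at [g 0], [g 1], and so on. *)
Lemma incr_blocks (g : nat -> nat) n : (0 < n)%N -> (forall p, g p + n <= g p.+1)%N ->
  incr (fun q => g (q %/ n) + q %% n)%N.
Proof.
move=> n0 gn; apply: incrS => q; have q2 : (q %% n < n)%N by rewrite ltn_mod.
have := gn (q %/ n)%N; set i := (q %/ n)%N; set k := (q %% n)%N in q2 *.
have qE : q.+1 = (i * n + k.+1)%N by rewrite addnS -divn_eq.
have [lt|ge] := ltnP k.+1 n.
  have -> : (q.+1 %/ n)%N = i by rewrite qE divnMDl// divn_small// addn0.
  have -> : (q.+1 %% n)%N = k.+1 by rewrite qE modnMDl modn_small.
  lia.
have kn : k.+1 = n by apply/eqP; rewrite eqn_leq q2.
have -> : (q.+1 %/ n)%N = i.+1 by rewrite qE kn -mulSnr mulnK.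
have -> : (q.+1 %% n)%N = 0%N by rewrite qE kn -mulSnr modnMl.
lia.
Qed.

Section AsymptoticNorm.
Variables (R : realType) (X : normedModType R) (b : nat -> R).
Hypotheses (b_gt0 : forall k, 0 < b k) (b_summable : cvgn (series b)).
Variable Phi : nat -> seq nat -> X.
Hypothesis Phi_bound : forall k B, incr B -> `|branch_value (Phi k) B| <= 2.
Notation wsum := (branch_sum b Phi).
Hypothesis stable : forall n (e : R), 0 < e -> exists nu, forall B B', incr B -> incr B' ->
  (nu <= B 0)%N -> (nu <= B' 0)%N -> forall a : nat -> R, (forall j, `|a j| <= 1) ->
  `| `|wsum n a B| - `|wsum n a B'| | <= e.

Lemma branch_sum_support m n a B : (m <= n)%N -> (forall j, (m <= j)%N -> a j = 0) ->
  wsum n a B = \sum_(j < m) \sum_(k < n)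
    (a j * b k) *: branch_value (Phi k) (slice (n * n) (j * n + k) B).
Proof.
move=> mn a0; rewrite branch_sumE.
pose F j := \sum_(k < n) (a j * b k) *: branch_value (Phi k) (slice (n * n) (j * n + k) B).
apply: (sum_ord_zero (F := F) mn) => j mj; rewrite /F big1// => k _.
by rewrite a0// mul0r scale0r.
Qed.

(** Within [n' * n'] branches, those with indices below [n] form a block of
    [n * n]; the others contribute a tail of the series of weights. *)
Lemma branch_sum_subconfiguration m n n' B : (m <= n)%N -> (n <= n')%N -> incr B ->
  exists B', [/\ incr B', B' 0%N = B 0%N & forall a : nat -> R, (forall j, `|a j| <= 1) ->
    (forall j, (m <= j)%N -> a j = 0) ->
    `| `|wsum n' a B| - `|wsum n a B'| | <= m%:R * (2 * tail b n)].
Proof.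
move=> mn nn iB; have [n0|n0] := posnP n.
  exists B; split => // a _ a0; have m0 : m = 0%N by move: mn; rewrite n0; lia.
  have z k : wsum k a B = 0.
    by rewrite /branch_sum big1// => r _; rewrite a0 ?m0// mul0r scale0r.
  by rewrite !z m0 subrr normr0 mul0r.
pose g p := (((p %/ n) * n' + p %% n) * n')%N.
have gn p : (g p + n <= g p.+1)%N.
  have : incr (fun p => (p %/ n) * n' + p %% n)%N.
    by apply: (@incr_blocks (fun p => p * n')%N) => // q; rewrite mulSn; lia.
  move=> /(_ p p.+1 (ltnSn p)); rewrite /g; nia.
have ig := incr_blocks n0 gn.
exists (fun q => B (g (q %/ n) + q %% n)%N); split.
- exact: (incr_comp iB ig).
- by rewrite div0n mod0n /g div0n mod0n.
move=> a a1 a0; apply: le_trans (ler_dist_dist _ _) _.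
rewrite (branch_sum_support _ (leq_trans mn nn) a0) (branch_sum_support _ mn a0) -sumrB.
apply: le_trans (ler_norm_sum _ _ _) _.
have -> : m%:R * (2 * tail b n) = \sum_(j < m) 2 * tail b n.
  by rewrite sumr_const card_ord mulr_natl.
apply: ler_sum => j _; have jm := ltn_ord j.
have sE (k : 'I_n) : slice (n * n) (j * n + k) (fun q => B (g (q %/ n) + q %% n)%N) =
    slice (n' * n') (j * n' + k) B.
  apply/funext => i; rewrite /slice; have kn := ltn_ord k; congr B.
  have -> : (i * (n * n) + (j * n + k) = (i * n + j) * n + k)%N by lia.
  rewrite divnMDl// divn_small// addn0 modnMDl modn_small// /g.
  rewrite divnMDl// divn_small ?addn0; last lia.
  by rewrite modnMDl modn_small; lia.
under [X in _ - X]eq_bigr => k _ do rewrite sE.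
apply: (weighted_sum_trunc b_gt0 b_summable (v := fun k => branch_value (Phi k) (slice (n' * n') (j * n' + k) B))) => //.
by move=> k kn; apply: Phi_bound; apply: incr_slice => //; apply: slot_lt => //; lia.
Qed.

Lemma branch_sumD n a a' B : wsum n (fun j => a j + a' j) B = wsum n a B + wsum n a' B.
Proof.
by rewrite /branch_sum -big_split; apply: eq_bigr => r _; rewrite mulrDl scalerDl.
Qed.

Lemma branch_sumZ n t a B : wsum n (fun j => t * a j) B = t *: wsum n a B.
Proof.
by rewrite /branch_sum scaler_sumr; apply: eq_bigr => r _; rewrite scalerA mulrA.
Qed.

Lemma coef_sumX m (a : nat -> R) j : (forall j, (m <= j)%N -> a j = 0) ->
  (\sum_(i < m) a i *: 'X^i : {poly R})`_j = a j.
Proof.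
by move=> a0; rewrite -poly_def coef_poly; case: ltnP => // /a0.
Qed.

(** The seminorm is the limit, along an ultrafilter, of the seminorms
    [p |-> `|wsum n p (S n)|]; by [stable] any other sets that start late enough
    give the same limit, up to the tail of the weights. *)
Theorem asymptotic_norm : exists N : {poly R} -> R,
  [/\ forall p, 0 <= N p, forall p q, N (p + q) <= N p + N q,
      forall t p, N (t *: p) = `|t| * N p &
      forall m (e : R), 0 < e -> exists n0, forall n, (n0 <= n)%N -> exists nu, forall B,
        incr B -> (nu <= B 0)%N -> forall a : nat -> R, (forall j, `|a j| <= 1) ->
        (forall j, (m <= j)%N -> a j = 0) ->
        `| `|wsum n a B| - N (\sum_(j < m) a j *: 'X^j) | <= e].
Proof.
have [U [UU Uge]] := ultrafilter_nat.
have d0 n : 0 < n.+1%:R^-1 :> R by rewrite invr_gt0.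
have /choice[nu nuP] := fun n => @stable n _ (d0 n).
(* The set used at level [n] starts beyond the thresholds of all lower levels. *)
pose mu n := (\sum_(i < n.+1) nu i)%N.
have nu_mu n n' : (n <= n')%N -> (nu n <= mu n')%N.
  by move=> nn; rewrite /mu (bigD1 (Ordinal (nn : (n < n'.+1)%N))) //= leq_addr.
pose S n := fun i => (i + mu n)%N.
have iS n : incr (S n) by move=> i j ij; rewrite /S ltn_add2r.
pose u p n : R := `|wsum n (fun j => p`_j) (S n)|.
have ub p : exists C, forall n, `|u p n| <= C.
  exists ((\sum_(j < size p) `|p`_j|) * (2 * total b)) => n; rewrite normr_id.
  have z : wsum n (fun=> 0) (S n) = 0.
    by rewrite /branch_sum big1// => r _; rewrite mul0r scale0r.
  have := @branch_sum_dist _ _ _ b_gt0 b_summable _ Phi_bound n (fun j => p`_j) (fun=> 0) _ (iS n).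
  rewrite z subr0 => /le_trans; apply; rewrite -mulr_suml ler_wpM2r//.
    by rewrite mulr_ge0//; exact: total_ge0.
  under eq_bigr do rewrite subr0.
  rewrite -(@sum_ord_zero _ (fun j => `|p`_j|) _ _ (leq_addl n (size p))).
    by rewrite big_split_ord /= lerDl sumr_ge0.
  by move=> j pj; rewrite nth_default// normr0.
have cu p : cvg (u p @ U) by have [C CP] := ub p; exact: ultra_bounded_cvg CP.
pose N p := lim (u p @ U).
have uN p : u p @ U --> N p := cu p.
exists N; split.
- by move=> p; apply: limr_ge => //; apply: nearW => n; rewrite normr_ge0.
- move=> p q; have uD : (fun n => u p n + u q n) @ U --> N p + N q by apply: cvgD; exact: uN.
  rewrite -(cvg_lim _ uD)//; apply: ler_lim => //; first by apply/cvg_ex; eexists; exact: uD.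
  apply: nearW => n; rewrite /u; under [X in wsum _ X]eq_fun => j do rewrite coefD.
  by rewrite branch_sumD ler_normD.
- move=> t p; have uZ : (fun n => `|t| * u p n) @ U --> `|t| * N p.
    by apply: cvgM; [exact: cvg_cst|exact: uN].
  rewrite -(cvg_lim _ uZ)//; congr (lim (_ @ U)); apply/funext => n.
  rewrite /u; under [X in wsum _ X]eq_fun => j do rewrite coefZ.
  by rewrite branch_sumZ normrZ.
- move=> m e e0; have e4 : 0 < e / (4 * m.+1%:R) by rewrite divr_gt0// mulr_gt0.
  have [n1 n1P] := tail_small b_summable e4.
  pose n2 := (Num.truncn (2 / e)).
  exists (maxn m (maxn n1 n2)) => n; rewrite !geq_max => /and3P[mn /n1P tn n2n].
  exists (nu n) => B iB nuB a a1 a0.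
  have inv : n.+1%:R^-1 <= e / 2.
    rewrite -[e / 2]invrK lef_pV2 ?posrE ?invr_gt0 ?divr_gt0// invf_div.
    have /andP[_ /ltW] := truncn_itv (divr_ge0 (ler0n R 2) (ltW e0)); move=> h.
    by apply: le_trans h _; rewrite ler_nat ltnS.
  have tm : m%:R * (2 * tail b n) <= e / 2.
    apply: (@le_trans _ _ (m.+1%:R * (2 * (e / (4 * m.+1%:R))))).
      apply: ler_pM => //; rewrite ?mulr_ge0 ?tail_ge0//; first by rewrite ler_nat.
      by rewrite ler_wpM2l.
    have m0 : m.+1%:R != 0 :> R by rewrite pnatr_eq0.
    suff -> : m.+1%:R * (2 * (e / (4 * m.+1%:R))) = e / 2 by [].
    by field.
  have near_u n' : (n <= n')%N -> `| `|wsum n a B| - u (\sum_(j < m) a j *: 'X^j) n' | <= e.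
    move=> nn; rewrite /u; under [X in wsum n' X]eq_fun => j do rewrite coef_sumX//.
    have [B' [iB' B'0 B'P]] := branch_sum_subconfiguration mn nn (iS n').
    have h1 := B'P a a1 a0.
    have h2 : `| `|wsum n a B| - `|wsum n a B'| | <= n.+1%:R^-1.
      by apply: nuP => //; rewrite B'0 /S add0n nu_mu.
    move: h1 h2 inv tm; move: (_%:R^-1) (m%:R * _) => r1 r2.
    rewrite !ler_norml => /andP[? ?] /andP[? ?] ? ?.
    by apply/andP; split; lra.
  set p := \sum_(j < m) _ in near_u *; set w := `|wsum n a B| in near_u *.
  have Un := Uge n.
  have h1 : N p <= w + e.
    apply: limr_le => //; apply: filterS Un => n' /near_u.
    by rewrite ler_norml => /andP[h1 h2] /=; rewrite -lerBlDl; lra.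
  have h2 : w - e <= N p.
    apply: limr_ge => //; apply: filterS Un => n' /near_u.
    by rewrite ler_norml => /andP[h1' h2]; lra.
  by rewrite ler_norml; apply/andP; split; lra.
Qed.

End AsymptoticNorm.

(** * Estimates for the asymptotic seminorm *)

Section Estimates.
Variables (R : realType) (X : normedModType R) (b : nat -> R).
Hypotheses (b_gt0 : forall k, 0 < b k) (b_summable : cvgn (series b)).
Variable Phi : nat -> seq nat -> X.
Hypothesis Phi_tree : forall k, weak_tree (Phi k).
Hypothesis Phi_bound : forall k B, incr B -> `|branch_value (Phi k) B| <= 2.
Notation wsum := (branch_sum b Phi).
Variable ek : nat -> seminormed_basis R.
Hypothesis ek_normalized : forall k, normalized (ek k).
Hypothesis Phi_spreading : forall k m (eps : R), 0 < eps ->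
  exists n, forall A, interleaved m A -> (n <= A 0 0)%N ->
  forall a : nat -> R, (forall j, `|a j| <= 1) ->
  `| `|\sum_(j < m) a j *: branch_value (Phi k) (A j)| -
     comb_norm (ek k) (fun j : 'I_m => a j) | <= eps.
Variable N : {poly R} -> R.
Hypothesis N_lim : forall m (e : R), 0 < e ->
  exists n0, forall n, (n0 <= n)%N -> exists nu, forall B,
    incr B -> (nu <= B 0)%N -> forall a : nat -> R, (forall j, `|a j| <= 1) ->
    (forall j, (m <= j)%N -> a j = 0) ->
    `| `|wsum n a B| - N (\sum_(j < m) a j *: 'X^j) | <= e.

Lemma slices_interleaved n k B l : (l <= n)%N -> (k < n)%N -> incr B ->
  interleaved l (fun j => slice (n * n) (j * n + k) B).
Proof.
move=> ln kn iB; split=> [j jl|i j j' jj jl|i j j' jl jl'].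
- by apply: incr_slice => //; apply: slot_lt => //; lia.
- by apply: iB; nia.
- apply: iB; have := @slot_lt n j k (leq_trans jl ln) kn; rewrite mulSn; lia.
Qed.

Lemma weighted_comb_cvg m (a : nat -> R) : (forall j, `|a j| <= 1) ->
  cvgn (series (fun k => b k * comb_norm (ek k) (fun j : 'I_m => a j))).
Proof.
move=> a1; apply: (@series_le_cvg _ _ (fun k => m%:R * b k)) => [k|k|k|].
- by rewrite mulr_ge0 ?(ltW (b_gt0 _)) ?sb_norm_ge0.
- by rewrite mulr_ge0 ?(ltW (b_gt0 _)).
- by rewrite mulrC ler_wpM2r ?(ltW (b_gt0 _))// comb_norm_le.
- exact: is_cvg_seriesZ.
Qed.

Lemma asymptotic_norm_le m (a : nat -> R) : (forall j, `|a j| <= 1) ->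
  (forall j, (m <= j)%N -> a j = 0) -> N (\sum_(j < m) a j *: 'X^j) <=
  limn (series (fun k => b k * comb_norm (ek k) (fun j : 'I_m => a j))).
Proof.
move=> a1 a0; set T := limn _; apply/ler_addgt0Pr => eps eps0.
have S0 := total_ge0 b_gt0 b_summable.
pose e := eps / (2 + total b); have e0 : 0 < e by rewrite divr_gt0//; lra.
have [n0 n0P] := N_lim m e0; pose n := maxn n0 m.
have [nu nuP] := n0P n (leq_maxl _ _); have mn : (m <= n)%N by rewrite leq_maxr.
have /choice[h hP] := fun k => @Phi_spreading k m _ e0.
pose B i := (i + (nu + \max_(k < n) h k))%N.
have iB : incr B by move=> i j ij; rewrite /B ltn_add2r.
have nuB : (nu <= B 0%N)%N by rewrite /B; lia.
have lim := nuP B iB nuB a a1 a0.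
have wle : `|wsum n a B| <= T + total b * e.
  rewrite (branch_sum_support _ _ _ mn a0) exchange_big /=.
  apply: le_trans (ler_norm_sum _ _ _) _.
  apply: (@le_trans _ _ (\sum_(k < n) b k * (comb_norm (ek k) (fun j : 'I_m => a j) + e))).
    apply: ler_sum => k _.
    have -> : \sum_(j < m) (a j * b k) *: branch_value (Phi k) (slice (n * n) (j * n + k) B) =
        b k *: \sum_(j < m) a j *: branch_value (Phi k) (slice (n * n) (j * n + k) B).
      by rewrite scaler_sumr; apply: eq_bigr => j _; rewrite scalerA mulrC.
    rewrite normrZ (gtr0_norm (b_gt0 _)) ler_wpM2l ?(ltW (b_gt0 _))//.
    have := hP k _ (slices_interleaved mn (ltn_ord k) iB) _ a a1.
    rewrite ler_norml => /(_ _)/andP[|_]; last by rewrite lerBlDl.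
    rewrite /slice /B; have : (h k <= \max_(k < n) h k)%N by exact: (leq_bigmax k).
    by lia.
  under eq_bigr => k _ do rewrite mulrDr.
  rewrite big_split /= -mulr_suml; apply: lerD; last first.
    by rewrite ler_wpM2r ?(ltW e0)//; exact: partial_le_total.
  have nd : nondecreasing_seq (series (fun k => b k * comb_norm (ek k) (fun j : 'I_m => a j))).
    apply/nondecreasing_seqP => k; rewrite seriesSr lerDl.
    by rewrite mulr_ge0 ?(ltW (b_gt0 _)) ?sb_norm_ge0.
  have := nondecreasing_cvgn_le nd (@weighted_comb_cvg m a a1) n.
  by rewrite /series /= big_mkord.
have E : eps = total b * e + e + e.
  by rewrite /e; field; rewrite gt_eqF//; lra.
move: lim; rewrite ler_norml => /andP[h1 h2]; lra.
Qed.

(** The terms with index different from [k0] are suppressed. *)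
Lemma asymptotic_norm_ge k0 m (a : nat -> R) : (forall j, `|a j| <= 1) ->
  (forall j, (m <= j)%N -> a j = 0) ->
  b k0 * comb_norm (ek k0) (fun j : 'I_m => a j) <= N (\sum_(j < m) a j *: 'X^j).
Proof.
move=> a1 a0; apply/ler_addgt0Pr => eps eps0.
have b0 := b_gt0 k0.
pose e := eps / (2 + b k0); have e0 : 0 < e by rewrite divr_gt0//; lra.
have [n0 n0P] := N_lim m e0; pose n := maxn n0 (maxn m k0.+1).
have [nu nuP] := n0P n (leq_maxl _ _).
have mn : (m <= n)%N by rewrite !leq_max leqnn orbT.
have kn : (k0 < n)%N by rewrite !leq_max leqnn !orbT.
have [h hP] := @Phi_spreading k0 m _ e0.
have n_gt0 : (0 < n)%N by apply: leq_ltn_trans kn.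
have nn0 : (0 < n * n)%N by rewrite muln_gt0 n_gt0.
have [B [iB hB]] := @suppression R X (n * n) (fun r => Phi (r %% n)%N)
  (fun r => a (r %/ n)%N * b (r %% n)%N) (fun r => (r %% n != k0)%N)
  (fun r _ => Phi_tree _) nn0 e (nu + h) e0.
rewrite -/(wsum n a B) => supp.
have lim := nuP B iB (leq_trans (leq_addr _ _) hB) a a1 a0.
have ge : b k0 * (comb_norm (ek k0) (fun j : 'I_m => a j) - e) <= `|wsum n a B| + e.
  apply: le_trans supp; rewrite big_mkcond /=.
  pose F r := if ~~ (r %% n != k0)%N then (a (r %/ n)%N * b (r %% n)%N) *:
    branch_value (Phi (r %% n)%N) (slice (n * n) r B) else 0.
  rewrite (sum_divmod F n n).
  have E (j : nat) : (j < n)%N -> \sum_(k < n) F (j * n + k)%N =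
      b k0 *: (a j *: branch_value (Phi k0) (slice (n * n) (j * n + k0) B)).
    move=> jn; rewrite (bigD1 (Ordinal kn)) //= big1 ?addr0 => [|k kk0].
      by rewrite /F modnMDl modn_small// eqxx /= divnMDl// divn_small// addn0 scalerA mulrC.
    rewrite /F modnMDl modn_small//; case: ifP => // /negPn/eqP kE.
    by move: kk0; rewrite -val_eqE /= kE eqxx.
  rewrite (eq_bigr (fun j : 'I_n => b k0 *: (a j *: branch_value (Phi k0)
    (slice (n * n) (j * n + k0) B)))); last by move=> j _; exact: E.
  rewrite -scaler_sumr normrZ (gtr0_norm b0) ler_wpM2l ?(ltW b0)//.
  pose G j := a j *: branch_value (Phi k0) (slice (n * n) (j * n + k0) B).
  rewrite (@sum_ord_zero _ G _ _ mn); last by move=> j mj; rewrite /G a0// scale0r.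
  have := hP _ (slices_interleaved mn kn iB) _ a a1.
  rewrite ler_norml => /(_ _)/andP[|]; last by move=> h1 _; rewrite lerBlDr -lerBlDl; lra.
  rewrite /slice; apply: leq_trans (leq_addl nu h) _; apply: leq_trans hB _.
  exact: incr_leq.
have E : eps = b k0 * e + e + e by rewrite /e; field; rewrite gt_eqF//; lra.
move: lim; rewrite ler_norml => /andP[h1 h2].
by rewrite mulrBr in ge; lra.
Qed.

(** The branches with index [m] are those with index [0] after a translation. *)
Lemma asymptotic_norm_shift m : N 'X^m = N 'X^0.
Proof.
have delta_le1 (i j : nat) : `|(i == j)%:R : R| <= 1.
  by case: eqP => _; rewrite ?normr1// normr0.
have sumE i l : (i < l)%N -> \sum_(j < l) ((j : nat) == i)%:R *: 'X^j = 'X^i :> {poly R}.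
  move=> il; rewrite (bigD1 (Ordinal il)) //= eqxx scale1r big1 ?addr0// => j.
  by rewrite -val_eqE /= => /negbTE ->; rewrite scale0r.
apply/eqP; rewrite -subr_eq0 -normr_le0; apply/ler_addgt0Pr => e e0; rewrite add0r.
have e2 : 0 < e / 2 by rewrite divr_gt0.
have [n1 n1P] := N_lim m.+1 e2; have [n2 n2P] := N_lim 1 e2.
pose n := (n1 + n2 + m.+1)%N.
have n1n : (n1 <= n)%N by rewrite /n; lia.
have [nu1 nu1P] := n1P n n1n.
have n2n : (n2 <= n)%N by rewrite /n; lia.
have [nu2 nu2P] := n2P n n2n.
pose B i := (i + (nu1 + nu2))%N; have iB : incr B by move=> i j ij; rewrite /B ltn_add2r.
pose B' i := B (i + m * n)%N.
have iB' : incr B' by move=> i j ij; rewrite /B'; apply: iB; rewrite ltn_add2r.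
have h1 := fun h => nu1P B iB h (fun j => (j == m)%:R) (fun j => delta_le1 _ _).
have h2 := fun h => nu2P B' iB' h (fun j => (j == 0)%N%:R) (fun j => delta_le1 _ _).
rewrite sumE// in h1; rewrite sumE// in h2.
have E : wsum n (fun j => (j == m)%:R) B = wsum n (fun j => (j == 0)%N%:R) B'.
  have single i C : (i < n)%N -> wsum n (fun j => (j == i)%:R) C =
      \sum_(k < n) b k *: branch_value (Phi k) (slice (n * n) (i * n + k) C).
    move=> il; rewrite branch_sumE (bigD1 (Ordinal il)) //= eqxx [X in _ + X]big1 ?addr0 => [|j].
      by apply: eq_bigr => k _; rewrite mul1r.
    rewrite -val_eqE /= => /negbTE ->; rewrite big1// => k _.
    by rewrite mul0r scale0r.
  rewrite !single; try by rewrite /n; lia.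
  apply: eq_bigr => k _; congr (_ *: branch_value _ _); apply/funext => i.
  by rewrite /slice /B'; congr B; lia.
move: h1 h2; rewrite E; set w := `|wsum n _ B'| => h1 h2.
have {}h1 : `|w - N 'X^m| <= e / 2.
  by apply: h1 => [|j mj]; [rewrite /B; lia|case: eqP => // jm; move: mj; rewrite jm ltnn].
have {}h2 : `|w - N 'X^0| <= e / 2.
  by apply: h2 => [|j mj]; [rewrite /B' /B; lia|case: eqP => // jm; move: mj; rewrite jm].
move: h1 h2; rewrite !ler_norml => /andP[? ?] /andP[? ?]; apply/andP; split; lra.
Qed.

End Estimates.

(** * From plegma families to interleaved branches *)

Section PlegmaBranches.
Variables (m n : nat) (s : nat -> seq nat).
Hypotheses (m_gt0 : (0 < m)%N) (mn : (m <= n)%N).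
Hypothesis s_nonempty : forall j, (j < m)%N -> (0 < size (s j))%N.
Hypothesis s_large : forall j y, (j < m)%N -> y \in s j -> (n * n <= y)%N.
Hypothesis s_lt : forall j j' i, (j < j')%N -> (j' < m)%N -> (i < size (s j))%N ->
  (i < size (s j'))%N -> (nth 0 (s j) i < nth 0 (s j') i)%N.
Hypothesis s_ltS : forall j j' i, (j < m)%N -> (j' < m)%N -> (i < size (s j))%N ->
  (i.+1 < size (s j'))%N -> (nth 0 (s j) i < nth 0 (s j') i.+1)%N.

(** Block [i * n + j] is reserved for the [i]-th element of [s j]; it is absent
    when [s j] is too short. *)
Definition present p : bool := (p %% n < m)%N && (p %/ n < size (s (p %% n)%N))%N.
Definition entry p : nat := nth 0%N (s (p %% n)%N) (p %/ n)%N.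
(** The least start of block [p] that leaves [n] places to each block and places
    every entry [y] not before [y * y]; [block_start_present] says that the
    gaps between squares are large enough for equality. *)
Definition block_start p : nat :=
  (\max_(p' < p.+1 | present p') (entry p' * entry p' + n * (p - p')))%N.

Let n_gt0 : (0 < n)%N := leq_trans m_gt0 mn.

Lemma present0 : present 0.
Proof. by rewrite /present mod0n div0n m_gt0 s_nonempty. Qed.

Lemma block_start_step p : (block_start p + n <= block_start p.+1)%N.
Proof.
have [|p' Pp' E] := @eq_bigmax_cond _ [pred p' : 'I_p.+1 | present p']
    (fun p' => (entry p' * entry p' + n * (p - p')))%N.
  by apply/card_gt0P; exists ord0; rewrite inE present0.
have p'p := ltn_ord p'; have p'p1 : (p' < p.+2)%N by lia.
have := @leq_bigmax_cond _ (fun p' : 'I_p.+2 => present p')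
  (fun p' => (entry p' * entry p' + n * (p.+1 - p')))%N (Ordinal p'p1) Pp'.
rewrite -/(block_start p.+1) /=; move: E; rewrite -/(block_start p) => ->.
by apply: leq_trans; rewrite subSn// mulnS; lia.
Qed.

Lemma entry_lt p p' : present p' -> present p -> (p' < p)%N -> (p <= p' + n)%N ->
  (entry p' < entry p)%N.
Proof.
move=> /andP[jm' is'] /andP[jm is_] lt le; rewrite /entry.
have e := divn_eq p n; have e' := divn_eq p' n.
have l := ltn_pmod p n_gt0; have l' := ltn_pmod p' n_gt0.
move: jm is_ jm' is' e e' l l'; set i := (p %/ n)%N; set j := (p %% n)%N.
set i' := (p' %/ n)%N; set j' := (p' %% n)%N => jm is_ jm' is' e e' l l'.
have [ii|ii|ii] := ltngtP i i'.
- by exfalso; nia.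
- have iE : i = i'.+1 by nia.
  by rewrite iE; apply: s_ltS => //; rewrite -iE.
- rewrite ii in is_ e *; apply: s_lt => //; nia.
Qed.

Lemma entry_ge p : present p -> (n * n <= entry p)%N.
Proof. by move=> /andP[jm is_]; apply: (s_large jm); exact: mem_nth. Qed.

Lemma entry_gap p p' : present p' -> present p -> (p' <= p)%N ->
  (entry p' * entry p' + n * (p - p') <= entry p * entry p)%N.
Proof.
move=> Pp'; elim/ltn_ind: p => p IH Pp; rewrite leq_eqVlt => /predU1P[->|lt].
  by rewrite subnn muln0 addn0.
have sq q : present q -> (q < p)%N -> (p <= q + n)%N ->
    (entry q * entry q + n * n <= entry p * entry p)%N.
  move=> Pq qp pq; have := entry_lt Pq Pp qp pq; have := entry_ge Pq; nia.
have [le|gt] := leqP p (p' + n).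
  by apply: leq_trans (sq p' Pp' lt le); rewrite leq_add2l leq_mul2l; apply/orP; right; lia.
have Pq : present (p - n).
  have pE : p = (p - n + 1 * n)%N by lia.
  move: Pp; rewrite /present {1 2 3}pE mul1n modnDr divnDr ?dvdnn// divnn n_gt0.
  by move=> /andP[-> h]; rewrite (leq_trans _ h)//; lia.
have h1 := IH (p - n)%N _ Pq _; have h2 := sq (p - n)%N Pq _ _.
apply: (@leq_trans (entry (p - n) * entry (p - n) + n * n)); last by apply: h2; lia.
apply: (@leq_trans (entry p' * entry p' + n * (p - n - p') + n * n)).
  by rewrite -addnA -mulnDr leq_add2l leq_mul2l; apply/orP; right; lia.
by rewrite leq_add2r; apply: h1; lia.
Qed.

Lemma block_start_present p : present p -> block_start p = (entry p * entry p)%N.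
Proof.
move=> Pp; apply/eqP; rewrite eqn_leq; apply/andP; split.
  by apply/bigmax_leqP => p' Pp'; apply: entry_gap => //; rewrite -ltnS.
have := @leq_bigmax_cond _ (fun p' : 'I_p.+1 => present p')
  (fun p' => (entry p' * entry p' + n * (p - p')))%N ord_max Pp.
by rewrite /= subnn muln0 addn0.
Qed.

Lemma plegma_branches : exists2 B, incr B & forall j k, (j < m)%N -> (k < n)%N ->
  mkseq (slice (n * n) (j * n + k) B) (size (s j)) = [seq (y * y + k)%N | y <- s j].
Proof.
have iB := incr_blocks n_gt0 block_start_step.
exists (fun q => block_start (q %/ n) + q %% n)%N => // j k jm kn.
apply: (@eq_from_nth _ 0%N); rewrite size_mkseq ?size_map// => i is_.
rewrite nth_mkseq// (nth_map 0%N)// /slice.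
have -> : (i * (n * n) + (j * n + k) = (i * n + j) * n + k)%N by lia.
have jn := leq_trans jm mn.
rewrite divnMDl// divn_small// addn0 modnMDl modn_small//.
have jE : ((i * n + j) %% n = j)%N by rewrite modnMDl modn_small.
have iE : ((i * n + j) %/ n = i)%N by rewrite divnMDl// divn_small// addn0.
by rewrite block_start_present /present /entry jE iE// jm.
Qed.

End PlegmaBranches.

(** * The family realizing the asymptotic seminorm *)

Section Realization.
Variables (R : realType) (X : normedModType R) (b : nat -> R).
Hypotheses (b_gt0 : forall k, 0 < b k) (b_summable : cvgn (series b)).
Variable Phi : nat -> seq nat -> X.
Hypothesis Phi_tree : forall k, weak_tree (Phi k).
Hypothesis Phi_bound : forall k B, incr B -> `|branch_value (Phi k) B| <= 2.
Variables (G0 : set {fset nat}) (sigma : nat -> nat -> nat).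
Hypothesis Phi_settled : forall k u (t : {fset nat}), sorted ltn u -> size u = #|` t| ->
  (forall i, (i < size u)%N -> (sigma k (nth 0 u i) <= selt t i)%N) ->
  maximals G0 t -> settled (Phi k) u.
Variables (N : {poly R} -> R) (K : R).
Hypothesis K_gt0 : 0 < K.
Hypothesis N_lim : forall m (e : R), 0 < e ->
  exists n0, forall n, (n0 <= n)%N -> exists nu, forall B,
    incr B -> (nu <= B 0)%N -> forall a : nat -> R, (forall j, `|a j| <= 1) ->
    (forall j, (m <= j)%N -> a j = 0) ->
    `| `|branch_sum b Phi n a B| - N (\sum_(j < m) a j *: 'X^j) | <= e.

(** With this enumeration, [shifted k s] is settled for the [k]-th tree whenever
    the image of [s] is maximal and [k] is below the least element of [s]. *)
Definition spread_enum (y : nat) : nat :=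
  (\sum_(y' < y.+1) (\sum_(k < y') sigma k (y' * y' + k)).+1)%N.
Notation L := spread_enum.

Lemma spread_enum_incr : incr L.
Proof. by apply: incrS => y; rewrite /L [X in (_ < X)%N]big_ord_recr /= -addSnnS leq_addr. Qed.

Lemma spread_enum_ge k y : (k < y)%N -> (sigma k (y * y + k) <= L y)%N.
Proof.
move=> ky; rewrite /L big_ord_recr /=; apply: leq_trans (leq_addl _ _).
by apply: leqW; rewrite (bigD1 (Ordinal ky)) //= leq_addr.
Qed.

(** The squares leave room between consecutive elements for the branches of
    all indices. *)
Definition shifted k (s : seq nat) : seq nat := [seq (y * y + k)%N | y <- s].

Lemma sorted_shifted k s : sorted ltn s -> sorted ltn (shifted k s).
Proof. by apply: sorted_map_incr => i j ij; rewrite ltn_add2r; nia. Qed.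

(** The least element of [s] decides how many trees take part, so that the sum
    is finite and, at nonempty nodes, depends continuously on [s]. *)
Definition zvec (s : seq nat) : X :=
  K^-1 *: \sum_(k < head 0%N s) b k *: Phi k (shifted k s).

Notation lset s := (setof (map L s)).

Definition zmap (c : cantor_space) : weak_space X :=
  zvec (xget [::] [set s | sorted ltn s /\ charf (lset s) = c]).

Lemma charf_inj : injective charf.
Proof. by move=> s t st; apply/fsetP => x; exact: (congr1 (fun c : cantor_space => c x) st). Qed.

Lemma lset_inj s s' : sorted ltn s -> sorted ltn s' -> lset s = lset s' -> s = s'.
Proof.
move=> ss ss' /setof_inj E; apply: (inj_map (incr_inj spread_enum_incr)).
by apply: E; apply: sorted_map_incr => //; exact: spread_enum_incr.
Qed.

Lemma zmapE s : sorted ltn s -> zmap (charf (lset s)) = zvec s.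
Proof.
move=> ss; rewrite /zmap; case: xgetP => [s' _ [ss' E]|/(_ s)[]//].
by congr zvec; apply: lset_inj => //; exact: charf_inj.
Qed.

Lemma range_lset (t : {fset nat}) : (forall n, n \in t -> range L n) ->
  exists2 s, sorted ltn s & t = lset s.
Proof.
move=> tL.
have ex n : exists y, n \in t -> L y = n.
  have [nt|nt] := boolP (n \in t); last by exists 0%N.
  by have [y _ Ly] := tL n nt; exists y.
have [g gP] := choice ex.
have E : map L (map g (sort leq t)) = sort leq t.
  by rewrite -map_comp -[RHS]map_id; apply/eq_in_map => n; rewrite mem_sort => /gP.
exists (map g (sort leq t)); last by rewrite E setof_sort.
have := sorted_sort t; rewrite -{1}E sorted_map; apply: sub_sorted => x y /=.
by rewrite (incr_lt _ _ spread_enum_incr).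
Qed.

Lemma head_le (s : seq nat) y : sorted ltn s -> y \in s -> (head 0 s <= y)%N.
Proof.
case: s => // x s /=; rewrite (path_sortedE ltn_trans) inE => /andP[/allP xs _].
by move=> /predU1P[->//|/xs/ltnW].
Qed.

Lemma shifted_settled k s : sorted ltn s -> maximals G0 (lset s) -> (k < head 0 s)%N ->
  settled (Phi k) (shifted k s).
Proof.
move=> ss Gs ks; have sL := sorted_map_incr spread_enum_incr ss.
apply: (Phi_settled (t := lset s)) => //; first exact: sorted_shifted.
  by rewrite card_setof// !size_map.
move=> i; rewrite size_map => is_; rewrite selt_setof// !(nth_map 0%N)//.
by apply: spread_enum_ge; apply: leq_trans ks _; apply: head_le => //; exact: mem_nth.
Qed.

Lemma settled_bound k u : sorted ltn u -> settled (Phi k) u -> `|Phi k u| <= 2.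
Proof.
move=> su st; have [B [iB Bu _]] := branch_through 0 su.
by have := Phi_bound k iB; rewrite (@branch_valueE _ _ _ _ (size u)) ?Bu.
Qed.

Lemma dual_bound (f : dual X) : exists2 C : R, 0 < C & forall x, `|f x| <= C * `|x|.
Proof.
have /linear_boundedP/pinfty_ex_gt0[C C0 CP] :=
  (linear_bounded_continuous (dual_fun f)).2 (@dual_continuous _ _ f).
by exists C.
Qed.

Lemma node_weak_bound (f : dual X) (C : R) k u : (forall x, `|f x| <= C * `|x|) -> 0 < C ->
  sorted ltn u -> `|f (Phi k u)| <= 2 * C.
Proof.
move=> fC C0 su; apply/ler_addgt0Pr => e e0.
have [n nP] := wt_cont (Phi_tree k) f su e0.
have [B [iB Bu Bn]] := branch_through n su.
have [m mP] := branch_value_settled (Phi_tree k) iB.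
have [_ bv] := mP (m + size u)%N (leq_addr _ _).
have E := mkseq_split B (leq_addl m (size u)); rewrite Bu in E.
have /ltW h1 : `|f (Phi k (mkseq B (m + size u))) - f (Phi k u)| < e.
  rewrite E; apply: nP; first by rewrite -E; exact: sorted_mkseq.
  by move=> y /mapP[i]; rewrite mem_iota => /andP[ui _] ->; exact: Bn.
have h2 : `|f (Phi k (mkseq B (m + size u)))| <= 2 * C.
  rewrite -bv mulrC; apply: le_trans (fC _) _.
  by rewrite ler_wpM2l ?(ltW C0)// Phi_bound.
move: h1 h2; move: (f (Phi k (mkseq _ _))) (f (Phi k u)) => p q h1 h2.
have := ler_normD (p : R) (q - p : R); rewrite (addrC p) subrK (distrC q).
move: h1 h2; rewrite -/(p - q); move: (`|q|) (`|p|) (`|p - q|) => x y z; lra.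
Qed.

Lemma dual_zvec (f : dual X) s :
  f (zvec s) = K^-1 * \sum_(k < head 0%N s) b k * f (Phi k (shifted k s)) :> R.
Proof.
rewrite /zvec linearZ /=; congr (_ * _); rewrite linear_sum /=.
by apply: eq_bigr => k _; rewrite linearZ.
Qed.

(** The first terms are small by continuity at the root, the others because
    their weights are summable and the trees weakly bounded. *)
Lemma zvec_null (f : dual X) (e : R) : 0 < e -> exists n, forall s, sorted ltn s ->
  (forall y, y \in s -> (n <= y)%N) -> `|f (zvec s)| < e.
Proof.
move=> e0; have [C C0 fC] := dual_bound f.
have S0 := total_ge0 b_gt0 b_summable.
pose e1 := e * K / (4 * C); have e10 : 0 < e1 by rewrite divr_gt0 ?mulr_gt0.
pose e2 := e * K / (4 * (1 + total b)).
have e20 : 0 < e2 by rewrite divr_gt0 ?mulr_gt0//; lra.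
have [n1 n1P] := tail_small b_summable e10.
have /choice[g gP] := fun k => wt_cont (Phi_tree k) f (isT : sorted ltn [::]) e20.
exists (\max_(k < n1) g k)%N => s ss sn.
have small k : (k < n1)%N -> `|f (Phi k (shifted k s))| <= e2.
  move=> kn; have := gP k (shifted k s) (sorted_shifted k ss).
  rewrite (wt_root (Phi_tree k)) subr0 => h; apply: ltW; apply: h => y /mapP[z /sn nz ->].
  apply: leq_trans (@leq_bigmax _ (fun k : 'I_n1 => g k) (Ordinal kn)) _.
  by apply: leq_trans nz _; nia.
have Kinv : `|K^-1| = K^-1 by rewrite gtr0_norm ?invr_gt0.
rewrite dual_zvec normrM Kinv mulrC ltr_pdivrMr//.
set h := head 0%N s.
apply: (@le_lt_trans _ _ (e2 * total b + 2 * C * tail b n1)).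
  apply: le_trans (ler_norm_sum _ _ _) _.
  apply: (@le_trans _ _ (\sum_(k < h + n1) b k * `|f (Phi k (shifted k s))|)).
    rewrite [leRHS]big_split_ord /=.
    apply: (@le_trans _ _ (\sum_(k < h) b k * `|f (Phi k (shifted k s))|)).
      by apply: ler_sum => k _; rewrite normrM (gtr0_norm (b_gt0 _)).
    by rewrite lerDl sumr_ge0// => k _; rewrite mulr_ge0// ltW.
  rewrite addnC big_split_ord /=; apply: lerD.
    apply: (@le_trans _ _ (\sum_(k < n1) e2 * b k)).
      by apply: ler_sum => k _; rewrite mulrC ler_wpM2r ?(ltW (b_gt0 _))// small.
    by rewrite -mulr_sumr ler_wpM2l ?(ltW e20)// partial_le_total.
  apply: (@le_trans _ _ (\sum_(k < h) 2 * C * b (n1 + k)%N)).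
    apply: ler_sum => k _; rewrite mulrC ler_wpM2r ?(ltW (b_gt0 _))//.
    by apply: node_weak_bound => //; exact: sorted_shifted.
  rewrite -mulr_sumr ler_wpM2l ?mulr_ge0 ?(ltW C0)//.
  have := partial_diff_le_tail b_gt0 b_summable n1 (n1 + h).
  by rewrite big_split_ord /= addrAC subrr add0r.
have h1 : e2 * total b <= e * K / 4.
  rewrite /e2; have -> : e * K / (4 * (1 + total b)) * total b =
     (e * K / 4) * (total b / (1 + total b)) by field; rewrite gt_eqF//; lra.
  rewrite ler_piMr//; first by rewrite divr_ge0// mulr_ge0 ?ltW.
  by rewrite ler_pdivrMr; lra.
have h2 : 2 * C * tail b n1 <= e * K / 2.
  have := ler_wpM2l (ltW C0) (n1P n1 (leqnn _)); rewrite /e1.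
  have -> : C * (e * K / (4 * C)) = e * K / 4 by field; rewrite gt_eqF.
  rewrite -[2 * C * _]mulrA; move: (C * tail b n1) (e * K) => p q; lra.
have : 0 < e * K by rewrite mulr_gt0.
move: h1 h2; move: (e2 * _) (2 * C * _) (e * K) => p q r; lra.
Qed.

Lemma zvec_cont (f : dual X) s (e : R) : sorted ltn s -> s != [::] -> 0 < e ->
  exists n, forall w, sorted ltn (s ++ w) -> (forall y, y \in w -> (n <= y)%N) ->
    `|f (zvec (s ++ w)) - f (zvec s)| < e.
Proof.
move=> ss s0 e0; have S0 := total_ge0 b_gt0 b_summable.
pose e1 := e * K / (1 + total b).
have e10 : 0 < e1 by rewrite divr_gt0 ?mulr_gt0//; lra.
have /choice[g gP] := fun k => wt_cont (Phi_tree k) f (sorted_shifted k ss) e10.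
set h := head 0%N s; exists (\max_(k < h) g k)%N => w sw wn.
have hE : head 0%N (s ++ w) = h by rewrite /h; case: (s) s0.
rewrite !dual_zvec hE -mulrBr -sumrB normrM.
have Kinv : `|K^-1| = K^-1 by rewrite gtr0_norm ?invr_gt0.
rewrite Kinv mulrC ltr_pdivrMr//.
apply: (@le_lt_trans _ _ (\sum_(k < h) e1 * b k)).
  apply: le_trans (ler_norm_sum _ _ _) _; apply: ler_sum => k _.
  rewrite -mulrBr normrM (gtr0_norm (b_gt0 _)) mulrC ler_wpM2r ?(ltW (b_gt0 _))//.
  rewrite /shifted map_cat; apply: ltW; apply: gP.
    by rewrite -map_cat; exact: sorted_shifted.
  move=> y /mapP[z /wn nz ->]; apply: leq_trans (@leq_bigmax _ (fun k : 'I_h => g k) k) _.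
  by apply: leq_trans nz _; nia.
rewrite -mulr_sumr; apply: (@le_lt_trans _ _ (e1 * total b)).
  by rewrite ler_wpM2l ?(ltW e10)// partial_le_total.
rewrite /e1 mulrAC ltr_pdivrMr; last lra.
by rewrite ltr_pM2l ?mulr_gt0//; lra.
Qed.

(** At the empty set, where the number of terms of [zvec] is not locally
    constant, continuity is [zvec_null]. *)
Lemma zmap_subordinated (F : set {fset nat}) : subordinated F (fun t => zmap (charf t)) L.
Proof.
exists zmap; split => //; apply/within_weak_continuousP => f c e [t [_ tL] <-] e0.
have [s ss ->] := range_lset tL.
have [s0|sn0] := eqVneq s [::].
  have [n nP] := zvec_null f e0.
  exists (L n) => c' [t' [_ tL'] <-] agr; have [s' ss' t'E] := range_lset tL'.
  subst t'; rewrite !zmapE// s0 /zvec /= big_ord0 scaler0 linear0 subr0.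
  apply: nP => // y ys'; rewrite leqNgt; apply/negP => yn.
  have := agr (L y); rewrite (incr_lt _ _ spread_enum_incr) => /(_ yn).
  rewrite /charf !in_setof s0 in_nil => /negP; apply; exact: map_f.
have [n nP] := zvec_cont f ss sn0 e0; have [M MP] := seq_bound s.
exists (L (n + M)) => c' [t' [_ tL'] <-] agr; have [s' ss' t'E] := range_lset tL'.
subst t'; rewrite !zmapE//.
pose w := [seq y <- s' | (n + M <= y)%N].
have sE : s' = s ++ w.
  have mem y : (y < n + M)%N -> (y \in s') = (y \in s).
    move=> yM; have := agr (L y); rewrite (incr_lt _ _ spread_enum_incr) => /(_ yM).
    by rewrite /charf !in_setof !(mem_map (incr_inj spread_enum_incr)).
  have ssw : sorted ltn (s ++ w).
    rewrite (sorted_pairwise ltn_trans) pairwise_cat -!(sorted_pairwise ltn_trans).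
    rewrite ss (sorted_filter ltn_trans)// andbT andbT; apply/allrelP => x y xs.
    rewrite mem_filter => /andP[ny _]; have /= := allP MP x xs; lia.
  apply: (irr_sorted_eq ltn_trans ltnn) => // y; rewrite mem_cat mem_filter.
  case: (leqP (n + M) y) => yM /=; last by rewrite orbF mem.
  suff /negbTE -> : y \notin s by [].
  by apply/negP => /(allP MP) /=; lia.
rewrite sE; apply: nP; first by rewrite -sE.
by move=> y; rewrite mem_filter => /andP[? _]; lia.
Qed.

Lemma zmap_weakly_null (F : set {fset nat}) : weakly_null F (fun t => zmap (charf t)) L.
Proof.
move=> f e e0; have [n nP] := zvec_null f e0; exists (L n) => t [_ tL].
have [s ss ->] := range_lset tL.
rewrite selt_setof; last exact: sorted_map_incr spread_enum_incr ss.
case: s ss => [|y s] ss.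
  by rewrite zmapE// /zvec /= big_ord0 scaler0 linear0 normr0.
rewrite zmapE//= (leqNgt (L n)) (incr_lt _ _ spread_enum_incr) -leqNgt => ny.
by apply: nP => // z /(head_le ss); exact: leq_trans.
Qed.

(** The members of a plegma tuple are extended to interleaved infinite sets on
    which the trees take the same values; the number of trees in [zvec] and in
    [branch_sum] then differ by a tail of the weights. *)
Lemma zvec_spreading m (e : R) : 0 < e -> exists n0, forall s : nat -> seq nat,
  (forall j, (j < m)%N -> [/\ sorted ltn (s j), (0 < size (s j))%N & maximals G0 (lset (s j))]) ->
  (forall j j' i, (j < j')%N -> (j' < m)%N -> (i < size (s j))%N ->
    (i < size (s j'))%N -> (nth 0 (s j) i < nth 0 (s j') i)%N) ->
  (forall j j' i, (j < m)%N -> (j' < m)%N -> (i < size (s j))%N ->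
    (i.+1 < size (s j'))%N -> (nth 0 (s j) i < nth 0 (s j') i.+1)%N) ->
  (n0 <= head 0 (s 0))%N -> forall a : nat -> R, (forall j, `|a j| <= 1) ->
  (forall j, (m <= j)%N -> a j = 0) ->
  `| `|\sum_(j < m) a j *: zvec (s j)| - N (\sum_(j < m) a j *: 'X^j) / K | <= e.
Proof.
move=> e0; pose e1 := e * K / 2; have e10 : 0 < e1 by rewrite divr_gt0 ?mulr_gt0.
have [p0 p0P] := N_lim m e10.
have e2 : 0 < e1 / (2 * m.+1%:R) by rewrite divr_gt0 ?mulr_gt0.
have [p1 p1P] := tail_small b_summable e2.
pose n := (p0 + p1 + m.+1)%N.
have p0n : (p0 <= n)%N by rewrite /n; lia.
have [nu nuP] := p0P n p0n.
have mn : (m <= n)%N by rewrite /n; lia.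
have n_gt0 : (0 < n)%N by rewrite /n; lia.
have tn : m%:R * (2 * tail b n) <= e1.
  have tp : tail b n <= e1 / (2 * m.+1%:R) by apply: p1P; rewrite /n; lia.
  apply: (@le_trans _ _ (m.+1%:R * (2 * (e1 / (2 * m.+1%:R))))).
    apply: ler_pM => //; rewrite ?mulr_ge0 ?tail_ge0//; first by rewrite ler_nat.
    by rewrite ler_wpM2l.
  have m0 : m.+1%:R != 0 :> R by rewrite pnatr_eq0.
  suff -> : m.+1%:R * (2 * (e1 / (2 * m.+1%:R))) = e1 by [].
  by field.
exists (n * n + n + nu)%N => s sP s1 s2 hs a a1 a0.
have head_s j : (j < m)%N -> (head 0 (s 0%N) <= head 0 (s j))%N.
  case: j => // j jm; have m0 : (0 < m)%N by lia.
  have := s1 0%N j.+1 0%N (ltn0Sn j) jm.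
  have [_ h0 _] := sP _ m0; have [_ hj _] := sP _ jm.
  by rewrite !nth0 => /(_ h0 hj)/ltnW.
have large j y : (j < m)%N -> y \in s j -> (n * n + n + nu <= y)%N.
  move=> jm ys; apply: leq_trans hs _; apply: leq_trans (head_s j jm) _.
  by apply: head_le ys; have [] := sP j jm.
have [B iB [nuB BP]] : exists2 B, incr B & (nu <= B 0)%N /\
   forall j k, (j < m)%N -> (k < n)%N ->
     mkseq (slice (n * n) (j * n + k) B) (size (s j)) = shifted k (s j).
  have [m0|m0] := posnP m.
    exists (fun i => i + nu)%N; first by move=> i j ij; rewrite ltn_add2r.
    by split => // j k; rewrite m0.
  have [||B iB BP] := @plegma_branches m n s m0 mn _ _ s1 s2.
  - by move=> j jm; have [] := sP j jm.
  - by move=> j y jm ys; have := large j y jm ys; lia.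
  exists B => //; split => //.
  have := congr1 (fun u => nth 0%N u 0) (BP 0%N 0%N m0 n_gt0).
  have [_ h0 _] := sP _ m0; rewrite nth_mkseq// (nth_map 0%N)// /slice !mul0n !addn0 => ->.
  have := large 0%N (nth 0%N (s 0%N) 0) m0 (mem_nth 0%N h0); nia.
have lim := nuP B iB nuB a a1 a0.
have headn j : (j < m)%N -> (n <= head 0 (s j))%N.
  by move=> jm; apply: leq_trans (head_s j jm); lia.
have close : `|\sum_(j < m) \sum_(k < head 0%N (s j)) (a j * b k) *: Phi k (shifted k (s j))
    - branch_sum b Phi n a B| <= e1.
  rewrite (branch_sum_support _ _ _ mn a0) -sumrB; apply: le_trans tn.
  apply: le_trans (ler_norm_sum _ _ _) _.
  have -> : m%:R * (2 * tail b n) = \sum_(j < m) 2 * tail b n.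
    by rewrite sumr_const card_ord mulr_natl.
  apply: ler_sum => j _; have jm := ltn_ord j; have [sj _ Gj] := sP j jm.
  have E (k : 'I_n) : branch_value (Phi k) (slice (n * n) (j * n + k) B) = Phi k (shifted k (s j)).
    have st : settled (Phi k) (shifted k (s j)).
      by apply: shifted_settled => //; apply: leq_trans (headn j jm).
    rewrite (@branch_valueE _ _ _ _ (size (s j))) ?BP//.
    by apply: incr_slice => //; apply: slot_lt => //; lia.
  under [X in _ - X]eq_bigr => k _ do rewrite E.
  apply: (weighted_sum_trunc b_gt0 b_summable (v := fun k => Phi k (shifted k (s j)))) => //.
    exact: headn.
  by move=> k kh; apply: settled_bound; [exact: sorted_shifted|exact: shifted_settled].
have zE : \sum_(j < m) a j *: zvec (s j) = K^-1 *:
    \sum_(j < m) \sum_(k < head 0%N (s j)) (a j * b k) *: Phi k (shifted k (s j)).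
  rewrite scaler_sumr; apply: eq_bigr => j _; rewrite /zvec scalerA mulrC -scalerA.
  by rewrite scaler_sumr; congr (_ *: _); apply: eq_bigr => k _; rewrite scalerA.
have Kinv : `|K^-1| = K^-1 by rewrite gtr0_norm ?invr_gt0.
rewrite zE normrZ Kinv [K^-1 * _]mulrC -mulrBl normrM Kinv ler_pdivrMr//.
have := le_trans (ler_dist_dist _ _) close; move: lim.
have eE : e * K = e1 + e1 by rewrite /e1; field.
rewrite eE !ler_norml => /andP[? ?] /andP[? ?]; apply/andP; split; lra.
Qed.

End Realization.

(** * Subsequences, coefficients and monomial bases *)

Section Subsequences.
Variables (R : realType) (X : normedModType R) (F : set {fset nat}).
Variables (x : {fset nat} -> X) (L L' : nat -> nat).
Hypothesis LL' : range L' `<=` range L.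

Lemma restr_sub (G : set {fset nat}) : restr G L' `<=` restr G L.
Proof. by move=> s [Gs sL]; split => // n /sL; exact: LL'. Qed.

Lemma subordinated_sub : subordinated F x L -> subordinated F x L'.
Proof.
move=> [phi [pc px]]; exists phi; split; last by move=> s /restr_sub; exact: px.
by apply: continuous_subspaceW pc => _ [s /restr_sub sL <-]; exists s.
Qed.

Lemma weakly_null_sub : weakly_null F x L -> weakly_null F x L'.
Proof.
by move=> wn f e /(wn f)[n nP]; exists n => s /restr_sub; exact: nP.
Qed.

End Subsequences.

Section FunctionExtension.
Variables (R : realType) (m : nat) (a : 'I_m -> R).

Definition extend_zero (j : nat) : R := if insub j is Some i then a i else 0.

Lemma extend_zeroE (i : 'I_m) : extend_zero i = a i.
Proof. by rewrite /extend_zero valK. Qed.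

Lemma extend_zero0 j : (m <= j)%N -> extend_zero j = 0.
Proof. by move=> mj; rewrite /extend_zero insubF// ltnNge mj. Qed.

Lemma extend_zero_le1 : (forall i, `|a i| <= 1) -> forall j, `|extend_zero j| <= 1.
Proof. by move=> a1 j; rewrite /extend_zero; case: insub => [i|]; rewrite ?a1// normr0. Qed.

Lemma sum_extend_zero (V : lmodType R) (v : nat -> V) :
  \sum_(j < m) extend_zero j *: v j = \sum_(j < m) a j *: v j.
Proof. by apply: eq_bigr => j _; rewrite extend_zeroE. Qed.

End FunctionExtension.

(** The space spanned by [e] is modelled by polynomials, whose monomials are
    a Hamel basis for any seminorm. *)
Section PolynomialBasis.
Variables (R : realType) (N : {poly R} -> R) (K : R).
Hypotheses (N_ge0 : forall p, 0 <= N p) (N_D : forall p q, N (p + q) <= N p + N q)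
  (N_Z : forall t p, N (t *: p) = `|t| * N p) (K_gt0 : 0 < K).

Lemma free_monomials n (a : 'I_n -> R) :
  \sum_(i < n) a i *: 'X^i = 0 :> {poly R} -> forall i, a i = 0.
Proof.
move=> s0 i; have := congr1 (fun p : {poly R} => p`_i) s0.
rewrite -(sum_extend_zero a (fun i => 'X^i)) coef_sumX ?coef0 ?extend_zeroE//.
exact: extend_zero0.
Qed.

Lemma span_monomials (p : {poly R}) : exists n (a : 'I_n -> R),
  p = \sum_(i < n) a i *: 'X^i.
Proof. by exists (size p), (fun i => p`_i); rewrite -poly_def coefK. Qed.

Definition polynomial_basis : seminormed_basis R.
Proof.
apply: (@SeminormedBasis R {poly R} (fun p => N p / K) (fun n => 'X^n)).
- by move=> p; rewrite divr_ge0// ltW.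
- by move=> p q; rewrite -mulrDl ler_wpM2r// invr_ge0 ltW.
- by move=> t p; rewrite N_Z mulrA.
- exact: free_monomials.
- exact: span_monomials.
Defined.

End PolynomialBasis.

Lemma comb_normZ (R : realType) (e : seminormed_basis R) n (t : R) (a : 'I_n -> R) :
  comb_norm e (fun i => t * a i) = `|t| * comb_norm e a.
Proof.
rewrite /comb_norm -sb_normZ scaler_sumr; congr sb_norm.
by apply: eq_bigr => i _; rewrite scalerA.
Qed.

(** * Generation of the monomial basis *)

Section Generation.
Variables (R : realType) (X : normedModType R) (b : nat -> R).
Hypotheses (b_gt0 : forall k, 0 < b k) (b_summable : cvgn (series b)).
Variable Phi : nat -> seq nat -> X.
Hypothesis Phi_bound : forall k B, incr B -> `|branch_value (Phi k) B| <= 2.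
Variables (G0 : set {fset nat}) (sigma : nat -> nat -> nat).
Hypothesis Phi_settled : forall k u (t : {fset nat}), sorted ltn u -> size u = #|` t| ->
  (forall i, (i < size u)%N -> (sigma k (nth 0 u i) <= selt t i)%N) ->
  maximals G0 t -> settled (Phi k) u.
Variables (N : {poly R} -> R) (K : R).
Hypotheses (N_ge0 : forall p, 0 <= N p) (N_D : forall p q, N (p + q) <= N p + N q)
  (N_Z : forall t p, N (t *: p) = `|t| * N p) (K_gt0 : 0 < K).
Hypothesis N_lim : forall m (e : R), 0 < e ->
  exists n0, forall n, (n0 <= n)%N -> exists nu, forall B,
    incr B -> (nu <= B 0)%N -> forall a : nat -> R, (forall j, `|a j| <= 1) ->
    (forall j, (m <= j)%N -> a j = 0) ->
    `| `|branch_sum b Phi n a B| - N (\sum_(j < m) a j *: 'X^j) | <= e.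

Notation L := (spread_enum sigma).
Notation lset s := (setof (map L s)).
Notation x := (fun t => zmap b Phi sigma K (charf t) : X).

(** Thinning makes the thresholds of [zvec_spreading] for [m] vectors and error
    [1 / (l + 1)] effective below the [l]-th element. *)
Lemma realization_generates : exists2 g, incr g &
  generates (maximals G0) x (L \o g) (polynomial_basis N_ge0 N_D N_Z K_gt0).
Proof.
have e0 i : 0 < i.+2%:R^-1 :> R by rewrite invr_gt0.
have /choice[n0 n0P] : forall mi : nat * nat, exists n0, _ :=
  fun mi => @zvec_spreading _ _ _ b_gt0 b_summable _ Phi_bound _ _ Phi_settled _ _ K_gt0 N_lim
    mi.1 _ (e0 mi.2).
pose g i := (\sum_(i' < i.+1) (\sum_(m < i'.+2) n0 (val m, val i')).+1)%N.
have ig : incr g.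
  by apply: incrS => i; rewrite /g [X in (_ < X)%N]big_ord_recr /= -addSnnS leq_addr.
have gn0 m i : (m <= i.+1)%N -> (n0 (m, i) <= g i)%N.
  move=> mi; rewrite /g big_ord_recr /=; apply: leq_trans (leq_addl _ _); apply: leqW.
  by rewrite (bigD1 (Ordinal (mi : (m < i.+2)%N))) //= leq_addr.
have iL := spread_enum_incr sigma.
(* [n0P] gives the error [1 / (l - 1).+2], which is [harmonic l] for [l > 0]. *)
exists g => //; exists harmonic; split.
- by move=> n; rewrite /harmonic /= invr_gt0.
- exact: cvg_harmonic.
move=> k l a s kl a1 [[sne sp1 sp2] sF] s0.
have ex (j : nat) : exists u, forall jm : (j < k.+1)%N, sorted ltn u /\ s (Ordinal jm) = lset u.
  have [jm|jm] := pselect (j < k.+1)%N; last by exists [::] => jm'; exfalso; exact: jm.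

  have [_ sL] := sF (Ordinal jm).
  have [|u su uE] := range_lset (sigma := sigma) (t := s (Ordinal jm)).
    by move=> n /sL[i _ <-]; exists (g i).
  by exists u => jm'; have -> : Ordinal jm' = Ordinal jm by exact: val_inj.
have [u uP] := choice ex.
have cardu j (jm : (j < k.+1)%N) : #|` s (Ordinal jm)| = size (u j).
  have [su ->] := uP j jm; by rewrite card_setof ?size_map//; exact: sorted_map_incr.
have selu j (jm : (j < k.+1)%N) i : (i < size (u j))%N ->
    selt (s (Ordinal jm)) i = L (nth 0%N (u j) i).
  have [su ->] := uP j jm => iu; rewrite selt_setof ?(nth_map 0%N)//.
  exact: sorted_map_incr.
have l_gt0 : l = l.-1.+1 by rewrite prednK//; lia.
have sizeu j (jm : (j < k.+1)%N) : (0 < size (u j))%N.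
  by rewrite -(cardu j jm) cardfs_gt0.
have := n0P (k.+1, l.-1) u _ _ _ _ (extend_zero a) _ _.
rewrite /= -l_gt0 => H.
rewrite -(sum_extend_zero a (fun j => 'X^j)).
have -> : \sum_(j < k.+1) a j *: (zmap b Phi sigma K (charf (s j)) : X) =
    \sum_(j < k.+1) extend_zero a j *: zvec b Phi K (u j).
  apply: eq_bigr => j _; rewrite extend_zeroE; congr (_ *: _).
  have [su sE] := uP j (ltn_ord j); rewrite -(@zmapE _ _ b Phi sigma K _ su) -sE.
  by congr (zmap _ _ _ _ (charf (s _))); exact: val_inj.
rewrite /harmonic /=; apply: H.
- move=> j jm; have [su sE] := uP j jm; split => //; first exact: sizeu jm.
  by rewrite -sE; case: (sF (Ordinal jm)).
- move=> j j' i jj' j'm iu iu'; have jm := ltn_trans jj' j'm.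
  have := sp1 (Ordinal jm) (Ordinal j'm) i jj'.
  rewrite !cardu leq_min iu iu' !selu// incr_lt//; exact.
- move=> j j' i jm j'm iu iu'.
  have h : (i < minn (size (u j)) (size (u j')).-1)%N by rewrite leq_min iu; lia.
  have := sp2 (Ordinal jm) (Ordinal j'm) i; rewrite !cardu => /(_ h).
  by rewrite !selu// incr_lt.
- apply: leq_trans (gn0 _ _ _) _; first by rewrite -l_gt0.
  have k0 : (0 < k.+1)%N by [].
  have E : ord0 = Ordinal k0 by exact: val_inj.
  move: s0; rewrite E selu ?sizeu// /= leqNgt incr_lt// -leqNgt nth0; exact.
- by apply: extend_zero_le1 => i; rewrite ler_norml.
- exact: extend_zero0.
Qed.

End Generation.

Theorem theorem19 (R : realType) (X : completeNormedModType R) (xi : cord)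
  (hxi : ole (osucc ozero) xi)
  (c : nat -> R) (c_gt0 : forall k, 0 < c k)
  (c_summable : cvgn (series (fun k => (c k)^-1)))
  (ek : nat -> seminormed_basis R)
  (ek_normalized : forall k, normalized (ek k))
  (ek_SM : forall k, SMw X xi (ek k)) :
  exists (e : seminormed_basis R) (K : R),
    [/\ SMw X xi e,
        (forall k, (c k)^-1 <= K) /\ K <= limn (series (fun k => (c k)^-1)),
        normalized e,
        (forall k, dominates (c k * K) e (ek k))
      & forall (l : nat) (a : 'I_l -> R), (forall j, -1 <= a j <= 1) ->
          comb_norm e a <=
            K^-1 * limn (series (fun k => (c k)^-1 * comb_norm (ek k) a))].
Proof.
pose b k := (c k)^-1; have b_gt0 k : 0 < b k by rewrite invr_gt0.
have [F0 [_ [_ [[G0 [rG0 _ oG0]] _ _ _ _]]]] := ek_SM 0%N.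
have /choice[Phi0 /choice[sigma0 P0]] := fun k =>
  tree_of_SMw hxi rG0 oG0 (ek_normalized k) (ek_SM k).
have T0 k : weak_tree (Phi0 k) by case: (P0 k).
have B0 k B : incr B -> `|branch_value (Phi0 k) B| <= 2 by case: (P0 k) => _ h _ _; exact: h.
have [H iH stab] := branch_sum_stabilize b_gt0 c_summable T0 B0.
pose Phi k := (Phi0 k) \o map H; pose sigma k := (sigma0 k) \o H.
have bvE k B : incr B -> branch_value (Phi k) B = branch_value (Phi0 k) (H \o B).
  by move=> iB; apply: branch_value_map.
have Phi_tree k : weak_tree (Phi k) by apply: weak_tree_map.
have Phi_bound k B : incr B -> `|branch_value (Phi k) B| <= 2.
  by move=> iB; rewrite bvE//; apply: B0; exact: incr_comp.
have sumH n a B : incr B -> branch_sum b Phi n a B = branch_sum b Phi0 n a (H \o B).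
  by move=> iB; apply: eq_bigr => r _; rewrite bvE//; exact: incr_slice.
have Phi_spreading k m (eps : R) : 0 < eps -> exists n, forall A, interleaved m A ->
    (n <= A 0 0)%N -> forall a : nat -> R, (forall j, `|a j| <= 1) ->
    `| `|\sum_(j < m) a j *: branch_value (Phi k) (A j)| -
      comb_norm (ek k) (fun j : 'I_m => a j) | <= eps.
  move=> e0; have [_ _ /(_ m eps e0)[n nP] _] := P0 k; exists n => A [iA A1 A2] nA a a1.
  rewrite (eq_bigr (fun j : 'I_m => a j *: branch_value (Phi0 k) (H \o A j))); last first.
    by move=> j _; rewrite bvE//; exact: iA.
  apply: (nP (fun j => H \o A j)) => //.
    split=> [j jm|i j j' jj jm|i j j' jm jm'] /=.
    - by apply: incr_comp => //; exact: iA.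
    - by apply: iH; exact: A1.
    - by apply: iH; exact: A2.
  by apply: leq_trans nA _; exact: incr_ge.
have Phi_settled k u (t : {fset nat}) : sorted ltn u -> size u = #|` t| ->
    (forall i, (i < size u)%N -> (sigma k (nth 0 u i) <= selt t i)%N) ->
    maximals G0 t -> settled (Phi k) u.
  move=> su ut sut mt; apply: settled_map => //; have [_ _ _ h] := P0 k.
  apply: (h _ t) => //; rewrite ?size_map//; first exact: sorted_map_incr.
  by move=> i iu; rewrite (nth_map 0%N)//; exact: sut.
have [|N [N_ge0 N_D N_Z N_lim]] := asymptotic_norm b_gt0 c_summable Phi_bound.
  move=> n e e0; have [nu nuP] := stab n e e0.
  by exists nu => B B' iB iB' nB nB' a a1; rewrite !sumH//; exact: nuP.
have upper l (a : 'I_l -> R) : (forall i, `|a i| <= 1) -> N (\sum_(j < l) a j *: 'X^j) <=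
    limn (series (fun k => b k * comb_norm (ek k) a)).
  move=> a1; rewrite -(sum_extend_zero a (fun j => 'X^j)).
  apply: le_trans (asymptotic_norm_le b_gt0 c_summable ek_normalized Phi_spreading N_lim
    (extend_zero_le1 a1) (@extend_zero0 _ _ a)) _.
  rewrite le_eqVlt; apply/orP; left; apply/eqP; congr (limn (series _)).
  by apply/funext => k; congr (_ * comb_norm _ _); apply/funext => j; rewrite extend_zeroE.
have lower k l (a : 'I_l -> R) : (forall i, `|a i| <= 1) ->
    b k * comb_norm (ek k) a <= N (\sum_(j < l) a j *: 'X^j).
  move=> a1; rewrite -(sum_extend_zero a (fun j => 'X^j)).
  apply: le_trans (asymptotic_norm_ge b_gt0 Phi_tree Phi_spreading N_lim k
    (extend_zero_le1 a1) (@extend_zero0 _ _ a)).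
  rewrite le_eqVlt; apply/orP; left; apply/eqP; congr (_ * comb_norm _ _).
  by apply/funext => j; rewrite extend_zeroE.
pose K := N 'X^0.
have one1 (i : 'I_1) : `|1 : R| <= 1 by rewrite normr1.
have comb1 k : comb_norm (ek k) (fun _ : 'I_1 => 1 : R) = 1.
  by rewrite /comb_norm big_ord1 scale1r ek_normalized.
have sum1 : \sum_(j < 1) (1 : R) *: 'X^j = 'X^0 :> {poly R} by rewrite big_ord1 scale1r.
have K_ge k : b k <= K by have := lower k 1%N _ one1; rewrite comb1 mulr1 sum1.
have K_gt0 : 0 < K := lt_le_trans (b_gt0 0%N) (K_ge 0%N).
pose e := polynomial_basis N_ge0 N_D N_Z K_gt0; exists e, K; split.
- have [g ig gen] := realization_generates b_gt0 c_summable Phi_bound Phi_settled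
    N_ge0 N_D N_Z K_gt0 N_lim.
  have sub : range (spread_enum sigma \o g) `<=` range (spread_enum sigma).
    by move=> _ [i _ <-]; exists (g i).
  exists (maximals G0), (fun t => zmap b Phi sigma K (charf t)), (spread_enum sigma \o g); split.
  + by exists G0.
  + exact: (incr_comp (spread_enum_incr sigma) ig).
  + apply: (subordinated_sub sub); exact: zmap_subordinated.
  + apply: (weakly_null_sub sub); exact: zmap_weakly_null.
  + exact: gen.
- split; first exact: K_ge.
  have := upper 1%N _ one1; rewrite sum1; under eq_fun do rewrite comb1 mulr1; exact.
- move=> n; rewrite /e /=; rewrite (asymptotic_norm_shift N_lim) divff ?gt_eqF//.
- move=> k l a.
  have [M M0 aM] : exists2 M : R, 0 < M & forall i, `|M^-1 * a i| <= 1.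
    exists (1 + \sum_i `|a i|); first by rewrite ltr_wpDr// sumr_ge0.
    move=> i; have M0 : 0 < 1 + \sum_i `|a i| by rewrite ltr_wpDr// sumr_ge0.
    rewrite normrM normfV (gtr0_norm M0) mulrC ler_pdivrMr// mul1r.
    by rewrite (bigD1 i) //= addrCA lerDl addr_ge0// sumr_ge0.
  have := lower k l _ aM.
  have -> : \sum_(j < l) (M^-1 * a j) *: 'X^j = M^-1 *: \sum_(j < l) a j *: 'X^j :> {poly R}.
    by rewrite scaler_sumr; apply: eq_bigr => j _; rewrite scalerA.
  rewrite comb_normZ N_Z mulrCA ler_pM2l ?normr_gt0 ?invr_eq0 ?gt_eqF//.
  rewrite -(ler_pM2l (c_gt0 k)) mulrA /b mulfV ?gt_eqF// mul1r.
  suff -> : c k * K * comb_norm e a = c k * N (\sum_(j < l) a j *: 'X^j) by [].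
  by rewrite /comb_norm /=; field; rewrite gt_eqF.
- move=> l a a1; rewrite /comb_norm /= mulrC ler_pM2l ?invr_gt0//.
  by apply: upper => i; rewrite ler_norml.
Qed.
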